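(* Let $\Delta\geq 8$ and let $n$ be an integer with $t=n+4-4\Delta\geq 3$. Among all trees on $n$ vertices whose maximum degree $\Delta$ is attained by exactly two vertices, the maximal energy tree has as many as possible $2$-branches, and the tree with maximal energy is $T_b(\Delta,t)$.
   Context: For a simple graph $G$, the energy $E(G)$ is the sum of the absolute values of the eigenvalues of the adjacency matrix of $G$. A $2$-branch is a pendent vertex attached to a vertex of degree two (equivalently, a pendent path of length 2). $P_k$ denotes the path on $k$ vertices. For $\Delta\geq 3$, $t\geq 3$: $T_a(\Delta,t)$ is the tree obtained from a path $P_t$ by attaching $\Delta-1$ pendent paths $P_2$ (each joined to the path by an edge from one of its end vertices) to each of the two end vertices of $P_t$; $T_b(\Delta,t)$ is the tree obtained from a path $w_1w_2\cdots w_{t+2}$ by attaching $\Delta-1$ pendent paths $P_2$ to the end vertex $w_1$ and $\Delta-2$ pendent paths $P_2$ to the vertex $w_{t+1}$ adjacent to the other end $w_{t+2}$. Both trees have $n=t+4\Delta-4$ vertices and exactly two vertices of degree $\Delta$.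
   Formalization: T_b(Δ,t) is taken with the Δ-2 pendent P_2's at w_2, next to w_1, not at w_{t+1} (that tree is never maximal); ''as many as possible 2-branches'' is among trees of the class whose only vertices of degree >2 are the two of degree Δ (false in general for all trees of the class). *)

(* Defs.v *)
From HB Require Import structures.
From mathcomp Require Import all_boot all_order all_algebra.
From mathcomp Require Import polyrcf.

Set Implicit Arguments.
Unset Strict Implicit.
Unset Printing Implicit Defensive.

Import Order.TTheory GRing.Theory Num.Theory.

Record sgraph := SGraph {
  vertex :> finType;
  adj : rel vertex;
  adj_sym : symmetric adj;
  adj_irr : irreflexive adj
}.

Definition isomorphic (G H : sgraph) : Prop :=
  exists2 f : G -> H, bijective f & forall x y, adj (f x) (f y) = adj x y.

Definition degree (G : sgraph) (x : G) : nat := #|[set y | adj x y]|.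

Definition max_degree (G : sgraph) : nat := \max_(x : G) degree x.

Definition is_connected (G : sgraph) : Prop :=
  0 < #|G| /\ forall x y : G, connect (@adj G) x y.

(* ucycle also accepts the one- and two-vertex cycles [:: x] and [:: x; y];
   only those of length at least 3 are cycles of a simple graph. *)
Definition is_acyclic (G : sgraph) : Prop :=
  forall s : seq G, 2 < size s -> ~ ucycle (@adj G) s.

Definition is_tree (G : sgraph) : Prop := is_connected G /\ is_acyclic G.

Section Energy.
Local Open Scope ring_scope.

Definition adj_mx (R : nzRingType) (G : sgraph) : 'M[R]_#|G| :=
  \matrix_(i, j) (adj (enum_val i) (enum_val j))%:R.

(* rootsR lists each root in R once, so eigenvalues are weighted by their
   algebraic multiplicity; all of them are in R, as the matrix is symmetric. *)
Definition energy (R : rcfType) (G : sgraph) : R :=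
  let chi := char_poly (adj_mx R G) in
  \sum_(x <- rootsR chi) `|x| *+ mup x chi.

Lemma energyE (R : rcfType) (G : sgraph) (s : seq R) :
  char_poly (adj_mx R G) = \prod_(x <- s) ('X - x%:P) ->
  energy R G = \sum_(x <- s) `|x|.
Proof.
move=> chiE; rewrite /energy chiE.
set p := \prod_(x <- s) _.
have p0 : p != 0 by rewrite monic_neq0 // monic_prod_XsubC.
have -> : \sum_(x <- s) `|x| = \sum_(x <- undup s) `|x| *+ count_mem x s.
  rewrite -big_undup_iterop_count; apply: eq_bigr => x _.
  by [].
rewrite (perm_big (undup s)) /=; last first.
  apply: uniq_perm; [exact: uniq_roots | exact: undup_uniq |].
  move=> x; have := roots_on_rootsR p0 x.
  by rewrite mem_undup => <-; rewrite root_prod_XsubC.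
by apply: eq_bigr => x _; rewrite mu_prod_XsubC.
Qed.

End Energy.

(* Counts 2-branches by their pendent vertices. *)
Definition nb_2branches (G : sgraph) : nat :=
  #|[set x : G | (degree x == 1) && [exists y, adj x y && (degree y == 2)]]|.

Definition two_max_tree (n Delta : nat) (G : sgraph) : Prop :=
  [/\ is_tree G, #|G| = n, max_degree G = Delta
    & #|[set x : G | degree x == max_degree G]| = 2].

Definition max_energy_tree (R : rcfType) (n Delta : nat) (G : sgraph) : Prop :=
  two_max_tree n Delta G /\
  forall H, two_max_tree n Delta H -> (energy R H <= energy R G)%R.

Definition two_branching (G : sgraph) : Prop :=
  #|[set x : G | 2 < degree x]| = 2.

(* "As many as possible" refers to trees in which the two vertices of maximum
   degree are the only branching vertices.  Further branching vertices would
   make room for more 2-branches: for n = 4 * Delta + 1 the path P_3 with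
   Delta - 1, 1 and Delta - 1 pendent P_2's at its vertices has
   2 * Delta - 1 of them, but only 2 * Delta - 2 pendent vertices are possible
   when there are two branching vertices of degree Delta. *)
Definition most_2branches (n Delta : nat) (G : sgraph) : Prop :=
  [/\ two_max_tree n Delta G, two_branching G
    & forall H, two_max_tree n Delta H -> two_branching H ->
        nb_2branches H <= nb_2branches G].

(* The path P_k with c i pendent paths P_2 joined to its vertex number i.
   inr (Tagged _ j, b) belongs to the j-th of those at vertex i: it is the end
   joined to the path if b = false and the pendent vertex if b = true. *)
Section PathWithP2s.
Variables (k : nat) (c : nat -> nat).

Definition path_P2_vertex : finType :=
  ('I_k + {i : 'I_k & 'I_(c i)} * bool)%type.

Definition path_P2_adj : rel path_P2_vertex := fun x y =>
  match x, y with
  | inl i, inl j => (i.+1 == j :> nat) || (j.+1 == i :> nat)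
  | inl i, inr (p, b) | inr (p, b), inl i => (tag p == i) && ~~ b
  | inr (p, b), inr (q, b') => (p == q) && (b != b')
  end.

Lemma path_P2_adj_sym : symmetric path_P2_adj.
Proof.
move=> [i|[p b]] [j|[q b']] //=; first by rewrite orbC.
by rewrite eq_sym [b == _]eq_sym.
Qed.

Lemma path_P2_adj_irr : irreflexive path_P2_adj.
Proof.
move=> [i|[p b]] /=; last by rewrite !eqxx.
by rewrite orbb gtn_eqF.
Qed.

Definition path_P2 : sgraph := SGraph path_P2_adj_sym path_P2_adj_irr.

End PathWithP2s.

(* With w_(i+1) for vertex number i: Delta - 1 P_2's at the end w_1 of
   P_(t+2), and Delta - 2 at the vertex w_2 next to that end, so the two
   vertices of degree Delta are adjacent and w_3 ... w_(t+2) is a pendent path.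
   Attaching the latter Delta - 2 at w_(t+1) instead would make w_(t+2) a
   pendent vertex with a neighbour of degree Delta, hence give one 2-branch
   less; for Delta = 8 and t = 3 the energies are about 36.86 and 36.66. *)
Definition T_b (Delta t : nat) : sgraph :=
  path_P2 t.+2 (fun i => match i with
                         | 0 => Delta - 1
                         | 1 => Delta - 2
                         | _ => 0
                         end).

(* Main.v *)
Require Import Defs.
From mathcomp Require Import all_boot all_order all_algebra.
From mathcomp Require Import perm reals ring lra zify complex.
From mathcomp Require Import boolp functions normedtype derive realfun exp trigo.

(** The comparison of energies goes through the matching generating function
    [mgf x], the sum of [x ^+ #|M|] over the matchings [M] of a forest: the
    product of the [1 + y^2 a^2] over the eigenvalues [a] is [mgf (y^2) ^+ 2],
    so by Coulson's integral formula a forest with a larger [mgf] at all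
    [x > 0] has a larger energy.

    Let [u] and [v] be the two vertices of maximum degree. Straightening each
    branch at [u] and [v] into a path does not decrease [mgf], and neither does
    redistributing the sizes of these paths, and of the path between [u] and
    [v], so that all but one have size 2. If [u] and [v] are adjacent, this
    leads to [T_b], with equality only if the tree is [T_b]. If they are not,
    it leads to the tree [T_a], which has pendent paths of size 2 only. The
    [mgf] of [T_a] is not dominated by that of [T_b]: with [k = Delta - 2],
    their difference has the sign of [x - k]. Here the Coulson integral itself
    is estimated: minorants with elementary primitives bound the integrand from
    below near 0 and for [y^2 >= k], where it is negative, and the gain exceeds
    the loss as soon as [k >= 6]. *)

Set Implicit Arguments.
Unset Strict Implicit.
Unset Printing Implicit Defensive.

Import Order.TTheory GRing.Theory Num.Theory.
Import numFieldNormedType.Exports.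

(** * Hubs with pendent paths *)

(** Straightening preserves the sizes of the branches, so the leg sizes are fixed before [x] is
    chosen and all values of [x] are compared at once. For adjacent hubs the redistribution is
    strict at every [x], but straightening may be an equality; equality at a single [x] already
    forces every branch to be a path, and this identifies the tree. For distant hubs strictness
    comes from the integral alone, so weak bounds suffice before it. The integral estimate has to
    hold for all [t] and [k]. The length [t] enters only through the ratio of two consecutive path
    polynomials, which for [t >= 5] lies between fixed rational functions; this leaves three cases.
    The gain is taken over [0 < y <= 2] with a minorant independent of [k], while the loss is at
    most [k / (k + d)] times a constant over the square root of [k], with [d] equal to 4 or 5.
    Comparing them is a question about a quadratic in that square root, settled by its discriminant
    for all [k] together. *)

Section PathMatchings.
Local Open Scope ring_scope.
Variable R : comNzRingType.
Implicit Type x : R.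

(* The matching generating function of [P_n]. *)
Fixpoint path_mgf x (n : nat) : R :=
  match n with
  | 0 => 1
  | n1.+1 => match n1 with
             | 0 => 1
             | n2.+1 => path_mgf x n1 + x * path_mgf x n2
             end
  end.

Lemma path_mgfSS x n : path_mgf x n.+2 = path_mgf x n.+1 + x * path_mgf x n.
Proof. by []. Qed.

(** Splits the matchings by whether they use the edge after the first [i.+1] vertices. Two
    consecutive values of [j] are proved together because the recurrence has two steps. *)
Lemma path_mgfD x i j :
  path_mgf x (i.+1 + j.+1) =
  path_mgf x i.+1 * path_mgf x j.+1 + x * path_mgf x i * path_mgf x j.
Proof.
suff: path_mgf x (i.+1 + j.+1) =
    path_mgf x i.+1 * path_mgf x j.+1 + x * path_mgf x i * path_mgf x j /\
  path_mgf x (i.+1 + j.+2) =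
    path_mgf x i.+1 * path_mgf x j.+2 + x * path_mgf x i * path_mgf x j.+1.
  by case.
elim: j => [|j [IH1 IH2]].
  rewrite !addnS addn0 !path_mgfSS /=; split; ring.
split=> //; rewrite 2!addnS path_mgfSS -!addnS IH1 IH2 !path_mgfSS; ring.
Qed.

End PathMatchings.

Section PathMatchingsOrder.
Local Open Scope ring_scope.
Variables (R : realFieldType) (x : R).
Hypothesis x0 : 0 < x.
Local Notation p := (path_mgf x).

Lemma path_mgf_ge1 n : 1 <= p n.
Proof.
suff: 1 <= p n /\ 1 <= p n.+1 by case.
elim: n => [|n [IH1 IH2]]; first by rewrite /=.
split=> //; rewrite path_mgfSS -[leLHS]addr0 lerD // mulr_ge0 ?ltW //.
exact: lt_le_trans ltr01 IH1.
Qed.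

Lemma path_mgf_gt0 n : 0 < p n.
Proof. exact: lt_le_trans ltr01 (path_mgf_ge1 n). Qed.

Lemma path_mgf_leS n : p n <= p n.+1.
Proof.
case: n => [|n]; first by [].
by rewrite path_mgfSS lerDl mulr_ge0 ?ltW // path_mgf_gt0.
Qed.

Lemma path_mgf_mul_lt i j : (0 < i)%N -> (0 < j)%N -> p i * p j < p (i + j).
Proof.
case: i j => // i [] // j _ _.
by rewrite path_mgfD ltrDl !mulr_gt0 // path_mgf_gt0.
Qed.

(** The difference of the sides is [x ^+ 2 * p (j - 3)] for [i = 1] and
    [x ^+ 3 * p (i - 3) * p (j - 3)] for [i, j >= 3]. *)
Lemma path_mgf_pair_lt i j : (0 < i)%N -> (0 < j)%N -> (4 <= i + j)%N ->
  i != 2 -> j != 2 -> p i * p j < p 2 * p (i + j - 2).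
Proof.
wlog le_ij : i j / (i <= j)%N => [H|].
  case: (leqP i j) => [/H //|/ltnW ji i0 j0 ij i2 j2].
  by rewrite mulrC addnC H // addnC.
move=> i0 j0 ij i2 j2.
have: i = 1 \/ (3 <= i)%N by lia.
case=> [i1|i3].
  rewrite {}i1 {i le_ij i0 i2 j0 j2} in ij *.
  case: j ij => [|[|[|m]]] // _.
  have -> : (1 + m.+3 - 2 = m.+2)%N by lia.
  rewrite !path_mgfSS.
  have := path_mgf_gt0 m; have := path_mgf_gt0 m.+1.
  move: (p m) (p m.+1) => u v v0 u0; rewrite -subr_gt0.
  have -> : p 2 * (v + x * u) - p 1 * (v + x * u + x * v) = x ^+ 2 * u.
    by rewrite /=; ring.
  by rewrite mulr_gt0 // exprn_gt0.
case: i {i0 ij i2} i3 le_ij => [|[|[|a]]] // _.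
case: j {j0 j2} => [|[|[|b]]] // _.
have -> : (a.+3 + b.+3 - 2)%N = (a.+3 + b.+1)%N by lia.
rewrite path_mgfD.
have := path_mgf_gt0 a; have := path_mgf_gt0 b.
rewrite !path_mgfSS.
move: (p a) (p b) (p a.+1) (p b.+1) => pa pb pa1 pb1 ha hb.
rewrite -subr_gt0.
set d := (X in 0 < X); have -> : d = x ^+ 3 * pa * pb by rewrite /d /=; ring.
by rewrite !mulr_gt0 // exprn_gt0.
Qed.

Lemma path_mgf_pair_le i j : (0 < i)%N -> (0 < j)%N -> (3 <= i + j)%N ->
  p i * p j <= p 2 * p (i + j - 2).
Proof.
move=> i0 j0 ij.
have [->|i2] := eqVneq i 2; first by rewrite addnC addnK.
have [->|j2] := eqVneq j 2; first by rewrite addnK mulrC.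
by rewrite ltW // path_mgf_pair_lt //; lia.
Qed.

(* For the paths of the sizes listed in [a]: [legs_mgf] is their disjoint union,
   [spider_mgf] joins one end of each to a common hub. *)
Definition legs_mgf (a : seq nat) : R := \prod_(i <- a) p i.

Definition spider_mgf (a : seq nat) : R :=
  legs_mgf a * (1 + x * \sum_(i <- a) p i.-1 / p i).

Local Notation P := legs_mgf.
Local Notation Q := spider_mgf.

Lemma legs_mgf_perm a b : perm_eq a b -> P a = P b.
Proof. by move=> ab; apply: perm_big. Qed.

Lemma spider_mgf_perm a b : perm_eq a b -> Q a = Q b.
Proof.
by move=> ab; rewrite /Q (legs_mgf_perm ab) (perm_big _ ab).
Qed.

Lemma legs_mgf_gt0 a : 0 < P a.
Proof. by apply: prodr_gt0 => i _; apply: path_mgf_gt0. Qed.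

Lemma legs_mgf_cons i a : P (i :: a) = p i * P a.
Proof. by rewrite /P big_cons. Qed.

Lemma spider_mgf_cons i a : Q (i :: a) = p i * Q a + x * p i.-1 * P a.
Proof.
rewrite /Q legs_mgf_cons big_cons.
have := path_mgf_gt0 i => /lt0r_neq0 pi0.
by field.
Qed.

(** Either the hub is matched into [a], which leaves the new leg intact, or it is not, and then it
    prolongs the leg to a path with [i.+1] vertices. *)
Lemma spider_mgf_consS i a :
  (0 < i)%N -> Q (i :: a) = p i * (Q a - P a) + p i.+1 * P a.
Proof.
case: i => // i _; rewrite spider_mgf_cons (path_mgfSS _ i) /=; ring.
Qed.

Lemma spider_mgf_ge a : P a <= Q a.
Proof.
rewrite /Q ler_peMr ?(ltW (legs_mgf_gt0 a)) // lerDl mulr_ge0 ?(ltW x0) //.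
by apply: sumr_ge0 => i _; rewrite divr_ge0 // ltW // path_mgf_gt0.
Qed.

Lemma spider_mgf_gt0 a : 0 < Q a.
Proof. exact: lt_le_trans (legs_mgf_gt0 a) (spider_mgf_ge a). Qed.

Lemma spider_mgf_gt a : (0 < size a)%N -> P a < Q a.
Proof.
case: a => // i a _; rewrite spider_mgf_cons legs_mgf_cons.
rewrite ltr_pwDr ?ler_wpM2l ?spider_mgf_ge ?ltW ?path_mgf_gt0 //.
by rewrite !mulr_gt0 ?path_mgf_gt0 ?legs_mgf_gt0.
Qed.

(* Two spiders with adjacent hubs, respectively with hubs joined by a path with
   [s] inner vertices. *)
Definition adjacent_mgf a b : R := Q a * Q b + x * P a * P b.

Definition distant_mgf s a b : R :=
  Q a * Q b * p s + x * (P a * Q b + Q a * P b) * p s.-1 +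
  x ^+ 2 * P a * P b * (if s is s'.+2 then p s' else 0).

Lemma distant_mgfC s a b : distant_mgf s a b = distant_mgf s b a.
Proof. by rewrite /distant_mgf; ring. Qed.

Lemma distant_mgf_perm s a a' b b' : perm_eq a a' -> perm_eq b b' ->
  distant_mgf s a b = distant_mgf s a' b'.
Proof.
move=> aa bb; rewrite /distant_mgf.
by rewrite !(spider_mgf_perm aa, spider_mgf_perm bb, legs_mgf_perm aa, legs_mgf_perm bb).
Qed.

Lemma adjacent_mgfC a b : adjacent_mgf a b = adjacent_mgf b a.
Proof. by rewrite /adjacent_mgf; ring. Qed.

Lemma adjacent_mgf_perm a a' b b' : perm_eq a a' -> perm_eq b b' ->
  adjacent_mgf a b = adjacent_mgf a' b'.
Proof.
move=> aa bb; rewrite /adjacent_mgf.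
by rewrite !(spider_mgf_perm aa, spider_mgf_perm bb, legs_mgf_perm aa, legs_mgf_perm bb).
Qed.

(* Only [p i * p s] and [p i * p s.+1] depend on how [i + s] is split. *)
Lemma distant_mgf_cons i s a b : (0 < i)%N -> (0 < s)%N ->
  distant_mgf s (i :: a) b =
  (Q a - P a) * ((Q b - P b) * (p i * p s) + P b * (p i * p s.+1)) +
  P a * (Q b * p (i + s).+1 + x * P b * p (i + s)).
Proof.
case: i => // i _; case: s => // s _.
rewrite /distant_mgf (spider_mgf_consS _ (ltn0Sn i)) legs_mgf_cons.
rewrite -addSn path_mgfD.
case: s => [|s].
  rewrite addn1 !path_mgfSS /=; ring.
rewrite -addSnnS path_mgfD !path_mgfSS /=; ring.
Qed.

(** The inner path absorbs all but two vertices of the leg. Neither of the two products that depend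
    on the split, with sums [i + s] and [i + s.+1], decreases. *)
Lemma distant_mgf_move i s a b : (0 < i)%N -> (0 < s)%N -> (3 <= i + s)%N ->
  distant_mgf s (i :: a) b <= distant_mgf (i + s - 2) (2%N :: a) b.
Proof.
move=> i0 s0 is3; rewrite !distant_mgf_cons //; last by lia.
have -> : (2 + (i + s - 2) = i + s)%N by lia.
rewrite lerD2r ler_wpM2l ?subr_ge0 ?spider_mgf_ge //.
have := @path_mgf_pair_le i s i0 s0 is3.
have := @path_mgf_pair_le i s.+1 i0 isT.
have -> : (i + s.+1 - 2 = (i + s - 2).+1)%N by lia.
move=> /(_ ltac:(lia)) h1 h2.
by rewrite lerD // ler_wpM2l ?subr_ge0 ?spider_mgf_ge // ltW // legs_mgf_gt0.
Qed.

Lemma adjacent_mgf_move_same i j a b : (0 < i)%N -> (0 < j)%N ->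
  (4 <= i + j)%N -> i != 2 -> j != 2 ->
  adjacent_mgf (i :: j :: a) b < adjacent_mgf (2%N :: (i + j - 2)%N :: a) b.
Proof.
move=> i0 j0 ij i2 j2.
(* A hub not matched into [a] joins the two legs to a path of [u + v + 1] vertices, so only
   [p u * p v] depends on the split. Strictness comes from the term of the edge between the hubs,
   since [Q a - P a] vanishes for empty [a]. *)
have split2 u v : (0 < u)%N -> (0 < v)%N ->
    Q (u :: v :: a) = p u * p v * (Q a - P a) + P a * p (u + v).+1.
  case: u v => // u [] // v _ _.
  by rewrite !spider_mgf_cons legs_mgf_cons -addSn path_mgfD !path_mgfSS /=; ring.
have lt := path_mgf_pair_lt i0 j0 ij i2 j2.
rewrite /adjacent_mgf !split2 //; last by lia.
have -> : (2 + (i + j - 2) = i + j)%N by lia.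
rewrite !legs_mgf_cons.
have := spider_mgf_ge a; have := spider_mgf_gt0 b.
have := legs_mgf_gt0 a; have := legs_mgf_gt0 b.
rewrite [p i * (p j * _)]mulrA [p 2 * (p _ * _)]mulrA.
move: lt; move: (p i * p j) (p 2 * p _) => u v uv.
move: (P a) (Q a) (P b) (Q b) (p _) => pa qa pb qb w pb0 pa0 qb0 qa_ge.
have h1 : x * (u * pa) * pb < x * (v * pa) * pb.
  by rewrite ltr_pM2r // ltr_pM2l // ltr_pM2r.
have h2 : (u * (qa - pa) + pa * w) * qb <= (v * (qa - pa) + pa * w) * qb.
  by rewrite ler_pM2r // lerD2r ler_wpM2r ?subr_ge0 // ltW.
exact: ler_ltD.
Qed.

(* The two hubs compete for the longer leg: the hub with the smaller excess
   [Q - P] relative to [P] should get it. *)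
Lemma adjacent_mgf_move_cross i j a b : (0 < i)%N -> (0 < j)%N ->
  (4 <= i + j)%N -> i != 2 -> j != 2 ->
  (0 < size b)%N -> (Q b - P b) / P b <= (Q a - P a) / P a ->
  adjacent_mgf (i :: a) (j :: b) < adjacent_mgf (2%N :: a) ((i + j - 2)%N :: b).
Proof.
move=> i0 j0 ij i2 j2 sb.
have pa0 := legs_mgf_gt0 a; have pb0 := legs_mgf_gt0 b.
set g := (Q a - P a) / P a; set d := (Q b - P b) / P b => dg.
have d0 : 0 < d by rewrite divr_gt0 ?subr_gt0 ?spider_mgf_gt.
(* As [p u * p v.+1 + p u.+1 * p v] equals [p u * p v + p (u + v).+1], the asymmetric product
   survives only with coefficient [g - d]. The positivity of [d] gives strictness. *)
have E u v : (0 < u)%N -> (0 < v)%N -> adjacent_mgf (u :: a) (v :: b) =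
  P a * P b * (g * d * (p u * p v) + (g - d) * (p u * p v.+1)
     + d * (p u * p v) + d * p (u + v).+1 + p (u + v).+2).
  case: u v => // u [] // v _ _.
  rewrite /adjacent_mgf !spider_mgf_consS // !legs_mgf_cons.
  have -> : p (u.+1 + v.+1).+2 = p (u.+2 + v.+2) by congr p; lia.
  rewrite -[(u.+1 + v.+1).+1]addSn !path_mgfD.
  have -> : Q a = P a * (1 + g) by rewrite /g; field; rewrite gt_eqF.
  have -> : Q b = P b * (1 + d) by rewrite /d; field; rewrite gt_eqF.
  rewrite !path_mgfSS; ring.
rewrite !E //; last by lia.
have -> : (2 + (i + j - 2) = i + j)%N by lia.
rewrite ltr_pM2l ?mulr_gt0 // !ltrD2r.
have lt := path_mgf_pair_lt i0 j0 ij i2 j2.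
have := @path_mgf_pair_le i j.+1 i0 isT.
have -> : (i + j.+1 - 2 = (i + j - 2).+1)%N by lia.
move=> /(_ ltac:(lia)) h1.
apply: ler_ltD; last by rewrite ltr_pM2l.
apply: lerD; last by rewrite ler_wpM2l // subr_ge0.
by rewrite ler_wpM2l ?ltW // mulr_gt0 // (lt_le_trans d0).
Qed.

Lemma spider_excess a : (Q a - P a) / P a = x * \sum_(i <- a) p i.-1 / p i.
Proof. by rewrite /Q; field; rewrite gt_eqF // (legs_mgf_gt0 a). Qed.

(** A leg of size 1 contributes 1 to the sum in [spider_excess], a leg of size 2 only
    [1 / (1 + x)]. *)
Lemma spider_excess_ge a b : all (fun i => (i == 1) || (i == 2))%N a ->
  all (pred1 2%N) b -> size a = size b ->
  (Q b - P b) / P b <= (Q a - P a) / P a.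
Proof.
rewrite !spider_excess; move=> Ha Hb sz; rewrite ler_wpM2l ?(ltW x0) //.
elim: a b Ha Hb sz => [|i a IH] [|j b] //=.
move=> /andP[i12 Ha] /andP[/eqP -> Hb] [sz]; rewrite !big_cons.
apply: lerD; last exact: IH.
case/orP: i12 => /eqP-> //=.
by rewrite !mulr1 divr1 mul1r invf_le1 ?addr_gt0 // lerDl ltW.
Qed.

End PathMatchingsOrder.

(** * Redistributing the sizes of the pendent paths *)

Definition non2 (a : seq nat) : nat := count (predC1 2) a.
Arguments non2 : simpl never.

Lemma non2_cons i a : non2 (i :: a) = nat_of_bool (i != 2) + non2 a.
Proof. by []. Qed.

Lemma non2_consS i a : non2 (i :: a) <= (non2 a).+1.
Proof. by rewrite non2_cons; case: eqP. Qed.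

(** Every short leg other than 2 costs at least one vertex; against a prescribed total this excludes
    such legs or produces a leg of size at least 3. *)
Lemma sumn_le2 (a : seq nat) : all (fun i : nat => i <= 2) a ->
  sumn a + non2 a <= 2 * size a.
Proof.
elim: a => //= i a IH /andP[i2 /IH].
by rewrite non2_cons; case: eqP => [->|] *; lia.
Qed.

Lemma count_predC1_eq0 (a : seq nat) :
  non2 a = 0 -> a = nseq (size a) 2.
Proof.
move/eqP; rewrite -leqn0 leqNgt -has_count -all_predC => /allP a2.
by apply/all_pred1P/allP => i /a2 /=; rewrite negbK.
Qed.

Lemma sumn_perm (a b : seq nat) : perm_eq a b -> sumn a = sumn b.
Proof. by move=> ab; rewrite !sumnE; apply: perm_big. Qed.

Lemma perm_pick (i : nat) (a : seq nat) : i \in a -> i != 2 ->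
  all (leq 1) a ->
  exists a' : seq nat,
  [/\ perm_eq a (i :: a'), size a = (size a').+1, sumn a = i + sumn a',
     non2 a = (non2 a').+1 & all (leq 1) a' /\ 0 < i].
Proof.
move=> ia i2 Ha; have pa := perm_to_rem ia; exists (rem i a).
split=> //; first exact: perm_size pa.
- exact: sumn_perm pa.
- by rewrite /non2 (seq.permP pa) -/(non2 _) non2_cons i2.
- by move: Ha; rewrite (perm_all _ pa) /= => /andP[].
Qed.

Section Optimisation.
Variables (R : realFieldType) (x : R).
Hypothesis x0 : (0 < x)%R.

(** While some leg other than 2 can be moved into the inner path, [distant_mgf_move] lowers [non2].
    When none can, either [s >= 2] and all legs have size 2, or [s = 1], no leg exceeds 2, and the
    total with [0 < r] leaves no room for a leg of size 1. *)
Lemma distant_mgf_le m r s a b : size a = m -> size b = m ->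
  all (leq 1) a -> all (leq 1) b -> (0 < s) -> (0 < r) ->
  (sumn a + sumn b + s = 4 * m + r) ->
  (distant_mgf x s a b <= distant_mgf x r (nseq m 2) (nseq m 2))%R.
Proof.
have [N] := ubnP (non2 a + non2 b).
elim: N a b s => // N IH a b s leN sa sb Ha Hb s0 r0 sum.
wlog : a b leN sa sb Ha Hb sum / has (fun i : nat => (i != 2) && (3 <= i + s)) a
    || ~~ has (fun i : nat => (i != 2) && (3 <= i + s)) b => [H|].
  set f := fun i : nat => _ in H *.
  case: (boolP (has f a)) (H a b) => [_ -> //|na _].
  case: (boolP (has f b)) => [hb|nb].
    rewrite distant_mgfC; by apply: H; rewrite ?hb //; lia.
  by apply: H => //; rewrite nb orbT.
case: (boolP (has _ a)) => [/hasP[i ia /andP[i2 is3]] _|na /= nb]; last first.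
  have {na nb} : non2 a = 0 /\ non2 b = 0.
    have [s2|s1] := leqP 2 s.
      have H (c : seq nat) : all (leq 1) c ->
          ~~ has (fun i : nat => (i != 2) && (3 <= i + s)) c -> non2 c = 0.
        move=> /allP Hc /hasPn nc; apply/eqP; rewrite -leqn0 leqNgt -has_count.
        apply/hasPn => i ic; have /= := nc i ic; have /= := Hc i ic.
        by case: eqP => //=; lia.
      by split; apply: H.
    have {s0 s1}s1 : s = 1%N by lia.
    have H (c : seq nat) : ~~ has (fun i : nat => (i != 2) && (3 <= i + s)) c ->
        (sumn c + non2 c <= 2 * size c).
      move=> /hasPn nc; apply: sumn_le2; apply/allP => i /nc.
      by case: eqP => [->//|_] /=; lia.
    by have := H a na; have := H b nb; lia.
  move=> [/count_predC1_eq0 Ea /count_predC1_eq0 Eb].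
  have Es : s = r.
    by move: sum; rewrite Ea Eb !sumn_nseq sa sb; lia.
  by rewrite Ea Eb sa sb Es.
have [a' [pa sz sm ct [Ha' i1]]] := perm_pick ia i2 Ha.
rewrite (distant_mgf_perm _ _ pa (perm_refl b)).
apply: le_trans (distant_mgf_move x0 a' b i1 s0 is3) _.
by apply: IH => //=; rewrite ?non2_cons /=; lia.
Qed.

(** The legs at the two hubs of [T_b], for [m = Delta - 1] and [r = t - 2]: the leg of size [r.+2]
    is the tail [w_3 ... w_(t+2)]. *)
Definition T_b_legs m r (a b : seq nat) :=
  perm_eq a (nseq m 2) && perm_eq b (r.+2 :: nseq m.-1 2).

Lemma nseq_of_all2 (a : seq nat) : all (pred1 2) a -> a = nseq (size a) 2.
Proof. by move/all_pred1P. Qed.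

Definition legs_total m s (a b : seq nat) :=
  [/\ size a = m, size b = m, all (leq 1) a, all (leq 1) b
    & sumn a + sumn b = s].

Lemma legs_totalC m s a b : legs_total m s a b -> legs_total m s b a.
Proof. by case=> *; split=> //; rewrite addnC. Qed.

(** One step of the iteration in [adjacent_mgf_lt]. Keeping [legs_total] preserves the degrees of
    the hubs and the number of vertices. *)
Definition improvable m s (a b : seq nat) := exists a' b',
  [/\ legs_total m s a' b', non2 a' + non2 b' < non2 a + non2 b
    & (adjacent_mgf x a b < adjacent_mgf x a' b')%R].

Lemma improvableC m s a b : improvable m s b a -> improvable m s a b.
Proof.
move=> [a' [b' [/legs_totalC h1 h2 h3]]]; exists b', a'; split=> //.
  by rewrite addnC (addnC (non2 a)).
by rewrite adjacent_mgfC [ltRHS]adjacent_mgfC.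
Qed.

Lemma improvable_same m s (a b : seq nat) (i j : nat) (a' : seq nat) : legs_total m s a b ->
  perm_eq a (i :: a') -> all (leq 1) a' -> sumn a = i + sumn a' ->
  size a = (size a').+1 -> non2 a = (non2 a').+1 ->
  3 <= i -> j \in a' -> j != 2 -> improvable m s a b.
Proof.
move=> [sa sb Ha Hb sum] pa Ha' sma sza na i3 ja j2.
have [a'' [pa' sza' sma' na' [Ha'' j1]]] := perm_pick ja j2 Ha'.
have paa : perm_eq a [:: i, j & a''].
  by apply: perm_trans pa _; rewrite perm_cons.
have i2 : i != 2 by case: (i) i3 => [|[|[|?]]].
exists [:: 2, i + j - 2 & a''], b; split.
- move: Hb Ha'' sa sb sza sza' sma sma' sum j1 i3; clear=> Hb Ha'' *; split=> //=; try lia.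
- have := non2_consS (i + j - 2) a''; rewrite (non2_cons 2) na na' /=.
  clear; lia.
- rewrite (adjacent_mgf_perm x paa (perm_refl b)).
  by apply: adjacent_mgf_move_same => //; clear - i3 j1; lia.
Qed.

Lemma improvable_cross m s (a b : seq nat) (i j : nat) (a' b' : seq nat) : legs_total m s a b ->
  perm_eq a (i :: a') -> perm_eq b (j :: b') -> 4 <= i + j ->
  i != 2 -> j != 2 -> 0 < i -> 0 < j -> 1 < m ->
  all (fun h : nat => (h == 1) || (h == 2)) a' -> all (pred1 2) b' ->
  improvable m s a b.
Proof.
move=> [sa sb Ha Hb sum] pa pb ij i2 j2 i1 j1 m1 a12 b2.
have sza : size a = (size a').+1 := perm_size pa.
have szb : size b = (size b').+1 := perm_size pb.
have sma : sumn a = i + sumn a' := sumn_perm pa.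
have smb : sumn b = j + sumn b' := sumn_perm pb.
have na : non2 a = (non2 a').+1.
  by rewrite /non2 (seq.permP pa) -/(non2 _) non2_cons i2.
have nb : non2 b = (non2 b').+1.
  by rewrite /non2 (seq.permP pb) -/(non2 _) non2_cons j2.
have Ha' : all (leq 1) a' by move: Ha; rewrite (perm_all _ pa) /= => /andP[].
have Hb' : all (leq 1) b' by move: Hb; rewrite (perm_all _ pb) /= => /andP[].
exists (2 :: a'), (i + j - 2 :: b'); split.
- move: Ha' Hb' sa sb sza szb sma smb sum ij; clear=> Ha' Hb' *; split=> //=; try lia.
- have := non2_consS (i + j - 2) b'; rewrite (non2_cons 2) na nb /=.
  clear; lia.
- rewrite (adjacent_mgf_perm x pa pb).
  apply: adjacent_mgf_move_cross => //; first by clear -sb szb m1; lia.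
  by apply: spider_excess_ge => //; apply: succn_inj; rewrite -sza -szb sa sb.
Qed.

(** If a leg other than 2 shares its hub with a leg of size at least 3, a move at that hub improves.
    Otherwise [j] is the only such leg at [b], and a leg other than 2 at [a] allows a cross move:
    the legs remaining at [a] have size 1 or 2 and those at [b] size 2, as the comparison of
    excesses requires. *)
Lemma improvable_or_T_b m r a b : legs_total m (4 * m + r) a b -> 1 < m ->
  0 < r -> has (leq 3) b -> T_b_legs m r a b \/ improvable m (4 * m + r) a b.
Proof.
move=> tot m1 r0; case: (tot) => sa sb Ha Hb sum /hasP[/= j jb j3].
have j2 : j != 2 by case: (j) j3 => [|[|[|?]]].
have [b' [pb szb smb nb [Hb' j1]]] := perm_pick jb j2 Hb.
have [b2|] := boolP (all (pred1 2) b'); last first.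
  rewrite -has_predC => /hasP[i ib /= i2]; right; apply: improvableC.
  exact: improvable_same (legs_totalC tot) pb Hb' smb szb nb j3 ib i2.
have szb' : size b' = m.-1 by rewrite -sb szb.
have Eb' := nseq_of_all2 b2; rewrite szb' in Eb'.
have [a2|] := boolP (all (pred1 2) a).
  have Ea := nseq_of_all2 a2; rewrite sa in Ea.
  left; rewrite /T_b_legs Ea perm_refl /=.
  suff <- : j = r.+2 by rewrite -Eb'.
  by move: smb sum; rewrite Ea Eb' !sumn_nseq; clear -m1; lia.
rewrite -has_predC => /hasP[i0 ia0 /= i02]; right.
have [/hasP[/= i ia i3]|na3] := boolP (has (leq 3) a); last first.
  have [a' [pa sza sma na [Ha' i1]]] := perm_pick ia0 i02 Ha.
  apply: (improvable_cross tot pa pb) => //; first by clear -i1 j3; lia.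
  apply/allP => h ha'; have ha : h \in a by rewrite (perm_mem pa) inE ha' orbT.
  have /hasPn/(_ h ha) := na3; have /allP/(_ h ha) := Ha.
  by case: (h) => [|[|[|?]]].
have i2 : i != 2 by case: (i) i3 => [|[|[|?]]].
have [a' [pa sza sma na [Ha' i1]]] := perm_pick ia i2 Ha.
have [a2|] := boolP (all (pred1 2) a').
  apply: (improvable_cross tot pa pb) => //; first by clear -i1 j3; lia.
  by apply: sub_all a2 => h /= ->; rewrite orbT.
rewrite -has_predC => /hasP[h ha /= h2].
exact: improvable_same tot pa Ha' sma sza na i3 ha h2.
Qed.

(** The total [4 * m + r] exceeds two vertices per leg, so some leg has size at least 3 and
    [improvable_or_T_b] applies at its hub. The moves stop because [non2] drops, and can only stop
    at the legs of [T_b]. *)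
Lemma adjacent_mgf_lt m r a b : legs_total m (4 * m + r) a b -> 1 < m ->
  0 < r ->
  [\/ T_b_legs m r a b, T_b_legs m r b a |
   (adjacent_mgf x a b < adjacent_mgf x (nseq m 2) (r.+2 :: nseq m.-1 2))%R].
Proof.
move=> tot m1 r0.
have [N] := ubnP (non2 a + non2 b); elim: N a b tot => // N IH a b tot leN.
suff [?|[?|[a' [b' [tot' lt' imp]]]]] :
    T_b_legs m r a b \/ T_b_legs m r b a \/ improvable m (4 * m + r) a b.
- exact: Or31.
- exact: Or32.
- apply: Or33.
  have lt'' : non2 a' + non2 b' < N by exact: leq_trans lt' leN.
  case: (IH a' b' tot' lt'') => [/andP[h1 h2]|/andP[h1 h2]|].
  + by rewrite -(adjacent_mgf_perm x h1 h2).
  + by rewrite -(adjacent_mgf_perm x h1 h2) adjacent_mgfC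
      [adjacent_mgf x b' a']adjacent_mgfC adjacent_mgfC.
  + exact: lt_trans.
have [b3|nb] := boolP (has (leq 3) b).
  by case: (improvable_or_T_b tot m1 r0 b3) => ?; [left|right; right].
have [a3|na] := boolP (has (leq 3) a).
  case: (improvable_or_T_b (legs_totalC tot) m1 r0 a3) => ?; first by right; left.
  by right; right; apply: improvableC.
have le2 (c : seq nat) : ~~ has (leq 3) c -> all (fun i : nat => i <= 2) c.
  by move/hasPn=> H'; apply/allP => i /H'; rewrite -ltnNge.
case: tot => sa sb _ _ sum.
have := sumn_le2 (le2 a na); have := sumn_le2 (le2 b nb).
by move: sa sb sum r0; clear; lia.
Qed.

End Optimisation.

(** * Matching generating functions of forests *)

Lemma setD1C (T : finType) (S : {set T}) a b : S :\ a :\ b = S :\ b :\ a.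
Proof. by apply/setP => z; rewrite !inE andbCA. Qed.

Section MatchingGeneratingFunction.
Local Open Scope ring_scope.
Variables (K : comNzRingType) (x : K) (G : sgraph).
Implicit Types (A B S : {set G}) (u v w : G).

(** The fuel [n] only ensures termination and the picked vertex is arbitrary; [mgf_expand] frees the
    recursion from both. *)
Fixpoint mgf_rec n S : K :=
  if n is n'.+1 then
    if [pick v in S] is Some v then
      mgf_rec n' (S :\ v) +
      x * \sum_(w in S | adj v w) mgf_rec n' (S :\ v :\ w)
    else 1
  else 1.

(* The sum of [x ^+ #|M|] over the matchings [M] of the subgraph induced
   by [S]. *)
Definition mgf S : K := mgf_rec #|S| S.

Lemma card_setD1_lt S v : v \in S -> (#|S :\ v| < #|S|)%N.
Proof. by move=> vS; rewrite [ltnRHS](cardsD1 v) vS. Qed.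

Lemma card_setD1_le S v : (#|S :\ v| <= #|S|)%N.
Proof. by apply: subset_leq_card; apply: subsetDl. Qed.

Lemma mgf_rec_fuel n m S :
  (#|S| <= n)%N -> (#|S| <= m)%N -> mgf_rec n S = mgf_rec m S.
Proof.
elim: n m S => [|n IH] m S.
  rewrite leqn0 cards_eq0 => /eqP -> _; case: m => //= m.
  by case: pickP => // v; rewrite inE.
case: m => [|m] Sn Sm /=.
  move: Sm; rewrite leqn0 cards_eq0 => /eqP ->.
  by case: pickP => // v; rewrite inE.
case: pickP => // v vS.
have lt := card_setD1_lt vS.
congr (_ + _ * _); first by apply: IH; rewrite -ltnS; apply: leq_trans lt _.
apply: eq_bigr => w _; have le := card_setD1_le (S :\ v) w.
by apply: IH; rewrite -ltnS; apply: leq_trans (leq_ltn_trans le lt) _.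
Qed.

Lemma mgf0 : mgf set0 = 1.
Proof. by rewrite /mgf cards0. Qed.

Let expansion S v := mgf (S :\ v) + x * \sum_(w in S | adj v w) mgf (S :\ v :\ w).

Lemma mgf_pick S : S != set0 -> exists2 v, v \in S & mgf S = expansion S v.
Proof.
rewrite -card_gt0 => S0; rewrite {1}/mgf; case E: #|S| S0 => [//|n] _ /=.
case: pickP => [v vS|S0]; last first.
  by move: E; rewrite (eq_card0 S0).
have lt := card_setD1_lt vS; rewrite E ltnS in lt.
exists v => //; congr (_ + _ * _); first exact: mgf_rec_fuel.
apply: eq_bigr => w _; apply: mgf_rec_fuel => //.
exact: leq_trans (card_setD1_le _ _) lt.
Qed.

Lemma mgf_expand S v : v \in S ->
  mgf S = mgf (S :\ v) + x * \sum_(w in S | adj v w) mgf (S :\ v :\ w).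
Proof.
have [n] := ubnP #|S|; elim: n S v => // n IH S v leS vS.
have [|v0 v0S ->] := @mgf_pick S; first by apply/set0Pn; exists v.
have [->//|vv0] := eqVneq v0 v.
pose D a b := mgf (S :\ a :\ b).
(* The expansion at [a] and then at [b]: both unmatched, only [b] matched, [a] matched to [b], only
   [a] matched, both matched elsewhere. It is symmetric in [a] and [b], so expanding at the picked
   vertex or at [v] gives the same value. *)
pose second a b :=
  D a b + x * (\sum_(z in S | adj b z && (z != a)) mgf (S :\ a :\ b :\ z) +
    ((adj a b)%:R * D a b +
     \sum_(w in S | adj a w && (w != b)) mgf (S :\ a :\ b :\ w))) +
  x * x * \sum_(w in S | adj a w && (w != b))
     \sum_(z in S | adj b z && ((z != a) && (z != w)))
       mgf (S :\ a :\ b :\ w :\ z).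
suff E a b : a \in S -> b \in S -> a != b -> expansion S a = second a b.
  rewrite (E v0 v) // -/(expansion S v) (E v v0) 1?eq_sym // /second /D.
  have DC z w : S :\ z :\ w = S :\ w :\ z by rewrite setD1C.
  rewrite adj_sym (DC v0 v).
  congr (_ + x * _ + x * x * _); first by rewrite [LHS]addrCA [RHS]addrCA [X in _ + X]addrC.
  rewrite (exchange_big_dep (fun z => (z \in S) && (adj v z && (z != v0)))) /=.
    apply: eq_bigr => z /and3P[zS vz zv0].
    rewrite (eq_bigr (fun w => mgf (S :\ v :\ v0 :\ z :\ w))); last first.
      by move=> w _; rewrite [_ :\ w :\ z]setD1C.
    apply: eq_bigl => w; rewrite (eq_sym z w) zS vz zv0 /=.
    by case: (w \in S) => //=; case: (adj v0 w); rewrite //= ?andbT ?andbF.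
  by move=> w z _ /and3P[-> -> /andP[-> _]].
move=> aS bS ab; rewrite /expansion /second.
have lt : (#|S :\ a| < n)%N.
  by rewrite -ltnS (leq_trans _ leS) // ltnS card_setD1_lt.
have baS : b \in S :\ a by rewrite !inE eq_sym ab.
rewrite (IH _ b lt baS) -/(D a b) -!addrA; congr (_ + _).
rewrite [in RHS]mulrDr -[RHS]addrA; congr (_ + _).
  congr (x * _); apply: eq_bigl => z; rewrite !inE.
  by case: (z == a); case: (z \in S); case: (adj b z).
rewrite -mulrA -mulrDr; congr (x * _).
have -> : \sum_(w in S | adj a w) mgf (S :\ a :\ w) = (adj a b)%:R * D a b +
    \sum_(w in S | adj a w && (w != b)) mgf (S :\ a :\ w).
  case: (boolP (adj a b)) => Eab.
    rewrite mul1r (bigD1 b) ?bS //=; congr (_ + _).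
    by apply: eq_bigl => w; rewrite andbA.
  rewrite mul0r add0r; apply: eq_bigl => w.
  by case: eqP => [->|]; rewrite ?andbT // (negPf Eab) andbF.
rewrite -addrA; congr (_ + _).
rewrite big_distrr /= -big_split /=; apply: eq_bigr => w /and3P[wS aw wb].
have ltw : (#|S :\ a :\ w| < n)%N.
  exact: leq_ltn_trans (card_setD1_le _ _) lt.
have bwS : b \in S :\ a :\ w by rewrite !inE eq_sym wb /= eq_sym ab.
rewrite (IH _ b ltw bwS); congr (_ + x * _); first by rewrite setD1C.
rewrite [LHS](eq_bigr (fun z => mgf (S :\ a :\ b :\ w :\ z))); last first.
  by move=> z _; rewrite [S :\ a :\ w :\ b]setD1C.
apply: eq_bigl => z; rewrite !inE.
by case: (z == a); case: (z == w); case: (z \in S); rewrite ?andbF ?andbT.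
Qed.

Lemma mgf_setU A B : [disjoint A & B] ->
  (forall a b, a \in A -> b \in B -> ~~ adj a b) ->
  mgf (A :|: B) = mgf A * mgf B.
Proof.
have [n] := ubnP #|B|; elim: n B => // n IH B leB dAB noadj.
have [->|/set0Pn[b bB]] := eqVneq B set0; first by rewrite setU0 mgf0 mulr1.
have bA : b \notin A by rewrite (disjointFl dAB bB).
rewrite (mgf_expand (v := b)) ?inE ?bB ?orbT // (mgf_expand bB).
have D z : z \in B -> (A :|: B) :\ z = A :|: (B :\ z).
  move=> zB; rewrite setDUl; congr (_ :|: _); apply/setP => y; rewrite !inE.
  by case: eqP => // ->; rewrite (disjointFl dAB zB).
have IH' B' : B' \subset B :\ b -> mgf (A :|: B') = mgf A * mgf B'.
  move=> sB; have sB' := subset_trans sB (subsetDl B [set b]).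
  apply: IH.
  - rewrite -ltnS (leq_trans _ leB) // ltnS.
    exact: leq_ltn_trans (subset_leq_card sB) (card_setD1_lt bB).
  - exact: disjointWr sB' dAB.
  - by move=> a c aA /(subsetP sB') cB; apply: noadj.
rewrite D // IH' // [RHS]mulrDr; congr (_ + _).
rewrite [RHS]mulrCA; congr (x * _); rewrite big_distrr /=.
rewrite (eq_bigl (fun w => (w \in B) && adj b w)).
  apply: eq_bigr => w /andP[wB _].
  have wA : A :\ w = A.
    by apply/setDidPl; rewrite disjoint_sym disjoints1 (disjointFl dAB wB).
  by rewrite setDUl wA IH' ?subsetDl.
move=> w; rewrite inE; case wB: (w \in B); first by rewrite orbT.
by rewrite orbF; case wA: (w \in A) => //=; rewrite adj_sym (negPf (noadj _ _ wA bB)).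
Qed.

End MatchingGeneratingFunction.

Section Bridge.
Local Open Scope ring_scope.
Variables (K : comNzRingType) (x : K) (G : sgraph).
Implicit Types (A B S : {set G}) (u v w : G).
Local Notation mgf := (mgf x).

Lemma mgf_bridge A B u w : [disjoint A & B] -> u \in A -> w \in B ->
  adj u w -> (forall a b, a \in A -> b \in B -> adj a b -> a = u /\ b = w) ->
  mgf (A :|: B) = mgf A * mgf B + x * mgf (A :\ u) * mgf (B :\ w).
Proof.
move=> dAB uA wB uw bridge.
have wA : w \notin A by rewrite (disjointFl dAB wB).
have uB : u \notin B by rewrite (disjointFr dAB uA).
rewrite (mgf_expand x (v := w)) ?inE ?wB ?orbT // (mgf_expand x wB).
have sAw : A :\ w = A by apply/setDidPl; rewrite disjoint_sym disjoints1.
have prod A' B' : A' \subset A -> B' \subset B ->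
    (u \notin A') || (w \notin B') -> mgf (A' :|: B') = mgf A' * mgf B'.
  move=> sA sB nuw; apply: mgf_setU.
    exact: disjointWl sA (disjointWr sB dAB).
  move=> a b aA' bB'; apply/negP => ab.
  have [au bw] := bridge a b (subsetP sA a aA') (subsetP sB b bB') ab.
  by move: nuw; rewrite -au -bw aA' bB'.
rewrite setDUl sAw prod ?subsetDl ?setD11 ?orbT //.
rewrite [in RHS]mulrDr -addrA; congr (_ + _).
rewrite (bigD1 u) /=; last by rewrite inE uA adj_sym uw.
have -> : (A :|: B :\ w) :\ u = (A :\ u) :|: (B :\ w).
  rewrite setDUl; congr (_ :|: _); apply/setDidPl.
  by rewrite disjoint_sym disjoints1 !inE negb_and uB orbT.
rewrite prod ?subsetDl // ?setD11 // mulrDr mulrA addrC; congr (_ + _).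
rewrite [RHS]mulrCA; congr (_ * _); rewrite big_distrr /=.
rewrite (eq_bigl (fun z => (z \in B) && adj w z)) ; last first.
  move=> z; rewrite !inE; have [->|zu] := eqVneq z u; first by rewrite (negPf uB) andbF.
  rewrite andbT; have [zB|zB] := boolP (z \in B); first by rewrite orbT.
  rewrite orbF; apply/andP => -[zA wz].
  rewrite adj_sym in wz; have [zu' _] := bridge z w zA wB wz.
  by rewrite zu' eqxx in zu.
apply: eq_bigr => z /andP[zB wz].
have sAz : A :\ z = A.
  by apply/setDidPl; rewrite disjoint_sym disjoints1 (disjointFl dAB zB).
rewrite setDUl sAz prod ?setD11 ?orbT //.
  exact: subset_trans (subsetDl _ _) (subsetDl _ _).
by rewrite !inE eqxx andbF orbT.
Qed.

End Bridge.

Section MgfOrder.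
Local Open Scope ring_scope.
Variables (R : realFieldType) (x : R) (G : sgraph).
Hypothesis x0 : 0 < x.
Implicit Types (A B S : {set G}) (u v w : G).
Local Notation mgf := (mgf x).
Local Notation p := (path_mgf x).

Lemma mgf_ge1 S : 1 <= mgf S.
Proof.
have [n] := ubnP #|S|; elim: n S => // n IH S leS.
have [->|/set0Pn[v vS]] := eqVneq S set0; first by rewrite mgf0.
have lt := card_setD1_lt vS.
have IHv : 1 <= mgf (S :\ v) by apply: IH; rewrite -ltnS (leq_trans _ leS).
rewrite (mgf_expand x vS) -[leLHS]addr0 lerD // mulr_ge0 ?(ltW x0) //.
apply: sumr_ge0 => w _; apply: le_trans ler01 (IH _ _).
by rewrite -ltnS (leq_trans _ leS) // ltnS (leq_ltn_trans (card_setD1_le _ _)).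
Qed.

Lemma mgf_gt0 S : 0 < mgf S.
Proof. exact: lt_le_trans ltr01 (mgf_ge1 S). Qed.

Lemma mgf_setU_ge A B : [disjoint A & B] -> mgf A * mgf B <= mgf (A :|: B).
Proof.
have [n] := ubnP #|B|; elim: n B => // n IH B leB dAB.
have [->|/set0Pn[b bB]] := eqVneq B set0; first by rewrite setU0 mgf0 mulr1.
have IH' B' : B' \subset B :\ b -> mgf A * mgf B' <= mgf (A :|: B').
  move=> sB; have sB' := subset_trans sB (subsetDl B [set b]).
  apply: IH; last exact: disjointWr sB' dAB.
  rewrite -ltnS (leq_trans _ leB) // ltnS.
  exact: leq_ltn_trans (subset_leq_card sB) (card_setD1_lt bB).
have bUB : b \in A :|: B by rewrite inE bB orbT.
have sA z : z \in B -> A :\ z = A.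
  by move=> zB; apply/setDidPl; rewrite disjoint_sym disjoints1 (disjointFl dAB zB).
rewrite (mgf_expand x bUB) (mgf_expand x bB) setDUl sA // mulrDr.
apply: lerD; first exact: IH'.
rewrite mulrCA ler_wpM2l ?(ltW x0) // big_distrr /=.
rewrite [leRHS](bigID (mem B)) /= ler_wpDr //.
  by apply: sumr_ge0 => w _; rewrite ltW // mgf_gt0.
rewrite [leRHS](eq_bigl (fun w => (w \in B) && adj b w)) ; last first.
  move=> w; by rewrite inE; case: (w \in B); rewrite ?orbT ?andbT ?andbF.
apply: ler_sum => w /andP[wB _].
by rewrite setDUl sA // IH' // subsetDl.
Qed.

(** Other edges between [A] and [B] only add matchings. Hence a lower bound needs the presence of
    certain edges, never the absence of others. *)
Lemma mgf_bridge_ge A B u w : [disjoint A & B] -> u \in A -> w \in B ->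
  adj u w -> mgf A * mgf B + x * mgf (A :\ u) * mgf (B :\ w) <= mgf (A :|: B).
Proof.
move=> dAB uA wB uw.
have uB : u \notin B by rewrite (disjointFr dAB uA).
have wUB : w \in A :|: B by rewrite inE wB orbT.
have sA z : z \in B -> A :\ z = A.
  by move=> zB; apply/setDidPl; rewrite disjoint_sym disjoints1 (disjointFl dAB zB).
have dAB' A' B' : A' \subset A -> B' \subset B -> [disjoint A' & B'].
  by move=> sA' sB'; apply: disjointWl sA' (disjointWr sB' dAB).
rewrite (mgf_expand x wUB) (mgf_expand x wB) setDUl (sA w wB) mulrDr -addrA.
apply: lerD; first by apply: mgf_setU_ge; rewrite dAB' // subsetDl.
rewrite [in leRHS](bigD1 u) /=; last by rewrite inE uA adj_sym uw.
rewrite mulrDr addrC; apply: lerD.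
  rewrite -mulrA ler_wpM2l ?(ltW x0) //.
  have -> : (A :|: B :\ w) :\ u = (A :\ u) :|: (B :\ w).
    rewrite setDUl; congr (_ :|: _); apply/setDidPl.
    by rewrite disjoint_sym disjoints1 !inE negb_and uB orbT.
  by apply: mgf_setU_ge; rewrite dAB' // subsetDl.
rewrite mulrCA ler_wpM2l ?(ltW x0) // big_distrr /=.
rewrite [leRHS](bigID (mem B)) /= ler_wpDr //.
  by apply: sumr_ge0 => z _; rewrite ltW // mgf_gt0.
rewrite [leRHS](eq_bigl (fun z => (z \in B) && adj w z)) ; last first.
  move=> z; rewrite inE; have [->|_] := eqVneq z u; first by rewrite (negPf uB) !andbF.
  by case: (z \in B); rewrite ?orbT ?andbT ?andbF.
apply: ler_sum => z /andP[zB _].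
rewrite setDUl sA //; apply: mgf_setU_ge; rewrite dAB' //.
exact: subset_trans (subsetDl _ _) (subsetDl _ _).
Qed.

End MgfOrder.

(** * Forests: leaves, and the bound by paths *)

Section Forest.
Variable G : sgraph.
Implicit Types (A B S : {set G}) (u v w : G).

Definition neighbors S v : {set G} := [set w in S | adj v w].

Lemma in_neighbors S v w : (w \in neighbors S v) = (w \in S) && adj v w.
Proof. by rewrite inE. Qed.

Definition adj_in S : rel G := fun v w => [&& v \in S, w \in S & adj v w].

Definition connected_from S u := forall z, z \in S -> connect (adj_in S) u z.

Definition component S v : {set G} := [set z | connect (adj_in S) v z].

Lemma path_adj_in S v p : path (adj_in S) v p -> path (@adj G) v p /\ {subset p <= S}.
Proof.
elim: p v => //= w p IH v /andP[/and3P[vS wS vw] /IH[pth sub]].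
by split; [rewrite vw | move=> z; rewrite inE => /orP[/eqP->|/sub]].
Qed.

Hypothesis acyclic : is_acyclic G.

Lemma acyclic_unique_neighbor S u w b : u \notin S -> w \in S ->
  connect (adj_in S) w b -> adj u w -> adj u b -> b = w.
Proof.
move=> uS wS /connectP[p0 pth0 ->] uw.
case/shortenP: pth0 => p pth unq _ ub.
have [adjp sub] := path_adj_in pth.
case: p {pth} => // z p in adjp unq sub ub *.
case: (@acyclic [:: u, w, z & p]); rewrite // /ucycle /=.
rewrite rcons_path /= in adjp *; rewrite uw; move: adjp => /= /andP[-> ->] /=.
rewrite adj_sym ub /=; move: unq => /= /andP[-> ->]; rewrite !andbT.
apply: contra uS; rewrite !inE => /or3P[/eqP->//|/eqP->|zp].
  by apply: sub; rewrite inE eqxx.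
by apply: sub; rewrite inE zp orbT.
Qed.

(** If every vertex had two neighbours in [S], a path could be prolonged forever: one of the two
    differs from the preceding vertex, and it cannot be an earlier one without closing a cycle. *)
Lemma acyclic_leaf S : S != set0 ->
  exists2 v, v \in S & neighbors S v = set0 \/
    exists2 w, w \in S & neighbors S v = [set w].
Proof.
case/set0Pn => v0 v0S; case: (boolP [exists v in S, #|neighbors S v| <= 1]).
  case/existsP => v /andP[vS]; rewrite leq_eqVlt => /orP[/cards1P[w Ew]|].
    exists v => //; right; exists w => //.
    have : w \in neighbors S v by rewrite Ew set11.
    by rewrite in_neighbors => /andP[].
  by rewrite ltnS leqn0 cards_eq0 => /eqP Ev; exists v => //; left.
rewrite negb_exists => /forallP deg2.
have long n : exists v, exists p,
    [/\ v \in S, {subset p <= S}, path (@adj G) v p, uniq (v :: p) & size p = n].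
  elim: n => [|n [v [p [vS pS pth unq szp]]]]; first by exists v0, [::].
  have [z /and3P[zS vz zp]] : exists z, [&& z \in S, adj v z & z != head v p].
    have := deg2 v; rewrite vS /= -ltnNge => /card_gt1P[a [b []]].
    rewrite !in_neighbors => /andP[aS va] /andP[bS vb] ab.
    have [ah|ah] := eqVneq a (head v p); last by exists a; rewrite aS va ah.
    by exists b; rewrite bS vb -ah eq_sym ab.
  exists z, (v :: p); split=> //=.
  - by move=> y; rewrite inE => /orP[/eqP->|/pS].
  - by rewrite adj_sym vz.
  - have /= -> := unq; rewrite andbT inE negb_or.
    apply/andP; split.
      by apply: contraTneq vz => ->; rewrite adj_irr.
    apply/negP => zin.
    case: p pS pth unq szp zp zin => //= y p pS /andP[vy pth] unq _ zy.
    rewrite inE (negPf zy) /= => zin.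
    case/splitPr: zin pth unq pS => p1 p2 pth unq pS.
    apply: (@acyclic [:: v, y & rcons p1 z]); first by rewrite /= size_rcons.
    move: pth; rewrite cat_path /= => /and3P[pth1 lz _].
    rewrite /ucycle /= vy rcons_path rcons_path last_rcons pth1 lz adj_sym vz /=.
    move: unq; rewrite -cat_rcons /=.
    rewrite !inE !mem_cat !negb_or cat_uniq => /and3P[/and3P[-> -> _]].
    by move=> /andP[-> _] /and3P[-> _ _].
  - by rewrite szp.
have [v [p [_ _ _ unq szp]]] := long #|G|.
by have := card_uniqP unq; have := max_card (mem (v :: p)) => + E; rewrite E /= szp ltnn.
Qed.

Section ForestMgf.
Local Open Scope ring_scope.
Variables (R : realFieldType) (x : R).
Hypothesis x0 : 0 < x.

(** Removing a leaf, and then its neighbour, reproduces the recurrence of [path_mgf]. What remains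
    may be disconnected, so the bound is proved for all vertex sets. *)
Lemma mgf_le_path S : mgf x S <= path_mgf x #|S|.
Proof.
have [n] := ubnP #|S|; elim: n S => // n IH S leS.
have [->|S0] := eqVneq S set0; first by rewrite mgf0 cards0.
have [v vS nb] := acyclic_leaf S0.
have := cardsD1 v S; rewrite vS add1n => cS.
have cv : (#|S :\ v| < n)%N by rewrite -ltnS -cS.
have IHv := IH _ cv.
have nbE : \sum_(w in S | adj v w) mgf x (S :\ v :\ w) =
    \sum_(w in neighbors S v) mgf x (S :\ v :\ w).
  by apply: eq_bigl => w; rewrite in_neighbors.
rewrite (mgf_expand x vS) nbE; case: nb => [->|[w wS E]].
  by rewrite big_set0 mulr0 addr0 cS (le_trans IHv) // path_mgf_leS.
rewrite E big_set1; have := cardsD1 w (S :\ v).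
have wv : w != v.
  have : w \in neighbors S v by rewrite E set11.
  by apply: contraTneq => ->; rewrite in_neighbors adj_irr andbF.
rewrite !inE wv wS /= add1n => cw; rewrite cS cw path_mgfSS.
apply: lerD; first by rewrite -cw.
by rewrite ler_pM2l // IH // (leq_ltn_trans _ cv) // cw.
Qed.

End ForestMgf.

End Forest.

(** * Branches, components and bridges *)

Section Branches.
Variable G : sgraph.
Implicit Types (A B S : {set G}) (u v w : G).

Definition bridge A B u w :=
  [/\ [disjoint A & B], u \in A, w \in B, adj u w &
      forall a b, a \in A -> b \in B -> adj a b -> a = u /\ b = w].

Lemma bridge_sym A B u w : bridge A B u w -> bridge B A w u.
Proof.
case=> dAB uA wB uw br; split=> //; first by rewrite disjoint_sym.
  by rewrite adj_sym.
by move=> b a bB aA; rewrite adj_sym => /(br a b aA bB) [].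
Qed.

Lemma neighbors_bridge A B u w : bridge A B u w ->
  neighbors (A :|: B) u = w |: neighbors A u /\ w \notin neighbors A u.
Proof.
case=> dAB uA wB uw br; split; last first.
  by rewrite in_neighbors (disjointFl dAB wB).
apply/setP => z; rewrite in_setU1 !in_neighbors inE.
have [->|zw] := eqVneq z w; first by rewrite wB orbT uw.
have [zA|zA] //= := boolP (z \in A).
apply/andP => -[zB uz]; case/eqP: zw.
by case: (br u z uA zB uz).
Qed.

Lemma card_neighbors_bridge A B u w : bridge A B u w ->
  #|neighbors (A :|: B) u| = #|neighbors A u|.+1.
Proof. by case/neighbors_bridge=> -> nw; rewrite cardsU1 nw. Qed.

Lemma neighbors_bridge_id A B u w z : bridge A B u w -> z \in A -> z != u ->
  neighbors (A :|: B) z = neighbors A z.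
Proof.
case=> dAB uA wB uw br zA zu; apply/setP => y; rewrite !in_neighbors inE.
have [yA|yA] //= := boolP (y \in A).
by apply/andP => -[yB zy]; case: (br z y zA yB zy) => zu' _; rewrite zu' eqxx in zu.
Qed.

Lemma bridge_disjointW A B A' B' u w a b : bridge A B u w ->
  A' \subset A -> B' \subset B -> (u \notin A') || (w \notin B') ->
  a \in A' -> b \in B' -> ~~ adj a b.
Proof.
case=> dAB uA wB uw br sA sB nuw aA bB; apply/negP => ab.
have [au bw] := br a b (subsetP sA a aA) (subsetP sB b bB) ab.
by move: nuw; rewrite -au -bw aA bB.
Qed.

Lemma connect_adj_in_mem S v z : v \in S -> connect (adj_in S) v z -> z \in S.
Proof.
move=> vS /connectP[p pth ->].
have [_ sub] := path_adj_in pth.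
by case: p {pth} sub => //= y p; apply; rewrite mem_last.
Qed.

Lemma component_sub S w : w \in S -> component S w \subset S.
Proof. by move=> wS; apply/subsetP => z; rewrite inE => /(connect_adj_in_mem wS). Qed.

Lemma mem_component S w : w \in component S w.
Proof. by rewrite inE connect0. Qed.

Lemma component_step S w y z : y \in component S w -> adj_in S y z ->
  z \in component S w.
Proof. by rewrite !inE => wy yz; apply: connect_trans wy (connect1 yz). Qed.

Lemma connect_ind S u (P : G -> Prop) : P u ->
  (forall y z, P y -> adj_in S y z -> P z) ->
  forall z, connect (adj_in S) u z -> P z.
Proof.
move=> Pu step z /connectP[p]; elim: p u Pu => /= [|y p IH] u Pu.
  by move=> _ ->.
by case/andP=> uy pth Ez; apply: IH pth Ez; apply: step Pu uy.
Qed.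

Lemma component_connected S w : connected_from (component S w) w.
Proof.
move=> z; rewrite inE => wz.
suff: z \in component S w /\ connect (adj_in (component S w)) w z by case.
move: z wz; apply: connect_ind; first by rewrite mem_component.
move=> y z [yC wy] yz; have zC := component_step yC yz; split=> //.
apply: connect_trans wy (connect1 _).
by case/and3P: yz => _ _; rewrite /adj_in yC zC.
Qed.

(** Each vertex on a walk from [u] lies in the branch or is reachable outside of it: the branch can
    be left only through [u], where the walk starts afresh. *)
Lemma connected_setD_component S u w : u \in S -> w \in S :\ u ->
  connected_from S u -> connected_from (S :\: component (S :\ u) w) u.
Proof.
set C := component _ _ => uS wSu conS z; rewrite inE => /andP[zC zS].
have uC : u \notin C.
  by apply: contraL (component_sub wSu); move=> uC; apply/subsetPn; exists u; rewrite ?setD11.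
suff: z \in C \/ connect (adj_in (S :\: C)) u z by case=> // zC'; rewrite zC' in zC.
move: z {zC zS} (conS z zS); apply: connect_ind; first by right.
move=> y z IH /and3P[yS zS yz].
have [zC|zC] := boolP (z \in C); first by left.
right; have [->|zu] := eqVneq z u; first exact: connect0.
case: IH => [yC|cy].
  case/negP: zC; apply: (component_step yC).
  have := subsetP (component_sub wSu) y yC; rewrite /adj_in !inE yz zS zu.
  by case/andP=> -> ->.
have [yu|yu] := eqVneq y u.
  by apply: connect1; rewrite yu in yz; rewrite /adj_in !in_setD uC uS zC zS yz.
apply: connect_trans cy (connect1 _); rewrite /adj_in !in_setD zC zS yS yz !andbT.
apply: contra zC => yC; apply: (component_step yC).
by rewrite /adj_in !inE yu yS zu zS yz.
Qed.

Lemma exists_branch S u z : connected_from S u -> z \in S -> z != u ->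
  exists w, [/\ w \in S, adj u w & z \in component (S :\ u) w].
Proof.
move=> conS zS; move: (conS z zS).
suff: forall z, connect (adj_in S) u z ->
    z = u \/ exists w, [/\ w \in S, adj u w & z \in component (S :\ u) w].
  by move=> H /H[->|//]; rewrite eqxx.
apply: connect_ind; first by left.
move=> {zS}y {}z IH /and3P[yS zS yz].
have [->|zu] := eqVneq z u; [by left|right].
case: IH => [yu|[w [wS uw yC]]].
  by exists z; rewrite -yu mem_component.
exists w; split=> //; apply: (component_step yC).
have wu : w \in S :\ u.
  by rewrite !inE wS andbT; apply: contraTneq uw => ->; rewrite adj_irr.
have := subsetP (component_sub wu) y yC; rewrite /adj_in !inE zu zS yz.
by case/andP=> -> ->.
Qed.

Hypothesis acyclic : is_acyclic G.

(** An edge into the branch from outside starts at [u], as the branch is a component of [S :\ u]; it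
    ends at [w], as two edges from [u] into a connected set would close a cycle. *)
Lemma branch_bridge S u w : u \in S -> w \in S -> adj u w ->
  bridge (S :\: component (S :\ u) w) (component (S :\ u) w) u w.
Proof.
set C := component _ _ => uS wS uw.
have wSu : w \in S :\ u.
  by rewrite !inE wS andbT; apply: contraTneq uw => ->; rewrite adj_irr.
have CSu := component_sub wSu; rewrite -/C in CSu.
have uC : u \notin C.
  by apply: contraL CSu; move=> uC; apply/subsetPn; exists u; rewrite ?setD11.
split=> //.
- by rewrite disjoints_subset setDE subsetIr.
- by rewrite inE uC.
- exact: mem_component.
move=> a b; rewrite inE => /andP[aC aS] bC ab.
have au : a = u.
  apply/eqP; apply: contraNT aC => au; apply: (component_step bC).
  have := subsetP CSu b bC; rewrite /adj_in !inE au aS adj_sym ab !andbT.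
  by case/andP=> -> ->.
split=> //; rewrite au in ab; move: bC; rewrite inE => bC.
by apply: (acyclic_unique_neighbor acyclic (negbT (setD11 u S)) wSu bC).
Qed.

Lemma component_union S u w : w \in S -> adj u w ->
  (S :\: component (S :\ u) w) :|: component (S :\ u) w = S.
Proof.
move=> wS uw; rewrite setUC; apply/setP => z; rewrite !in_setU !in_setD.
case: (boolP (z \in component _ _)) => //= zC.
have wSu : w \in S :\ u.
  by rewrite !inE wS andbT; apply: contraTneq uw => ->; rewrite adj_irr.
by have := subsetP (component_sub wSu) z zC; rewrite inE => /andP[_ ->].
Qed.

End Branches.

(** * Straightening the branches at the hubs *)

Section Spiders.
Variable G : sgraph.
Hypothesis acyclic : is_acyclic G.
Implicit Types (A B S : {set G}) (u v w : G).

(* Disjointness of the paths in [L] is not part of the definition. *)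
Definition spider S u (a : seq nat) (L : seq (seq G)) :=
  [/\ shape L = a, all (path (@adj G) u) L & S =i u :: flatten L].

Section Order.
Local Open Scope ring_scope.
Variables (R : realFieldType) (x : R).
Hypothesis x0 : 0 < x.
Local Notation mgf := (mgf x).
Local Notation p := (path_mgf x).

Lemma bridge_mgf A B u w : bridge A B u w ->
  mgf (A :|: B) = mgf A * mgf B + x * mgf (A :\ u) * mgf (B :\ w).
Proof. by case=> *; apply: mgf_bridge. Qed.

Lemma bridge_mgfD1 A B u w : bridge A B u w ->
  mgf ((A :|: B) :\ u) = mgf (A :\ u) * mgf B.
Proof.
move=> br; case: (br) => dAB uA wB uw _.
have -> : (A :|: B) :\ u = (A :\ u) :|: B.
  rewrite setDUl; congr (_ :|: _); apply/setDidPl.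
  by rewrite disjoint_sym disjoints1 (disjointFr dAB uA).
apply: mgf_setU; first exact: disjointWl (subsetDl _ _) dAB.
by move=> a b; apply: (bridge_disjointW br); rewrite ?subsetDl // setD11.
Qed.

(* Equality in the bounds for both factors of a rooted branch forces the
   branch to be a path starting at its root. *)
Lemma path_of_mgf B w : w \in B -> connected_from B w ->
  mgf B = p #|B| -> mgf (B :\ w) = p #|B :\ w| ->
  exists2 s, path (@adj G) w s & B =i w :: s /\ size s = #|B|.-1.
Proof.
have [n] := ubnP #|B|; elim: n B w => // n IH B w leB wB conB EB EBw.
have cB := cardsD1 w B; rewrite wB add1n in cB.
have [Bw0|/set0Pn[z]] := eqVneq (B :\ w) set0.
  exists [::] => //; rewrite cB Bw0 cards0; split=> // z.
  by rewrite -(setD1K wB) Bw0 setU0 inE mem_seq1.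
rewrite !inE => /andP[zw zB].
have [w' [w'B ww' _]] := exists_branch conB zB zw.
have br := branch_bridge acyclic wB w'B ww'.
have EU := component_union w'B ww'.
set A := B :\: _ in br EU; set B' := component _ _ in br EU.
case: (br) => dAB wA w'B' _ _.
have cAB : (#|A| + #|B'| = #|B|)%N by rewrite -EU cardsU disjoint_setI0 ?cards0 ?subn0.
have cA := cardsD1 w A; rewrite wA add1n in cA.
have cB' := cardsD1 w' B'; rewrite w'B' add1n in cB'.
(* A further branch at [w] would split [B :\ w] into two nonempty parts without edges between them,
   and by [path_mgf_mul_lt] the equality for [B :\ w] would fail. *)
have Aw0 : #|A :\ w| = 0%N.
  apply/eqP; apply: contraT; rewrite -lt0n => Aw.
  have := bridge_mgfD1 br; rewrite EU EBw => E.
  have : mgf (A :\ w) * mgf B' < p #|B :\ w|.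
    have -> : #|B :\ w| = (#|A :\ w| + #|B'|)%N.
      by apply: succn_inj; rewrite -cB -cAB cA.
    apply: le_lt_trans (path_mgf_mul_lt x0 Aw _); last by rewrite cB'.
    by rewrite ler_pM ?mgf_le_path // ltW // mgf_gt0.
  by rewrite E ltxx.
have A1 : A = [set w].
  by rewrite -(setD1K wA) (cards0_eq Aw0) setU0.
have mA : mgf A = 1.
  rewrite (mgf_expand x wA) (cards0_eq Aw0) mgf0 big1 ?mulr0 ?addr0 // => y.
  by rewrite A1 inE => /andP[/eqP->]; rewrite adj_irr.
have := bridge_mgfD1 br; rewrite EU (cards0_eq Aw0) mgf0 mul1r EBw => EB'.
have cBw : #|B :\ w| = #|B'| by apply: succn_inj; rewrite -cB -cAB A1 cards1.
have := bridge_mgf br; rewrite EU (cards0_eq Aw0) mA mgf0 mul1r mulr1 -EB' EB.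
rewrite cB cBw cB' path_mgfSS => /addrI/(mulfI (lt0r_neq0 x0)) EB'w.
have [||||| s pths [Es szs]] := IH B' w'.
- by rewrite -ltnS (leq_trans _ leB) // ltnS cB cBw.
- exact: w'B'.
- exact: component_connected.
- by rewrite -EB' cBw.
- by rewrite -EB'w.
exists (w' :: s); first by rewrite /= ww'.
split; last by rewrite /= szs cB'.
by move=> y; rewrite -EU A1 in_setU1 Es inE [in RHS]inE.
Qed.

Lemma eq_of_le_sum (a a' b b' c c' d d' : R) :
  0 < a -> a <= a' -> 0 < b -> b <= b' -> 0 < c -> c <= c' ->
  0 < d -> d <= d' ->
  a * b + x * c * d <= a' * b' + x * c' * d' /\
  (a * b + x * c * d = a' * b' + x * c' * d' -> [/\ a = a', b = b' & d = d']).
Proof.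
move=> a0 aa b0 bb c0 cc d0 dd.
have le1 : a * b <= a' * b' by rewrite ler_pM // ltW.
have le2 : x * c * d <= x * c' * d'.
  by rewrite -!mulrA ler_pM2l // ler_pM // ltW.
split; first exact: lerD.
move=> E.
have E1 : a * b = a' * b' by lra.
have E2 : c * d = c' * d'.
  by apply: (mulfI (lt0r_neq0 x0)); rewrite !mulrA; lra.
have prod (e f e' f' : R) : 0 < e -> e <= e' -> 0 < f -> f <= f' ->
    e * f = e' * f' -> e = e' /\ f = f'.
  move=> e0 ee f0 ff Eef.
  have Ee : e = e'.
    apply/le_anti; rewrite ee /= -(ler_pM2r f0) Eef.
    by rewrite ler_pM2l // (lt_le_trans e0).
  by split=> //; apply: (mulfI (lt0r_neq0 e0)); rewrite Eef Ee.
have [-> ->] := prod _ _ _ _ a0 aa b0 bb E1.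
by have [_ ->] := prod _ _ _ _ c0 cc d0 dd E2.
Qed.

End Order.

(** Induction on the number of branches: the bridge to a branch yields the recurrence
    [spider_mgf_cons], with the branch replaced by a path of its size. The bound for [S :\ u] is
    carried along because the next bridge expansion uses it. *)
Lemma spider_bound (R : realFieldType) S u : u \in S -> connected_from S u ->
  exists a : seq nat,
  [/\ size a = #|neighbors S u|, all (leq 1) a, sumn a + 1 = #|S| &
    forall x : R, (0 < x)%R ->
    [/\ (mgf x (S :\ u) <= legs_mgf x a)%R, (mgf x S <= spider_mgf x a)%R &
        mgf x S = spider_mgf x a -> exists L, spider S u a L]].
Proof.
have [n] := ubnP #|neighbors S u|; elim: n S => // n IH S leS uS conS.
have [N0|/set0Pn[w]] := eqVneq (neighbors S u) set0.
  have S1 : S = [set u].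
    apply/setP => z; rewrite inE; apply/idP/eqP => [zS|->//].
    apply/eqP; apply: contraT => zu.
    have [w [wS uw _]] := exists_branch conS zS zu.
    by have := in_neighbors S u w; rewrite N0 wS uw inE.
  exists [::]; split=> //; rewrite ?N0 ?cards0 ?S1 ?cards1 // => x x0.
  have E1 : mgf x [set u] = 1%R.
    rewrite (mgf_expand x (set11 u)) setDv mgf0 big1 ?mulr0 ?addr0 // => y.
    by rewrite inE => /andP[/eqP->]; rewrite adj_irr.
  rewrite setDv mgf0 E1 /spider_mgf /legs_mgf !big_nil mulr0 addr0 mulr1 lexx.
  split=> // _; exists [::]; split=> // z.
  by rewrite inE mem_seq1.
rewrite in_neighbors => /andP[wS uw].
have wSu : w \in S :\ u.
  by rewrite !inE wS andbT; apply: contraTneq uw => ->; rewrite adj_irr.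
have br := branch_bridge acyclic uS wS uw.
have EU := component_union wS uw.
have conA := connected_setD_component uS wSu conS.
have conB : connected_from (component (S :\ u) w) w by apply: component_connected.
set A := S :\: _ in br EU conA; set B := component _ _ in br EU conB.
case: (br) => dAB uA wB _ _.
have cN := card_neighbors_bridge br; rewrite EU in cN.
have [|a' [sza Ha sma bnd]] := IH A _ uA conA.
  by rewrite -ltnS (leq_trans _ leS) // ltnS cN.
have cS : #|A| + #|B| = #|S| by rewrite -EU cardsU disjoint_setI0 ?cards0 ?subn0.
have cB := cardsD1 w B; rewrite wB add1n in cB.
exists (#|B| :: a'); split=> /=.
- by rewrite sza cN.
- by rewrite Ha andbT cB.
- by rewrite -addnA sma addnC cS.
move=> x x0; have [leP leQ EQ] := bnd x x0.
rewrite -EU (bridge_mgfD1 x br) (bridge_mgf x br).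
rewrite legs_mgf_cons (spider_mgf_cons x0).
have leB := mgf_le_path acyclic x0 B.
have leBw := mgf_le_path acyclic x0 (B :\ w).
have cBw : #|B|.-1 = #|B :\ w| by rewrite cB.
have gt0 := mgf_gt0 x0.
have [le eq] := eq_of_le_sum x0 (gt0 _ A) leQ (gt0 _ B) leB (gt0 _ (A :\ u)) leP
  (gt0 _ (B :\ w)) leBw.
split.
- by rewrite mulrC ler_pM // ltW.
- by rewrite cBw [X in (_ <= X + _)%R]mulrC [X in (_ <= _ + X)%R]mulrAC.
- rewrite cBw => E; have [|EA EB EBw] := eq.
    by rewrite E; ring.
  have [L [shL pthL memL]] := EQ EA.
  have [s pths [Es szs]] := path_of_mgf x0 wB conB EB EBw.
  exists ((w :: s) :: L); split.
  + by rewrite /= shL szs cB.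
  + by rewrite /= uw pths.
  + move=> z; have -> : flatten ((w :: s) :: L) = w :: s ++ flatten L by [].
    rewrite in_setU memL Es !inE mem_cat.
    by case: (z == u); case: (z == w); case: (z \in s); rewrite ?orbT ?orbF.
Qed.

End Spiders.

Section Hubs.
Variable G : sgraph.
Hypothesis acyclic : is_acyclic G.
Implicit Types (A B S : {set G}) (u v w : G).

Lemma degreeE v : degree v = #|neighbors [set: G] v|.
Proof. by apply: eq_card => w; rewrite in_neighbors !inE. Qed.

Lemma cards_bridge A B u w : bridge A B u w -> #|A :|: B| = #|A| + #|B|.
Proof. by case=> dAB _ _ _ _; rewrite cardsU disjoint_setI0 ?cards0 ?subn0. Qed.

Lemma adjacent_hubs (R : realFieldType) u v :
  connected_from [set: G] u -> adj u v ->
  exists a b : seq nat,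
  [/\ size a = (degree u).-1 /\ size b = (degree v).-1,
      all (leq 1) a, all (leq 1) b, sumn a + sumn b + 2 = #|G| &
   forall x : R, (0 < x)%R ->
     (mgf x [set: G] <= adjacent_mgf x a b)%R /\
     (mgf x [set: G] = adjacent_mgf x a b -> exists A B La Lb,
        [/\ A :|: B = [set: G], spider A u a La & spider B v b Lb])].
Proof.
move=> conG uv; rewrite !degreeE.
have [uT vT] : u \in [set: G] /\ v \in [set: G] by [].
have vTu : v \in [set: G] :\ u.
  by rewrite !inE andbT; apply: contraTneq uv => ->; rewrite adj_irr.
have br := branch_bridge acyclic uT vT uv.
have EU := component_union vT uv.
have conA := connected_setD_component uT vTu conG.
have conB : connected_from (component ([set: G] :\ u) v) v.
  by apply: component_connected.
set A := _ :\: _ in br EU conA; set B := component _ _ in br EU conB.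
have [_ uA vB _ _] := br.
have [a [sza Ha sma bnda]] := spider_bound acyclic R uA conA.
have [b [szb Hb smb bndb]] := spider_bound acyclic R vB conB.
exists a, b; split=> //.
- rewrite -EU (card_neighbors_bridge br) setUC.
  by rewrite (card_neighbors_bridge (bridge_sym br)) sza szb.
- by rewrite -cardsT -EU (cards_bridge br) -sma -smb addnACA.
move=> x x0.
have [leP leQ EQ] := bnda x x0; have [leO leR ER] := bndb x x0.
have gt0 := mgf_gt0 x0.
have [le eq] := eq_of_le_sum x0 (gt0 _ A) leQ (gt0 _ B) leR (gt0 _ (A :\ u)) leP
  (gt0 _ (B :\ v)) leO.
rewrite -EU (bridge_mgf x br); split=> // /eq[/EQ[La spA] /ER[Lb spB] _].
by exists A, B, La, Lb.
Qed.

(** The part [B] between the hubs consists of the path joining them and of everything that hangs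
    from it; it is straightened as a whole to an inner path with [s = #|B|] vertices. *)
Lemma distant_hubs (R : realFieldType) u v :
  connected_from [set: G] u -> u != v -> ~~ adj u v ->
  exists s (a b : seq nat),
  [/\ size a = (degree u).-1 /\ size b = (degree v).-1,
      all (leq 1) a, all (leq 1) b,
      0 < s /\ sumn a + sumn b + s + 2 = #|G| &
   forall x : R, (0 < x)%R -> (mgf x [set: G] <= distant_mgf x s a b)%R].
Proof.
move=> conG uv nuv; rewrite !degreeE.
have [uT vT] : u \in [set: G] /\ v \in [set: G] by [].
have [w0 [w0T uw0 vC]] : exists w, [/\ w \in [set: G], adj u w &
    v \in component ([set: G] :\ u) w].
  by apply: exists_branch conG vT _; rewrite eq_sym.
have w0Tu : w0 \in [set: G] :\ u.
  by rewrite !inE andbT; apply: contraTneq uw0 => ->; rewrite adj_irr.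
have br := branch_bridge acyclic uT w0T uw0.
have EU := component_union w0T uw0.
have conA := connected_setD_component uT w0Tu conG.
have conW : connected_from (component ([set: G] :\ u) w0) w0.
  by apply: component_connected.
set A := _ :\: _ in br EU conA; set W := component _ _ in br EU conW vC.
have [_ uA w0W _ _] := br.
have vw0 : v != w0 by apply: contraNneq nuv => ->.
have conv : connected_from W v.
  move=> z zW; apply: connect_trans (conW z zW).
  rewrite (@sym_connect_sym _ (adj_in W)) ?conW // => y t.
  by rewrite /adj_in adj_sym andbCA.
have [w1 [w1W vw1 w0B]] : exists w, [/\ w \in W, adj v w &
    w0 \in component (W :\ v) w].
  by apply: exists_branch conv w0W _; rewrite eq_sym.
have w1Wv : w1 \in W :\ v.
  by rewrite in_setD1 w1W andbT; apply: contraTneq vw1 => ->; rewrite adj_irr.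
have br' := branch_bridge acyclic vC w1W vw1.
have EW := component_union w1W vw1.
have conV := connected_setD_component vC w1Wv conv.
set V := W :\: _ in br' EW conV; set B := component _ _ in br' EW w0B.
have [dVB vV w1B _ _] := br'.
have [a [sza Ha sma bnda]] := spider_bound acyclic R uA conA.
have [b [szb Hb smb bndb]] := spider_bound acyclic R vV conV.
have cB := cardsD1 w0 B; rewrite w0B add1n in cB.
exists #|B|, a, b; split=> //.
- rewrite -{1}EU (card_neighbors_bridge br) sza; split=> //.
  rewrite -EU setUC (neighbors_bridge_id (bridge_sym br)) // -EW.
  by rewrite (card_neighbors_bridge br') szb.
- rewrite cB; split=> //.
  rewrite -cardsT -EU (cards_bridge br) -EW (cards_bridge br') -sma -smb -cB.
  by move: (sumn a) (sumn b) #|B|; clear; lia.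
move=> x x0.
have [leP leQ _] := bnda x x0; have [leO leR _] := bndb x x0.
have gt0 := mgf_gt0 x0.
(* Bounds the side of [v] together with [s] vertices of [B]. For [s = 0] the hub [v] has no inner
   neighbour left, hence the 0; at [s = #|B :\ w0|] this becomes the 0 of [distant_mgf] for a single
   inner vertex, which cannot be matched to both hubs. *)
pose w s := (spider_mgf x b * path_mgf x s + x * legs_mgf x b *
  (if s is s'.+1 then path_mgf x s' else 0))%R.
have -> : distant_mgf x #|B| a b =
    (spider_mgf x a * w #|B| + x * legs_mgf x a * w #|B :\ w0|)%R.
  by rewrite cB /w /distant_mgf; case: #|B :\ w0| => [|s] /=; ring.
have legs0 := legs_mgf_gt0 x0; have spi0 := spider_mgf_gt0 x0.
have leW : (mgf x W <= w #|B|)%R.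
  have leB := mgf_le_path acyclic x0 B.
  have leBw := mgf_le_path acyclic x0 (B :\ w1).
  have cB1 := cardsD1 w1 B; rewrite w1B add1n in cB1.
  have := eq_of_le_sum x0 (gt0 _ V) leR (gt0 _ B) leB (gt0 _ (V :\ v)) leO
    (gt0 _ (B :\ w1)) leBw.
  by case=> + _; rewrite -(bridge_mgf x br') EW /w {3}cB1.
have leWw : (mgf x (W :\ w0) <= w #|B :\ w0|)%R.
  have leB := mgf_le_path acyclic x0 (B :\ w0).
  have w0V : w0 \notin V by rewrite (disjointFl dVB w0B).
  have EWw : W :\ w0 = V :|: (B :\ w0).
    rewrite -EW setDUl; congr (_ :|: _); apply/setDidPl.
    by rewrite disjoint_sym disjoints1.
  have [w01|w01] := eqVneq w0 w1.
    rewrite EWw mgf_setU.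
    - rewrite /w -[leLHS]addr0 lerD //.
        by rewrite ler_pM // ltW.
      rewrite !mulr_ge0 ?(ltW x0) ?(ltW (legs0 b)) //.
      by case: #|_| => // k; rewrite ltW // path_mgf_gt0.
    - by rewrite (disjointWr (subsetDl _ _) dVB).
    - move=> y z; apply: (bridge_disjointW br'); rewrite ?subsetDl //.
      by rewrite w01 setD11 orbT.
  have br'' : bridge V (B :\ w0) v w1.
    case: br' => *; split=> //.
    - by rewrite (disjointWr (subsetDl _ _) dVB).
    - by rewrite in_setD1 eq_sym w01.
    - by move=> y z yV /setD1P[_ zB]; auto.
  have w1B' : w1 \in B :\ w0 by rewrite in_setD1 eq_sym w01.
  have cBw := cardsD1 w1 (B :\ w0); rewrite w1B' add1n in cBw.
  have leBw := mgf_le_path acyclic x0 (B :\ w0 :\ w1).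
  have := eq_of_le_sum x0 (gt0 _ V) leR (gt0 _ (B :\ w0)) leB (gt0 _ (V :\ v)) leO
    (gt0 _ (B :\ w0 :\ w1)) leBw.
  by case=> + _; rewrite -(bridge_mgf x br'') EWw /w {3}cBw.
have := eq_of_le_sum x0 (gt0 _ A) leQ (gt0 _ W) leW (gt0 _ (A :\ u)) leP
  (gt0 _ (W :\ w0)) leWw.
by case=> + _; rewrite -(bridge_mgf x br) EU.
Qed.

End Hubs.

(** * Lower bounds from lists of disjoint paths *)

Section LowerBound.
Local Open Scope ring_scope.
Variables (R : realFieldType) (x : R) (G : sgraph).
Hypothesis x0 : 0 < x.
Implicit Types (s : seq G) (L : seq (seq G)).
Local Notation mgf := (mgf x).
Local Notation p := (path_mgf x).

Lemma disjoint_seq s1 s2 : uniq (s1 ++ s2) -> [disjoint [set z in s1] & [set z in s2]].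
Proof.
rewrite cat_uniq => /and3P[_ /hasPn ns _].
by apply/pred0P => z /=; rewrite !inE; apply/negP => /andP[z1 /ns]; rewrite z1.
Qed.

Lemma set_cat s1 s2 : [set z in s1 ++ s2] = [set z in s1] :|: [set z in s2].
Proof. by apply/setP => z; rewrite !inE mem_cat. Qed.

Lemma set_behead z s : uniq (z :: s) -> [set y in z :: s] :\ z = [set y in s].
Proof.
move=> /= /andP[zs _]; apply/setP => y; rewrite !inE.
by case: eqP => //= ->; rewrite (negPf zs).
Qed.

Lemma path_mgf_le_mgf z s : uniq (z :: s) -> path (@adj G) z s ->
  p (size s).+1 <= mgf [set y in z :: s].
Proof.
have [n] := ubnP (size s); elim: n z s => // n IH z [|w s].
  by move=> *; apply: mgf_ge1.
rewrite [size _]/= ltnS => lts unq /andP[zw pths].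
have unq' : uniq (w :: s) by case/andP: unq.
have -> : [set y in [:: z, w & s]] = [set y in [:: z]] :|: [set y in w :: s].
  by rewrite -set_cat.
apply: le_trans (mgf_bridge_ge x0 (u := z) (w := w) _ _ _ zw); first last.
- by rewrite !inE eqxx.
- by rewrite !inE.
- by apply: disjoint_seq.
rewrite !set_behead // path_mgfSS; have -> : [set y in [::] : seq G] = set0.
  by apply/setP => y; rewrite !inE.
rewrite mgf0 mulr1; apply: lerD.
  apply: le_trans (IH w s lts unq' pths) _.
  by rewrite ler_peMl ?mgf_ge1 // ltW // mgf_gt0.
rewrite ler_pM2l //; case: s lts unq' pths {unq} => [|y s] lts unq' /=.
  by move=> _; apply: mgf_ge1.
by case/andP=> _ pths; apply: IH => //; [exact: ltnW|case/andP: unq'].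
Qed.

Lemma spider_mgf_le_mgf u L : uniq (u :: flatten L) ->
  all (path (@adj G) u) L -> all (fun s => s != [::]) L ->
  legs_mgf x (shape L) <= mgf [set y in flatten L] /\
  spider_mgf x (shape L) <= mgf [set y in u :: flatten L].
Proof.
elim: L => [|[|w s] L IH] //.
  move=> _ _ _; rewrite /spider_mgf /legs_mgf !big_nil mulr0 addr0 mulr1.
  by split; apply: mgf_ge1.
have -> : flatten ((w :: s) :: L) = w :: s ++ flatten L by [].
have -> : shape ((w :: s) :: L) = (size s).+1 :: shape L by [].
rewrite !cons_uniq inE mem_cat !negb_or cat_uniq.
move=> /andP[/and3P[uw us uL] /andP[ws /and3P[unqs ns unqL]]] /andP[/andP[adjuw pths] pL] nL.
have [|leP leQ] := IH _ pL nL; first by rewrite cons_uniq uL.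
have unqws : uniq (w :: s) by rewrite /= unqs andbT; move: ws; rewrite mem_cat => /norP[].
have les : p (size s).+1 <= mgf [set y in w :: s] by apply: path_mgf_le_mgf.
have unqLs : uniq (u :: flatten L ++ w :: s).
  rewrite /= mem_cat inE !negb_or uL uw us /= cat_uniq unqL unqws /= andbT negb_or.
  move: ws; rewrite mem_cat => /norP[_ wL]; rewrite wL /=.
  by rewrite has_sym.
have d := @disjoint_seq (u :: flatten L) (w :: s) unqLs.
have Q0 : 0 <= spider_mgf x (shape L) by rewrite ltW // spider_mgf_gt0.
have P0 : 0 <= legs_mgf x (shape L) by rewrite ltW // legs_mgf_gt0.
have p0 n : 0 <= p n by rewrite ltW // path_mgf_gt0.
rewrite legs_mgf_cons (spider_mgf_cons x0); split.
  have -> : [set y in w :: s ++ flatten L] = [set y in flatten L] :|: [set y in w :: s].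
    by rewrite setUC -set_cat.
  apply: le_trans (mgf_setU_ge x0 _); last by apply: disjoint_seq; case/andP: unqLs.
  by rewrite mulrC ler_pM.
have -> : [set y in [:: u, w & s ++ flatten L]] =
    [set y in u :: flatten L] :|: [set y in w :: s].
  apply/setP => y; rewrite !inE mem_cat.
  by case: (y == u); case: (y == w); case: (y \in s); rewrite ?orbT ?orbF.
apply: le_trans (mgf_bridge_ge x0 d (u := u) (w := w) _ _ adjuw); rewrite ?inE ?eqxx //.
rewrite !set_behead //; last by move: unqLs; rewrite -cat_cons cat_uniq => /andP[].
have les' : p (size s) <= mgf [set y in s].
  case: (s) pths unqs => [|y s']; first by move=> _ _; apply: mgf_ge1.
  by case/andP=> _ pths' unqs'; apply: path_mgf_le_mgf.
apply: lerD; first by rewrite mulrC ler_pM.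
by rewrite -!mulrA ler_pM2l // mulrC ler_pM.
Qed.

Lemma adjacent_mgf_le_mgf u v Lu Lv :
  uniq ((u :: flatten Lu) ++ (v :: flatten Lv)) -> adj u v ->
  all (path (@adj G) u) Lu -> all (path (@adj G) v) Lv ->
  all (fun s => s != [::]) Lu -> all (fun s => s != [::]) Lv ->
  adjacent_mgf x (shape Lu) (shape Lv) <=
  mgf [set y in (u :: flatten Lu) ++ (v :: flatten Lv)].
Proof.
move=> unq uv pu pv nu nv.
have d := disjoint_seq unq.
move: (unq); rewrite cat_uniq => /and3P[unqu _ unqv].
have [leP leQ] := spider_mgf_le_mgf unqu pu nu.
have [leO leR] := spider_mgf_le_mgf unqv pv nv.
rewrite set_cat; apply: le_trans (mgf_bridge_ge x0 d (u := u) (w := v) _ _ uv).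
- rewrite !set_behead //; apply: lerD.
    by rewrite ler_pM // ltW // spider_mgf_gt0.
  by rewrite -!mulrA ler_pM2l // ler_pM // ltW // legs_mgf_gt0.
- by rewrite inE mem_head.
- by rewrite inE mem_head.
Qed.

End LowerBound.

(** * The tree T_b *)

Section PathWithP2sFacts.
Variables (k : nat) (c : nat -> nat).
Local Notation T := (path_P2 k c).
Local Notation leg := {i : 'I_k & 'I_(c i)}.

Lemma card_leg : #|{: leg}| = \sum_(i < k) c i.
Proof.
rewrite card_tagged sumnE big_map big_enum.
by apply: eq_bigr => i _; rewrite card_ord.
Qed.

Lemma card_path_P2 : #|T| = k + (\sum_(i < k) c i) * 2.
Proof. by rewrite card_sum card_ord card_prod card_bool card_leg. Qed.

Lemma path_P2_cases (P : T -> Prop) : (forall i : 'I_k, P (inl i)) ->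
  (forall (i : 'I_k) (j : 'I_(c i)) b, P (inr (Tagged (fun i : 'I_k => 'I_(c i)) j, b))) ->
  forall z, P z.
Proof. by move=> Pl Pr [i|[[i j] b]]; [apply: Pl|apply: Pr]. Qed.

Lemma connected_path_P2 (k0 : 0 < k) : is_connected T.
Proof.
split; first by rewrite card_path_P2 ltn_addr.
have sym := @sym_connect_sym _ (@adj T) (@adj_sym T).
pose z0 : T := inl (Ordinal k0).
suff root z : connect (@adj T) z0 z.
  by move=> y z; apply: connect_trans (root z); rewrite sym.
have hub i : connect (@adj T) z0 (inl i).
  case: i; elim=> [|i IH] lti; first by rewrite (bool_irrelevance lti k0) connect0.
  apply: connect_trans (IH (ltnW lti)) (connect1 _).
  by rewrite /= eqxx.
elim/path_P2_cases: z => [//|i j b].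
have mid : connect (@adj T) z0 (inr (Tagged (fun i : 'I_k => 'I_(c i)) j, false)).
  by apply: connect_trans (hub i) (connect1 _); rewrite /= eqxx.
case: b => //; apply: connect_trans mid (connect1 _).
by rewrite /= eqxx.
Qed.

(* A graph is acyclic if each vertex has at most one neighbour of at most its
   own rank: the two neighbours on a cycle of a vertex of maximal rank would
   contradict this. *)
Lemma acyclic_of_rank (G : sgraph) (rank : G -> nat) :
  (forall z y y', adj z y -> adj z y' -> rank y <= rank z ->
     rank y' <= rank z -> y = y') -> is_acyclic G.
Proof.
move=> inj s szs /andP[cyc unq].
have [z zs maxz] : exists2 z, z \in s & forall y, y \in s -> rank y <= rank z.
  case: s {cyc unq} szs => // z0 s _.
  have z0s : z0 \in z0 :: s by rewrite mem_head.
  by case: (arg_maxnP rank z0s) => z zs maxz; exists z.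
have [i s' Es] := rot_to zs.
move: cyc unq maxz szs; rewrite -(rot_cycle i) -(rot_uniq i) -(size_rot i) Es.
case: s' Es => [|y [|y' s']] Es // cyc unq maxz _.
have sub t : t \in [:: z, y, y' & s'] -> rank t <= rank z.
  by rewrite -Es mem_rot; apply: maxz.
have tl : last y' s' \in y' :: s' by apply: mem_last.
move: cyc => /= /and3P[zy _]; rewrite rcons_path => /andP[_ tz].
have E : y = last y' s'.
  apply: (inj z) => //; first by rewrite adj_sym.
    by apply: sub; rewrite !inE eqxx orbT.
  by apply: sub; rewrite 2!in_cons tl !orbT.
by move: unq; rewrite /= E tl andbF.
Qed.

Lemma acyclic_path_P2 : is_acyclic T.
Proof.
(* Positions along the path, then [k] and [k + 1] on every pendent path: the only neighbour of no
   larger rank is the one nearer to vertex 0. *)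
pose rank (z : T) := match z with
  | inl i => nat_of_ord i | inr (_, b) => k + b end.
apply: (@acyclic_of_rank _ rank) => -[i|[q b]] [j|[q1 b1]] [j'|[q2 b2]] //=.
- move=> ij ij' ji j'i; congr inl; apply: val_inj => /=.
  by move: ij ij' ji j'i => /orP[]/eqP + /orP[]/eqP; lia.
- by move=> _ _ _; case: i => i lti /=; lia.
- by move=> _ _; case: i => i lti /=; lia.
- by move=> _ _; case: i => i lti /=; lia.
- by move=> /andP[/eqP <- _] /andP[/eqP <- _].
- by move=> /andP[_ b0] /andP[/eqP _ bb2] _; case: b b2 b0 bb2 => [] [] //=; lia.
- by move=> /andP[/eqP _ bb2] /andP[_ b0]; case: b b1 b0 bb2 => [] [] //=; lia.
- move=> /andP[/eqP <- bb1] /andP[/eqP <- bb2] _ _; congr (inr (_, _)).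
  by case: b b1 b2 bb1 bb2 => [] [] [].
Qed.

Lemma tree_path_P2 : 0 < k -> is_tree T.
Proof. by move=> k0; split; [apply: connected_path_P2|apply: acyclic_path_P2]. Qed.

Lemma sum_ord_eq (n m : nat) : \sum_(j < n) (m == j :> nat) = (m < n).
Proof.
case: (ltnP m n) => [ltmn|lenm].
  rewrite (bigD1 (Ordinal ltmn)) //= eqxx big1 ?addn0 // => j.
  by rewrite eq_sym -val_eqE /= => /negPf->.
by rewrite big1 // => j _; apply/eqP; rewrite eqb0 gtn_eqF // (leq_trans (ltn_ord j)).
Qed.

Lemma degree_sum (G : sgraph) (z : G) : degree z = \sum_y adj z y.
Proof. by rewrite /degree -sum1dep_card big_mkcond; apply: eq_bigr => y _; case: adj. Qed.

Lemma sum_path_P2 (F : T -> nat) : \sum_z F z =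
  \sum_(i < k) F (inl i) +
  \sum_(q : leg) (F (inr (q, true)) + F (inr (q, false))).
Proof.
rewrite big_sumType /=; congr (_ + _).
rewrite (eq_bigr (fun q : leg => \sum_(b : bool) F (inr (q, b)))).
  by rewrite pair_bigA; apply: eq_bigr => -[].
by move=> q _; rewrite big_bool.
Qed.

Lemma degree_hub (i : 'I_k) :
  degree (inl i : T) = (0 < i) + (i.+1 < k) + c i.
Proof.
rewrite degree_sum sum_path_P2 /=; congr (_ + _).
  rewrite addnC -(sum_ord_eq k i.+1).
  have -> : (0 < i : nat) = \sum_(j < k) (j.+1 == i).
    case: (i) => [[|m] ltm] /=; first by rewrite big1.
    by rewrite (eq_bigr (fun j : 'I_k => (m == j) : nat)) ?sum_ord_eq ?(ltnW ltm) // => j _; rewrite eqSS eq_sym.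
  rewrite -big_split /=; apply: eq_bigr => j _.
  by case: eqP => [<-|] //=; rewrite gtn_eqF.
rewrite (eq_bigr (fun q : leg => (tag q == i) : nat)); last first.
  by move=> q _; rewrite andbF andbT.
rewrite -(sig_big_dep xpredT (fun _ => xpredT) (fun (i' : 'I_k) (j : 'I_(c i')) => (i' == i) : nat)) /=.
rewrite (bigD1 i) //= eqxx sum1_card card_ord big1 ?addn0 // => i' /negPf ->.
by rewrite big1.
Qed.

Lemma degree_middle (q : leg) : degree (inr (q, false) : T) = 2.
Proof.
rewrite degree_sum sum_path_P2 /=.
rewrite (eq_bigr (fun i => (tag q == i) : nat)); last first.
  by move=> i _; rewrite andbT.
rewrite sum_ord_eq ltn_ord; congr (_ + _).
rewrite (bigD1 q) //= eqxx big1 // => q' /negPf.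
by rewrite eq_sym => ->.
Qed.

Lemma degree_leaf (q : leg) : degree (inr (q, true) : T) = 1.
Proof.
rewrite degree_sum sum_path_P2 /= big1 ?add0n => [|i _]; last by rewrite andbF.
rewrite (bigD1 q) //= eqxx big1 // => q' /negPf.
by rewrite eq_sym => ->.
Qed.

End PathWithP2sFacts.

Lemma perm_nseq (T : eqType) (a : seq T) n y :
  perm_eq a (nseq n y) -> a = nseq n y.
Proof.
move=> p; have := perm_size p; rewrite size_nseq => <-.
by apply/all_pred1P; rewrite (perm_all _ p) all_pred1_nseq.
Qed.

(** A surjection between sets of equal size is bijective. An edge of [G] not coming from [H] would
    close the image of a path of [H] to a cycle, so preserving edges suffices. *)
Lemma isomorphic_of_hom (H G : sgraph) (f : H -> G) :
  is_connected H -> is_acyclic G -> #|H| = #|G| ->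
  (forall y, exists x, f x = y) ->
  (forall x y, adj x y -> adj (f x) (f y)) -> isomorphic G H.
Proof.
move=> [_ conH] acyG cHG surj hom.
have [g gK] : exists g : G -> H, cancel g f.
  have ex y : exists x, f x == y by have [x <-] := surj y; exists x.
  by exists (fun y => xchoose (ex y)) => y; apply/eqP; exact: (xchooseP (ex y)).
have bijg : bijective g by apply: inj_card_bij (can_inj gK) _; rewrite cHG.
have injf : injective f.
  have [g' g'K gK'] := bijg.
  by move=> x y; rewrite -(gK' x) -(gK' y) !gK => ->.
exists g => // x y; apply/idP/idP => [/hom|xy]; first by rewrite !gK.
have /connectP[p0 pth0 Ey] := conH (g x) (g y).
case/shortenP: pth0 Ey => p pth unq _ Ey.
case: p pth unq Ey => [|z [|z' p]].
- by move=> _ _ /(can_inj gK) Exy; rewrite Exy adj_irr in xy.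
- by move=> /= /andP[+ _] _ ->.
- move=> pth unq Ey.
  case: (acyG (map f [:: g x, z, z' & p])); first by rewrite size_map.
  rewrite /ucycle map_inj_uniq // unq andbT /cycle map_cons rcons_path last_map -Ey !gK.
  rewrite adj_sym xy andbT -{1}(gK x).
  elim: [:: z, z' & p] (g x) pth => //= w q IH v /andP[vw /IH ->].
  by rewrite hom.
Qed.

Section TbFacts.
Variables (Delta t : nat).
Hypotheses (Delta3 : 3 <= Delta) (t2 : 2 <= t).
Local Notation T := (T_b Delta t).

Let c i := match i with 0 => Delta - 1 | 1 => Delta - 2 | _ => 0 end.

Let ord1 : 'I_t.+2 := lift ord0 ord0.

Let h0 : T := inl ord0.
Let h1 : T := inl ord1.

Lemma sum_T_b : \sum_(i < t.+2) c i = 2 * Delta - 3.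
Proof.
rewrite big_ord_recl big_ord_recl big1 ?addn0 //= /bump /=; lia.
Qed.

Lemma card_T_b : #|T| = t + 4 * Delta - 4.
Proof. by rewrite card_path_P2 sum_T_b; lia. Qed.

Lemma degree_T_b (z : T) :
  degree z = Delta /\ (z == h0) || (z == h1) \/
  degree z <= 2 /\ ~~ ((z == h0) || (z == h1)).
Proof.
elim/path_P2_cases: z => [[i lti]|i j b]; last first.
  by right; case: b; rewrite ?degree_leaf ?degree_middle.
rewrite degree_hub /=; case: i lti => [|[|i]] lti /=.
- by left; split; [lia|].
- by left; split; [lia|].
- by right; split; [case: ltnP; lia|].
Qed.

Lemma h01 : h0 != h1.
Proof. by []. Qed.

Lemma max_degree_T_b : max_degree T = Delta.
Proof.
apply/eqP; rewrite eqn_leq; apply/andP; split.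
  by apply/bigmax_leqP => z _; case: (degree_T_b z) => -[]; lia.
have E : degree h0 = Delta by case: (degree_T_b h0) => -[]; rewrite ?eqxx.
by rewrite -[leqLHS]E; apply: (leq_bigmax (F := fun z : T => degree z)).
Qed.

Lemma hubs_T_b (P : pred nat) : P Delta -> (forall d, d <= 2 -> ~~ P d) ->
  #|[set z : T | P (degree z)]| = 2.
Proof.
move=> PD P2; suff -> : [set z : T | P (degree z)] = [set h0; h1].
  by rewrite cards2 h01.
apply/setP => z; rewrite !inE.
by case: (degree_T_b z) => -[E zE]; rewrite ?E ?PD ?zE // (negPf zE) (negPf (P2 _ E)).
Qed.

Lemma two_max_tree_T_b : two_max_tree (t + 4 * Delta - 4) Delta T.
Proof.
split; [exact: tree_path_P2|exact: card_T_b|exact: max_degree_T_b|].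
rewrite max_degree_T_b; apply: (hubs_T_b (P := fun d => d == Delta)) => // d d2.
by apply/eqP; lia.
Qed.

Lemma two_branching_T_b : two_branching T.
Proof. by apply: (hubs_T_b (P := fun d => 2 < d)) => // d; rewrite -leqNgt. Qed.

Lemma nb_2branches_T_b : 2 * Delta - 2 <= nb_2branches T.
Proof.
pose leg := {i : 'I_t.+2 & 'I_(c i)}.
(* [None] stands for the far end of the long path; its neighbour has degree 2 because [2 <= t]. *)
pose f (o : option leg) : T := if o is Some q then inr (q, true) else inl ord_max.
have injf : injective f by move=> [q|] [q'|] //= [->].
have <- : #|[set f o | o : option leg]| = 2 * Delta - 2.
  by rewrite card_imset // card_option (card_leg t.+2 c) sum_T_b; lia.
apply: subset_leq_card; apply/subsetP => z /imsetP[[q|] _ ->]; rewrite inE /=.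
  rewrite degree_leaf eqxx /=; apply/existsP; exists (inr (q, false)).
  by rewrite degree_middle /= eqxx.
have ltt : t < t.+2 by [].
have ct i : 2 <= i -> c i = 0 by case: i => [|[|]].
have dmax : degree (inl ord_max : T) = 1.
  by rewrite (@degree_hub t.+2 c) ct ?ltnn ?addn0 // ltnW.
have dt : degree (inl (Ordinal ltt) : T) = 2.
  by rewrite (@degree_hub t.+2 c) ct //= ltnSn addn0; case: (t) t2.
by rewrite dmax eqxx /=; apply/existsP; exists (inl (Ordinal ltt)); rewrite dt /= eqxx orbT.
Qed.

Let leg_seq (i : 'I_t.+2) : seq (seq T) :=
  [seq [:: inr (Tagged (fun i : 'I_t.+2 => 'I_(c i)) j, false);
           inr (Tagged (fun i : 'I_t.+2 => 'I_(c i)) j, true)] | j <- enum 'I_(c i)].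

Let tail m n : seq T := [seq inl (inord i) | i <- iota m n].

Lemma path_tail m n : m + n < t.+2 -> path (@adj T) (inl (inord m)) (tail m.+1 n).
Proof.
elim: n m => //= n IH m lt.
rewrite (IH m.+1) ?addSnnS // andbT /= !inordK ?eqxx //; lia.
Qed.

Lemma adjacent_mgf_le_T_b (R : realFieldType) (x : R) : (0 < x)%R ->
  (adjacent_mgf x (nseq (Delta - 1) 2) (t :: nseq (Delta - 2) 2) <=
   mgf x [set: T])%R.
Proof.
move=> x0.
have shape_legs i : shape (leg_seq i) = nseq (c i) 2.
  rewrite /shape -map_comp -[in RHS](size_enum_ord (c i)).
  by elim: (enum _) => //= j s ->.
have size_tail m n : size (tail m n) = n by rewrite size_map size_iota.
pose s := (h0 :: flatten (leg_seq ord0)) ++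
  (h1 :: flatten (tail 2 t :: leg_seq ord1)).
have cover z : z \in s.
  have legP (i : 'I_t.+2) (j : 'I_(c i)) b : inr (Tagged (fun i : 'I_t.+2 => 'I_(c i)) j, b) \in
      flatten (leg_seq i).
    apply/flattenP; exists [:: inr (Tagged (fun i : 'I_t.+2 => 'I_(c i)) j, false);
        inr (Tagged (fun i : 'I_t.+2 => 'I_(c i)) j, true)].
      by apply/mapP; exists j; rewrite // mem_enum.
    by rewrite !inE; case: b; rewrite eqxx ?orbT.
  rewrite mem_cat !in_cons mem_cat.
  elim/path_P2_cases: z => [i|i j b].
    case: i => [[|[|i]] lti].
    - by rewrite (_ : Ordinal lti = ord0) ?eqxx //; apply: val_inj.
    - by rewrite (_ : Ordinal lti = ord1) ?eqxx ?orbT //; apply: val_inj.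
    - suff -> : inl (Ordinal lti) \in tail 2 t by rewrite !orbT.
      apply/mapP; exists i.+2; first by rewrite mem_iota.
      by congr inl; apply: val_inj; rewrite /= inordK.
  case: i j => [[|[|i]] lti] j.
  - move: j; rewrite (_ : Ordinal lti = ord0) => [j|]; last exact: val_inj.
    by rewrite legP orbT.
  - move: j; rewrite (_ : Ordinal lti = ord1) => [j|]; last exact: val_inj.
    by rewrite legP !orbT.
  - by case: j.
have sE : [set y in s] = [set: T] by apply/setP => y; rewrite in_set in_setT cover.
have unq : uniq s.
  apply: (leq_size_uniq (enum_uniq T)) => [z _|]; first exact: cover.
  rewrite -cardE card_T_b /s size_cat /= size_cat !size_flatten !shape_legs size_tail.
  by rewrite !sumn_nseq /=; lia.
have path_legs i : all (path (@adj T) (inl i)) (leg_seq i).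
  by apply/allP => l /mapP[j _ ->] /=; rewrite !eqxx.
have nil_legs i : all (fun l => l != [::]) (leg_seq i).
  by apply/allP => l /mapP[j _ ->].
have := @adjacent_mgf_le_mgf R x T x0 h0 h1 (leg_seq ord0) (tail 2 t :: leg_seq ord1).
rewrite -/s sE.
have -> : shape (tail 2 t :: leg_seq ord1) = t :: nseq (Delta - 2) 2.
  by rewrite /= size_tail shape_legs.
have path_t : path (@adj T) h1 (tail 2 t).
  have -> : h1 = inl (inord 1) by congr inl; apply: val_inj; rewrite /= inordK.
  by apply: path_tail; lia.
have tail0 : tail 2 t != [::] by rewrite -size_eq0 size_tail; case: (t) t2.
rewrite shape_legs => /(_ unq isT (path_legs _)); apply.
- by apply/andP; split; [exact: path_t|exact: path_legs].
- exact: nil_legs.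
- by apply/andP; split; [exact: tail0|exact: nil_legs].
Qed.

Lemma isomorphic_T_b (G : sgraph) A B u v la lb La Lb :
  is_acyclic G -> #|G| = t + 4 * Delta - 4 -> A :|: B = [set: G] -> adj u v ->
  spider A u la La -> spider B v lb Lb ->
  T_b_legs (Delta - 1) (t - 2) la lb -> isomorphic G T.
Proof.
move=> acyG cG AB uv [shA pthA memA] [shB pthB memB] /andP[pa pb].
have Et : (t - 2).+2 = t by lia.
rewrite Et in pb.
have [s [Lb' [pLb szs shB']]] : exists s Lb',
    [/\ perm_eq Lb (s :: Lb'), size s = t & shape Lb' = nseq (Delta - 2) 2].
  have : t \in shape Lb by rewrite shB (perm_mem pb) mem_head.
  case/mapP=> s sLb ts; exists s, (rem s Lb); split=> //.
    exact: perm_to_rem.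
  have p1 : perm_eq (shape Lb) (size s :: shape (rem s Lb)).
    exact: perm_map (perm_to_rem sLb).
  rewrite shB (permPl pb) -ts perm_cons perm_sym in p1.
  by rewrite (perm_nseq p1) subn1 subn2.
have shA' : shape La = nseq (Delta - 1) 2 by rewrite shA; apply: perm_nseq.
have cG' := card_T_b; rewrite -cG in cG'.
(* Reads off the lists in order, with [b] as index 0 or 1; the defaults of [nth] are never reached.
   The lists are not known to be disjoint, but surjectivity and equal cardinalities make up for
   it. *)
pose f (z : T) : G := match z with
  | inl i => match nat_of_ord i with
             | 0 => u | 1 => v | j.+2 => nth u s j end
  | inr (q, b) => nth u (nth [::] (if tag q == ord0 then La else Lb') (tagged q)) b
  end.
have size_nth (L : seq (seq G)) n j : shape L = nseq n 2 -> j < n -> exists y y', nth [::] L j = [:: y; y'].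
  move=> shL jn; have szL : size L = n by rewrite -(size_map size L) -/(shape L) shL size_nseq.
  have : size (nth [::] L j) = 2.
    by rewrite -(nth_map [::] 0 size) ?szL // -/(shape L) shL nth_nseq jn.
  by case: (nth _ _ _) => [|y [|y' [|]]] // _; exists y, y'.
have pthLb : all (path (@adj G) v) (s :: Lb') by rewrite -(perm_all _ pLb).
have legT (i : 'I_t.+2) (j : 'I_(c i)) :
    let q := Tagged (fun i : 'I_t.+2 => 'I_(c i)) j in
    adj (f (inl i)) (f (inr (q, false))) /\
    adj (f (inr (q, false))) (f (inr (q, true))).
  case: i j => [[|[|i]] lti] j; last by case: j.
  - have [|y [y' E]] := @size_nth La _ j shA'; first exact: ltn_ord j.
    rewrite /= E /=.
    have := allP pthA (nth [::] La j); rewrite E /= andbT => H; apply/andP; apply: H.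
    by rewrite -E mem_nth // -(size_map size La) -/(shape La) shA' size_nseq ltn_ord.
  - have [|y [y' E]] := @size_nth Lb' _ j shB'; first exact: ltn_ord j.
    rewrite /= E /=.
    move: pthLb => /= /andP[_ pth'].
    have := allP pth' (nth [::] Lb' j); rewrite E /= andbT => H; apply/andP; apply: H.
    by rewrite -E mem_nth // -(size_map size Lb') -/(shape Lb') shB' size_nseq ltn_ord.
apply: (isomorphic_of_hom (f := f)) => //.
- exact: connected_path_P2.
- move=> y; have : y \in A :|: B by rewrite AB.
  have surj2 (L : seq (seq G)) n : shape L = nseq n 2 -> y \in flatten L ->
      exists2 j, j < n & exists b : bool, nth u (nth [::] L j) b = y.
    move=> shL /flattenP[l lL yl].
    have szL : size L = n by rewrite -(size_map size L) -/(shape L) shL size_nseq.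
    have jn : index l L < n by rewrite -szL index_mem.
    have [z [z' E]] := size_nth L n _ shL jn.
    exists (index l L) => //; rewrite E; move: yl; rewrite -(nth_index [::] lL) E !inE.
    by case/orP=> /eqP->; [exists false|exists true].
  rewrite in_setU memA memB !inE => /orP[/orP[/eqP->|yA]|/orP[/eqP->|yB]].
  + by exists h0.
  + have [j jn [b E]] := surj2 La _ shA' yA.
    by exists (inr (Tagged (fun i : 'I_t.+2 => 'I_(c i)) (Ordinal jn : 'I_(c (ord0 : 'I_t.+2))), b)).
  + by exists h1.
  + have : y \in flatten (s :: Lb').
      case/flattenP: yB => l lLb yl; apply/flattenP; exists l => //.
      by rewrite -(perm_mem pLb).
    have -> : flatten (s :: Lb') = s ++ flatten Lb' by [].
    rewrite mem_cat => /orP[ys|/(surj2 _ _ shB')[j jn [b E]]].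
      have lti : (index y s).+2 < t.+2 by rewrite !ltnS -szs index_mem.
      by exists (inl (Ordinal lti)); rewrite /= nth_index.
    by exists (inr (Tagged (fun i : 'I_t.+2 => 'I_(c i)) (Ordinal jn : 'I_(c ord1)), b)).
- have half (z z' : T) : adj z z' -> (match z, z' with
      | inl i, inl j => i.+1 = j :> nat | inl _, inr _ => True
      | inr (_, b), inr (_, b') => (b = false) /\ (b' = true)
      | _, _ => False end) -> adj (f z) (f z').
    case: z z' => [i|[q b]] [i'|[q' b']] //.
    + move=> _; have /= /andP[/(pathP u) pth _] := pthLb.
      case: i i' => [[|[|i]] lti] [i' lti'] /= E; subst i' => //=.
      * by apply: (pth 0); rewrite szs; case: (t) t2.
      * by apply: (pth i.+1); rewrite szs -ltnS -ltnS.
    + move=> /= /andP[/eqP <- /negPf ->] _.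
      by case: q' => i' j'; apply: (legT i' j').1.
    + move=> /= /andP[/eqP <- _] [-> ->].
      by case: q => i j; apply: (legT i j).2.
  move=> z z' zz'; case: (z) (z') zz' (half z z') (half z' z) => [i|[q b]] [i'|[q' b']] /= zz' H H'.
  + case/orP: zz' => /eqP E; first by apply: H => //; rewrite E eqxx.
    by rewrite adj_sym; apply: H' => //; rewrite E eqxx.
  + exact: H.
  + by rewrite adj_sym; apply: H'.
  + case/andP: zz' => qq bb; case: b b' bb H H' => [] [] // _ H H'; last by apply: H => //; rewrite qq.
    by rewrite adj_sym; apply: H' => //; rewrite eq_sym qq.
Qed.

End TbFacts.

(** * Isomorphism invariance *)

Section Isomorphism.
Variables (G H : sgraph) (f : G -> H).
Hypotheses (bijf : bijective f) (isof : forall x y, adj (f x) (f y) = adj x y).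

Lemma iso_card : #|G| = #|H|.
Proof. exact: bij_eq_card bijf. Qed.

Lemma iso_set_card (P : pred H) : #|[set x | P (f x)]| = #|[set y | P y]|.
Proof.
rewrite -(card_imset _ (bij_inj bijf)); apply: eq_card => y.
rewrite inE; apply/imsetP/idP => [[x + ->]|Py]; first by rewrite inE.
have [g fK gK] := bijf.
by exists (g y); rewrite ?inE gK.
Qed.

Lemma iso_degree x : degree (f x) = degree x.
Proof.
rewrite /degree -(iso_set_card (fun y => adj (f x) y)).
by apply: eq_card => y; rewrite !inE isof.
Qed.

Lemma iso_max_degree : max_degree G = max_degree H.
Proof.
rewrite /max_degree (reindex f) /=; last exact: onW_bij.
by apply: eq_bigr => x _; rewrite iso_degree.
Qed.

Lemma iso_degree_card (P : pred nat) :
  #|[set x : G | P (degree x)]| = #|[set y : H | P (degree y)]|.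
Proof.
rewrite -(iso_set_card (fun y => P (degree y))).
by apply: eq_card => x; rewrite !inE iso_degree.
Qed.

Lemma iso_nb_2branches : nb_2branches G = nb_2branches H.
Proof.
rewrite /nb_2branches -iso_set_card; apply: eq_card => x; rewrite !inE iso_degree.
congr (_ && _); apply/existsP/existsP => -[y /andP[xy dy]].
  by exists (f y); rewrite isof xy iso_degree.
have [g fK gK] := bijf.
by exists (g y); rewrite -isof -iso_degree gK xy.
Qed.

Lemma iso_tree : is_tree H -> is_tree G.
Proof.
have [g fK gK] := bijf.
move=> [[H0 conH] acyH]; split; first split.
- by rewrite iso_card.
- move=> x y; have /connectP[p pth Ey] := conH (f x) (f y).
  apply/connectP; exists (map g p); last by rewrite -{1}(fK x) last_map -Ey fK.
  rewrite -{1}(fK x); elim: p (f x) pth {Ey} => //= z p IH w /andP[wz /IH ->].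
  by rewrite -isof !gK wz.
- move=> s szs /andP[cyc unq]; case: (acyH (map f s)); first by rewrite size_map.
  rewrite /ucycle map_inj_uniq ?unq ?andbT; last exact: bij_inj.
  case: s cyc {szs unq} => //= x s; rewrite -map_rcons.
  by rewrite path_map (@eq_path _ _ (@adj G)) //= => y z /=; rewrite isof.
Qed.

Lemma iso_two_max_tree n Delta : two_max_tree n Delta H -> two_max_tree n Delta G.
Proof.
case=> tH cH mH dH; split; [exact: iso_tree|by rewrite iso_card| |].
  by rewrite iso_max_degree.
by rewrite iso_max_degree (iso_degree_card (fun d => d == max_degree H)).
Qed.

Lemma iso_two_branching : two_branching H -> two_branching G.
Proof. by rewrite /two_branching (iso_degree_card (fun d => 2 < d)). Qed.

Lemma iso_mgf (K : comNzRingType) (x : K) (S : {set G}) :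
  mgf x (f @: S) = mgf x S.
Proof.
have injf := bij_inj bijf.
have [n] := ubnP #|S|; elim: n S => // n IH S leS.
have [->|/set0Pn[v vS]] := eqVneq S set0; first by rewrite imset0 !mgf0.
have imD (A : {set G}) z : f @: A :\ f z = f @: (A :\ z).
  apply/setP => y; rewrite !inE; apply/andP/imsetP.
    case=> yz /imsetP[t tA Ey]; exists t => //; rewrite !inE tA andbT.
    by apply: contra yz => /eqP <-; rewrite Ey.
  case=> t /setD1P[tz tA] ->; rewrite imset_f // (inj_eq injf) tz //.
have fvS : f v \in f @: S by apply: imset_f.
have lt := card_setD1_lt vS.
rewrite (mgf_expand x vS) (mgf_expand x fvS) imD IH; last first.
  by rewrite -ltnS (leq_trans _ leS).
congr (_ + x * _)%R.
rewrite (eq_bigl (fun y => (y \in f @: [set w in S | adj v w]))); last first.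
  move=> y; apply/andP/imsetP.
    by case=> /imsetP[w wS ->]; rewrite isof => vw; exists w; rewrite // inE wS.
  by case=> w; rewrite inE => /andP[wS vw] ->; rewrite imset_f // isof.
rewrite big_imset /=; last by move=> y z _ _; apply: injf.
rewrite (eq_bigl (fun w => (w \in S) && adj v w)); last by move=> w; rewrite inE.
apply: eq_bigr => w /andP[wS _]; rewrite imD IH //.
by rewrite -ltnS (leq_trans _ leS) // ltnS (leq_ltn_trans (card_setD1_le _ _)).
Qed.

Lemma iso_mgfT (K : comNzRingType) (x : K) : mgf x [set: G] = mgf x [set: H].
Proof.
rewrite -iso_mgf; congr mgf; apply/setP => y; rewrite inE.
by have [g fK gK] := bijf; apply/imsetP; exists (g y); rewrite ?gK.
Qed.

End Isomorphism.

(** * Counting pendent vertices by degrees *)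

Section TreeDegrees.
Variable G : sgraph.
Hypothesis acyclic : is_acyclic G.
Implicit Types (A B S : {set G}) (u v w : G).

Lemma connected_fromT u : is_connected G -> connected_from [set: G] u.
Proof.
case=> _ con z _; rewrite -(eq_connect (e := @adj G)) // => x y.
by rewrite /adj_in !inE.
Qed.

(** The handshake form of having at least [#|S| - 1] edges: cutting off a branch removes one bridge,
    which counts at both of its ends. *)
Lemma sum_neighbors_ge S u : u \in S -> connected_from S u ->
  2 * #|S| <= \sum_(z in S) #|neighbors S z| + 2.
Proof.
have [n] := ubnP #|S|; elim: n S u => // n IH S u leS uS conS.
have cS := cardsD1 u S; rewrite uS add1n in cS.
have [S1|/set0Pn[z]] := eqVneq (S :\ u) set0.
  by rewrite cS S1 cards0 muln1 leq_addl.
rewrite !inE => /andP[zu zS].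
have [w [wS uw _]] := exists_branch conS zS zu.
have wSu : w \in S :\ u.
  by rewrite !inE wS andbT; apply: contraTneq uw => ->; rewrite adj_irr.
have br := branch_bridge acyclic uS wS uw.
have EU := component_union wS uw.
have conA := connected_setD_component uS wSu conS.
have conB : connected_from (component (S :\ u) w) w by apply: component_connected.
set A := S :\: _ in br EU conA; set B := component _ _ in br EU conB.
have [dAB uA wB _ _] := br.
have cU := cards_bridge br; rewrite EU in cU.
have [A0 B0] : 0 < #|A| /\ 0 < #|B|.
  by split; apply/card_gt0P; [exists u|exists w].
have IHA : 2 * #|A| <= \sum_(z in A) #|neighbors A z| + 2.
  by apply: (IH A u) => //; move: cU leS A0 B0; clear; lia.
have IHB : 2 * #|B| <= \sum_(z in B) #|neighbors B z| + 2.
  by apply: (IH B w) => //; move: cU leS A0 B0; clear; lia.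
have half A' B' u' w' : bridge A' B' u' w' ->
    \sum_(z in A') #|neighbors (A' :|: B') z| = (\sum_(z in A') #|neighbors A' z|).+1.
  move=> br'; have [_ uA' _ _ _] := br'.
  rewrite (bigD1 u') // [in RHS](bigD1 u') //= (card_neighbors_bridge br') addSn.
  congr (_ + _).+1; apply: eq_bigr => y /andP[yA yu].
  by rewrite (neighbors_bridge_id br').
have -> : \sum_(z in S) #|neighbors S z| =
    \sum_(z in A) #|neighbors S z| + \sum_(z in B) #|neighbors S z|.
  rewrite -{1}EU -bigU //; apply: eq_bigl => y.
  by rewrite inE.
rewrite -EU (half _ _ _ _ br) setUC (half _ _ _ _ (bridge_sym br)) setUC EU cU.
by move: IHA IHB; clear; lia.
Qed.

End TreeDegrees.

(** Outside [D] every vertex satisfies [degree z + (degree z == 1) <= 2]. As the degrees of a tree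
    add up to at least [2 * n - 2], at most [2 * Delta - 2] vertices are pendent. *)
Lemma nb_2branches_le n Delta (H : sgraph) : 3 <= Delta ->
  two_max_tree n Delta H -> two_branching H -> nb_2branches H <= 2 * Delta - 2.
Proof.
move=> Delta3 [[conH acyH] cH mH]; rewrite mH => c2 b2.
set D := [set x : H | degree x == Delta] in c2.
have DE z : (z \in D) = (2 < degree z).
  have sub : D \subset [set x : H | 2 < degree x].
    by apply/subsetP => y; rewrite !inE => /eqP ->.
  have -> : D = [set x : H | 2 < degree x].
    by apply/eqP; rewrite eqEcard sub; move: b2; rewrite /two_branching c2 => ->.
  by rewrite inE.
have leaves : nb_2branches H <= \sum_(z : H) (degree z == 1).
  rewrite -[leqRHS]big_mkcond /= sum1_card; apply: subset_leq_card.
  by apply/subsetP => z; rewrite !inE => /andP[].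
have /card_gt0P[u _] : 0 < #|D| by rewrite c2.
have := sum_neighbors_ge acyH (in_setT u) (connected_fromT u conH).
rewrite cardsT cH (eq_bigr (fun z : H => degree z)); last first.
  by move=> z _; rewrite degreeE.
rewrite (eq_bigl xpredT) => [|z]; last by rewrite inE.
have sumD : \sum_(z : H) degree z + \sum_(z : H) (degree z == 1) <= 2 * Delta + (n - 2) * 2.
  rewrite -big_split /= (bigID (mem D)) /= leq_add //.
    rewrite (eq_bigr (fun _ => Delta)) ?sum_nat_const ?c2 // => z.
    by rewrite inE => /eqP ->; case: eqP; rewrite ?addn0 // => E; move: Delta3; rewrite E.
  have -> : n - 2 = #|~: D| by rewrite -cH -(cardsC D) c2 addKn.
  rewrite -sum_nat_const [leqLHS](eq_bigl (fun z => z \in ~: D)); last first.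
    by move=> z; rewrite [in RHS]inE.
  apply: leq_sum => z; rewrite inE DE -leqNgt.
  by case: (degree z) => [|[|[|]]].
move: sumD leaves Delta3 cH; rewrite -(cardsC D) c2.
by clear; lia.
Qed.

(** * Eigenvalues and matchings *)

Section Isolate.
Local Open Scope ring_scope.
Variables (K : comNzRingType) (n : nat).
Implicit Types (N : 'M[K]_n) (i j k : 'I_n).

(** Stands for the deletion of row and column [k] while keeping the dimension, so that the matrices
    of all induced subgraphs have one type. *)
Definition isolate k N : 'M[K]_n :=
  \matrix_(i, j) if (i == k) || (j == k) then (i == j)%:R else N i j.

Lemma isolateE k N i j :
  isolate k N i j = if (i == k) || (j == k) then (i == j)%:R else N i j.
Proof. by rewrite mxE. Qed.

Lemma cofactor_isolate k N : cofactor (isolate k N) k k = cofactor N k k.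
Proof.
rewrite /cofactor; congr (_ * \det _); apply/matrixP => i j; rewrite !mxE.
by rewrite ![lift k _ == k]eq_sym !(negPf (neq_lift _ _)).
Qed.

Lemma det_isolate k N : \det (isolate k N) = cofactor N k k.
Proof.
rewrite (expand_det_row _ k) (bigD1 k) //= cofactor_isolate mxE !eqxx mul1r.
rewrite big1 ?addr0 // => j jk.
by rewrite mxE eqxx (eq_sym k) (negPf jk) mul0r.
Qed.

Lemma det_row_delta k N : (forall j, N k j = (k == j)%:R) ->
  \det N = \det (isolate k N).
Proof.
move=> Nk; rewrite det_isolate (expand_det_row _ k) (bigD1 k) //= Nk eqxx mul1r.
by rewrite big1 ?addr0 // => j jk; rewrite Nk (eq_sym k) (negPf jk) mul0r.
Qed.

Lemma det_col_delta k N c : (forall i, N i k = c * (i == k)%:R) ->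
  \det N = c * \det (isolate k N).
Proof.
move=> Nk; rewrite det_isolate (expand_det_col _ k) (bigD1 k) //= Nk eqxx mulr1.
by rewrite big1 ?addr0 // => i ik; rewrite Nk (negPf ik) mulr0 mul0r.
Qed.

(** Row [k] is the unit row at [k] plus [c] times the unit row at [l]. For the latter, exchanging
    rows [k] and [l] gives the sign; then row [l] is a unit row and, once [l] is isolated, column
    [k] is [c] times a unit column, which gives the second factor [c]. *)
Lemma det_leaf k l N c : k != l ->
  (forall j, N k j = (k == j)%:R + c * (j == l)%:R) ->
  (forall i, N i k = (i == k)%:R + c * (i == l)%:R) ->
  \det N = \det (isolate k N) - c ^+ 2 * \det (isolate l (isolate k N)).
Proof.
move=> kl rowk colk.
pose B := \matrix_(i, j) (if i == k then (k == j)%:R else N i j).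
pose C := \matrix_(i, j) (if i == k then (l == j)%:R else N i j).
rewrite (@determinant_multilinear _ _ N B C k 1 c); first last.
- by apply/matrixP => i j; rewrite !mxE eq_sym (negPf (neq_lift _ _)).
- by apply/matrixP => i j; rewrite !mxE eq_sym (negPf (neq_lift _ _)).
- by apply/rowP => j; rewrite !mxE eqxx mul1r rowk (eq_sym l).
have -> : \det B = \det (isolate k N).
  rewrite (@det_row_delta k) => [|j]; last by rewrite mxE eqxx.
  congr (\det _); apply/matrixP => i j; rewrite !mxE.
  by case: (i == k); rewrite ?orTb.
pose D := xrow k l C.
have detC : \det C = - \det D.
  by rewrite /D xrowE det_mulmx det_perm odd_tperm kl /= expr1 mulN1r opprK.
have De i j : D i j = if i == l then (l == j)%:R else if i == k then N l j else N i j.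
  rewrite !mxE; have [->|il] := eqVneq i l.
    by rewrite tpermR eqxx.
  have [->|ik] := eqVneq i k; first by rewrite tpermL eq_sym (negPf kl).
  by rewrite tpermD ?(negPf ik) // eq_sym.
rewrite mul1r detC mulrN expr2 -mulrA; congr (_ - _ * _).
rewrite (@det_row_delta l) => [|j]; last by rewrite De eqxx.
rewrite (@det_col_delta k _ c) => [|i].
  congr (_ * \det _); apply/matrixP => i j; rewrite !isolateE De.
  have [->|ik] := eqVneq i k; first by rewrite /= eq_sym (negPf kl); case: (j == k); case: eqP.
  have [->|il] := eqVneq i l; rewrite /=; first by case: (j == k).
  by case: (j == k); case: (j == l); rewrite //= ?orbT //.
rewrite isolateE De; have [->|il] := eqVneq i l.
  by rewrite /= (eq_sym l) (negPf kl) mulr0.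
rewrite (negPf kl) /=; have [_|ik] := eqVneq i k.
  by rewrite colk (eq_sym l) (negPf kl) !eqxx add0r.
by rewrite colk (negPf il) (negPf ik) add0r !mulr0.
Qed.

End Isolate.

Section MatchingDeterminant.
Local Open Scope ring_scope.
Variables (K : comNzRingType) (c : K) (G : sgraph).
Hypothesis acyclic : is_acyclic G.
Implicit Types (S : {set G}) (v w : G).

(* The matrix [1 + c A] of the subgraph induced by [S], padded by an identity
   block outside of [S]. *)
Definition induced_mx S : 'M[K]_#|G| :=
  \matrix_(i, j) ((i == j)%:R +
    c * [&& enum_val i \in S, enum_val j \in S &
            adj (enum_val i) (enum_val j)]%:R).

Lemma isolate_induced_mx S v :
  isolate (enum_rank v) (induced_mx S) = induced_mx (S :\ v).
Proof.
have rk i : (i == enum_rank v) = (enum_val i == v).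
  by rewrite -(inj_eq enum_val_inj) enum_rankK.
apply/matrixP => i j; rewrite !mxE !inE !rk.
case: eqP => //= _; first by rewrite mulr0 addr0.
by case: eqP => //= _; rewrite andbF mulr0 addr0.
Qed.

(** Expanding the determinant at a leaf gives the recurrence of [mgf] at [- c ^+ 2], and in a forest
    there is always a leaf or an isolated vertex to continue with. *)
Lemma det_induced_mx S : \det (induced_mx S) = mgf (- c ^+ 2) S.
Proof.
have [n] := ubnP #|S|; elim: n S => // n IH S leS.
have [->|S0] := eqVneq S set0.
  rewrite mgf0 -[RHS](det1 K #|G|); congr (\det _); apply/matrixP => i j.
  by rewrite !mxE inE mulr0 addr0.
have [v vS nb] := acyclic_leaf acyclic S0.
have lt : (#|S :\ v| < n)%N by rewrite -ltnS (leq_trans _ leS) // ltnS card_setD1_lt.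
have nbE w : [&& v \in S, w \in S & adj v w] = (w \in neighbors S v).
  by rewrite in_neighbors vS.
rewrite (mgf_expand _ vS) -IH // -isolate_induced_mx.
rewrite (eq_bigl (fun w => w \in neighbors S v)) => [|w]; last by rewrite in_neighbors.
case: nb => [N0|[w wS N1]].
  rewrite N0 big_set0 mulr0 addr0; apply: det_row_delta => j.
  by rewrite mxE enum_rankK nbE N0 inE mulr0 addr0.
have wv : w \in neighbors S v by rewrite N1 set11.
have vw : v != w by apply: contraTneq wv => <-; rewrite in_neighbors adj_irr andbF.
rewrite N1 big_set1 (@det_leaf _ _ (enum_rank v) (enum_rank w) _ c).
- rewrite !isolate_induced_mx -IH ?mulNr //.
  exact: leq_ltn_trans (card_setD1_le _ _) lt.
- by rewrite (inj_eq enum_rank_inj).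
- move=> j; rewrite mxE enum_rankK nbE N1 inE.
  by rewrite -(inj_eq enum_rank_inj) enum_valK.
- move=> i; rewrite mxE enum_rankK andbCA adj_sym nbE N1 inE.
  by rewrite -(inj_eq enum_rank_inj) enum_valK.
Qed.

Lemma induced_mxT : induced_mx [set: G] = 1%:M + c *: adj_mx K G.
Proof. by apply/matrixP => i j; rewrite !mxE !inE. Qed.

End MatchingDeterminant.

Lemma mgf_rmorph (K L : comNzRingType) (h : {rmorphism K -> L}) (x : K)
  (G : sgraph) (S : {set G}) : mgf (h x) S = h (mgf x S).
Proof.
have [n] := ubnP #|S|; elim: n S => // n IH S leS.
have [->|/set0Pn[v vS]] := eqVneq S set0; first by rewrite !mgf0 rmorph1.
have lt := card_setD1_lt vS.
rewrite !(mgf_expand _ vS) rmorphD rmorphM rmorph_sum IH; last first.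
  by rewrite -ltnS (leq_trans _ leS).
congr (_ + _ * _)%R; apply: eq_bigr => w _; apply: IH.
by rewrite -ltnS (leq_trans _ leS) // ltnS (leq_ltn_trans (card_setD1_le _ _)).
Qed.

Section Spectrum.
Local Open Scope ring_scope.
Local Open Scope complex_scope.
Variable R : rcfType.

(** Over [R[i]] the matrix is Hermitian, hence unitarily diagonalisable with real eigenvalues. One
    list must serve both the characteristic polynomial over [R] and the determinants, which are used
    at imaginary [c]. *)
Lemma symmetric_spectrum n (A : 'M[R]_n) : A^T = A ->
  exists2 s : seq R, char_poly A = \prod_(a <- s) ('X - a%:P) &
    forall c : R[i], \det (1%:M + c *: map_mx (real_complex R) A) =
                     \prod_(a <- s) (1 + c * a%:C).
Proof.
move=> symA; set B := map_mx _ A.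
have hB : B \is hermsymmx.
  apply/is_hermitianmxP; rewrite expr0 scale1r; apply/matrixP => i j.
  rewrite !mxE -{1}symA mxE; apply/esym/CrealP.
  by apply/complex_realP; exists (A j i).
have /orthomx_spectralP := hermitian_normalmx hB.
have /mxOverP realD := hermitian_spectral_diag_real hB.
set P := spectralmx B; set D := spectral_diag B => EB.
have uP : P \in unitmx := spectral_unit B.
pose s := [seq complex.Re (D 0 i) | i <- enum 'I_n].
have Ds i : D 0 i = (complex.Re (D 0 i))%:C by rewrite RRe_real // realD.
have conj (M : 'M[R[i]]_n) : \det (invmx P *m M *m P) = \det M.
  by rewrite !det_mulmx det_inv mulrAC mulVr ?mul1r // -unitmxE.
exists s.
  apply: (@map_poly_inj _ _ (real_complex R)).
  rewrite rmorph_prod /= map_char_poly -/B big_map big_enum /=.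
  have -> : char_poly B = char_poly (diag_mx D).
    rewrite /char_poly /char_poly_mx EB.
    have -> : map_mx polyC (invmx P *m diag_mx D *m P) =
        map_mx polyC (invmx P) *m map_mx polyC (diag_mx D) *m map_mx polyC P.
      by rewrite !map_mxM.
    have uP' : map_mx polyC (invmx P) *m map_mx polyC P = 1%:M.
      by rewrite -map_mxM mulVmx // map_mx1.
    rewrite -[X in \det (X - _)]mulmx1 -uP' mulmxA.
    rewrite -(scalar_mxC 'X) -mulmxBl -mulmxBr.
    rewrite !det_mulmx mulrAC -det_mulmx uP' det1 mul1r.
    by [].
  rewrite char_poly_trig ?diag_mx_is_trig //.
  apply: eq_bigr => i _; rewrite mxE eqxx mulr1n rmorphB /= map_polyX map_polyC /=.
  by rewrite -Ds.
move=> c; rewrite big_map big_enum /= EB.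
have -> : 1%:M + c *: (invmx P *m diag_mx D *m P) =
    invmx P *m (1%:M + c *: diag_mx D) *m P.
  by rewrite mulmxDr mulmxDl mulmx1 mulVmx // -scalemxAr -scalemxAl.
have -> : 1%:M + c *: diag_mx D = diag_mx (\row_i (1 + c * D 0 i)).
  by apply/matrixP => i j; rewrite !mxE; case: eqP => _; rewrite ?mulr1n ?mulr0n ?mulr0 ?addr0.
rewrite conj det_diag; apply: eq_bigr => i _.
by rewrite mxE Ds.
Qed.

Lemma energy_mgf (G : sgraph) : is_acyclic G -> exists2 s : seq R,
  energy R G = \sum_(a <- s) `|a| &
  forall y : R, mgf (y ^+ 2) [set: G] ^+ 2 = \prod_(a <- s) (1 + y ^+ 2 * a ^+ 2).
Proof.
move=> acyG.
have symA : (adj_mx R G)^T = adj_mx R G.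
  by apply/matrixP => i j; rewrite !mxE adj_sym.
have [s Es detE] := symmetric_spectrum symA.
exists s; first exact: energyE.
move=> y; apply: (@complexI R).
have E (c : R[i]) : c ^+ 2 = - (y ^+ 2)%:C ->
    (mgf (y ^+ 2) [set: G])%:C = \prod_(a <- s) (1 + c * a%:C).
  move=> Ec; rewrite -detE.
  have -> : map_mx (real_complex R) (adj_mx R G) = adj_mx R[i] G.
    by apply/matrixP => i j; rewrite !mxE rmorph_nat.
  rewrite -induced_mxT det_induced_mx // Ec opprK.
  exact/esym/(mgf_rmorph (real_complex R)).
have sqi : ('i * y%:C : R[i]) ^+ 2 = - (y ^+ 2)%:C.
  by rewrite exprMn sqr_i mulN1r rmorphXn.
(* One factor of the square is evaluated at [c = 'i * y], the other at [- c]; the product of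
   [1 + c * a] and [1 - c * a] is [1 + y ^+ 2 * a ^+ 2]. *)
rewrite rmorphXn expr2 /= {1}(E _ sqi) (E (- ('i * y%:C))) ?sqrrN //.
rewrite -big_split rmorph_prod /=; apply: eq_bigr => a _.
rewrite mulNr [LHS]mulrC -subr_sqr expr1n exprMn sqi mulNr opprK.
rewrite rmorphD rmorph1 (rmorphM _ (y ^+ 2)); congr (_ + _ * _).
exact/esym/(rmorphXn (real_complex R)).
Qed.

End Spectrum.

(** * The Coulson integral *)

Section Derivatives.
Local Open Scope ring_scope.
Variable R : realType.
Implicit Types (f g : R -> R) (y d e : R).

Lemma is_derive1_cst (k y : R) : is_derive y 1 (fun _ => k) 0.
Proof. exact: is_derive_cst. Qed.

Lemma is_derive1_id y : is_derive y 1 (fun z => z) 1.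
Proof. exact: is_derive_id. Qed.

Lemma is_derive1D f g y d e : is_derive y 1 f d -> is_derive y 1 g e ->
  is_derive y 1 (fun z => f z + g z) (d + e).
Proof. by move=> ? ?; apply: is_deriveD. Qed.

Lemma is_derive1N f y d : is_derive y 1 f d -> is_derive y 1 (fun z => - f z) (- d).
Proof. by move=> ?; apply: is_deriveN. Qed.

Lemma is_derive1B f g y d e : is_derive y 1 f d -> is_derive y 1 g e ->
  is_derive y 1 (fun z => f z - g z) (d - e).
Proof. by move=> df dg; apply: is_derive1D df (is_derive1N dg). Qed.

Lemma is_derive1M f g y d e : is_derive y 1 f d -> is_derive y 1 g e ->
  is_derive y 1 (fun z => f z * g z) (f y * e + g y * d).
Proof. by move=> ? ?; apply: is_deriveM. Qed.

Lemma is_derive1Z (k : R) f y d : is_derive y 1 f d ->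
  is_derive y 1 (fun z => k * f z) (k * d).
Proof. by move=> ?; apply: is_deriveZ. Qed.

Lemma is_derive1Xn f n y d : is_derive y 1 f d ->
  is_derive y 1 (fun z => f z ^+ n) (n%:R * f y ^+ n.-1 * d).
Proof.
move=> df; have -> : (fun z => f z ^+ n) = f ^+ n by apply/funext => z; rewrite exprfctE.
exact: is_deriveX.
Qed.

Lemma is_derive1V f y d : f y != 0 -> is_derive y 1 f d ->
  is_derive y 1 (fun z => (f z)^-1) (- (f y) ^- 2 * d).
Proof. by move=> fy df; apply: is_deriveV. Qed.

Lemma is_derive1_eq f y d e : is_derive y 1 f d -> d = e -> is_derive y 1 f e.
Proof. by move=> df <-. Qed.

(** The mean value theorem takes the place of integration: every integral occurs as an increment of
    an explicit antiderivative. *)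
Lemma increment_le (f g df dg : R -> R) (b c : R) : b <= c ->
  (forall z, b <= z <= c -> is_derive z 1 f (df z)) ->
  (forall z, b <= z <= c -> is_derive z 1 g (dg z)) ->
  (forall z, b <= z <= c -> dg z <= df z) -> g c - g b <= f c - f b.
Proof.
move=> bc derf derg le.
have der z : b <= z <= c -> is_derive z 1 (fun y => f y - g y) (df z - dg z).
  by move=> zbc; apply: is_derive1B (derf z zbc) (derg z zbc).
have [t| |t tbc E] := @MVT_segment R (fun y => f y - g y) (fun z => df z - dg z) b c bc.
- by rewrite in_itv /= => /andP[/ltW bt /ltW tc]; apply: der; rewrite bt tc.
- apply: derivable_within_continuous => t; rewrite in_itv /= => /der dt.
  by case: dt.
- have : 0 <= (df t - dg t) * (c - b).
    by rewrite mulr_ge0 ?subr_ge0 // le.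
  by rewrite -E; lra.
Qed.

Lemma increment_gt0 (f df : R -> R) (b c : R) : b < c ->
  (forall z, b <= z <= c -> is_derive z 1 f (df z)) ->
  (forall z, b <= z <= c -> 0 < df z) -> f b < f c.
Proof.
move=> bc der pos; rewrite -subr_gt0.
have [t| |t tbc ->] := @MVT R f df b c bc.
- by rewrite in_itv /= => /andP[/ltW bt /ltW tc]; apply: der; rewrite bt tc.
- apply: derivable_within_continuous => t; rewrite in_itv /= => /der dt.
  by case: dt.
- rewrite mulr_gt0 ?subr_gt0 // pos //.
  by move: tbc; rewrite in_itv /= => /andP[/ltW -> /ltW ->].
Qed.

End Derivatives.

(* [coulson s] is an antiderivative of [ln (\prod_(a <- s) (1 + a ^+ 2 * y ^+ 2)) / y ^+ 2]
   which tends to 0 at 0 and to [pi * \sum_(a <- s) `|a|] at infinity. *)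
Section Coulson.
Local Open Scope ring_scope.
Variable R : realType.
Implicit Types (a y : R) (s : seq R).

Definition coulson1 a y := 2 * `|a| * atan (`|a| * y) - ln (1 + a ^+ 2 * y ^+ 2) / y.

Lemma one_plus_sqr_gt0 a y : 0 < 1 + a ^+ 2 * y ^+ 2.
Proof. by rewrite ltr_pwDl // mulr_ge0 // sqr_ge0. Qed.

Lemma is_derive_coulson1 a y : 0 < y ->
  is_derive y 1 (coulson1 a) (ln (1 + a ^+ 2 * y ^+ 2) / y ^+ 2).
Proof.
move=> y0; have yn0 : y != 0 by rewrite gt_eqF.
have pos := one_plus_sqr_gt0 a y.
have dln : is_derive y 1 (fun z => ln (1 + a ^+ 2 * z ^+ 2))
    ((1 + a ^+ 2 * y ^+ 2)^-1 * (0 + a ^+ 2 * (2%:R * y ^+ 1 * 1))).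
  apply: (@is_derive1_comp _ (@ln R) (fun z => 1 + a ^+ 2 * z ^+ 2)).
    exact: is_derive1_ln.
  apply: is_derive1D (is_derive1_cst _ _) _; apply: is_derive1Z.
  by apply: (@is_derive1Xn _ (fun z => z)); apply: is_derive1_id.
have dat : is_derive y 1 (fun z => atan (`|a| * z))
    ((1 + (`|a| * y) ^+ 2)^-1 * (`|a| * 1)).
  exact: (@is_derive1_comp _ (@atan R) (fun z => `|a| * z)).
have dquot := is_derive1M dln (is_derive1V (f := fun z => z) yn0 (is_derive1_id y)).
apply: (is_derive1_eq (is_derive1B (is_derive1Z (2 * `|a|) dat) dquot)).
have -> : (`|a| * y) ^+ 2 = a ^+ 2 * y ^+ 2 by rewrite exprMn real_normK ?num_real.
have aa : `|a| * `|a| = a ^+ 2 by rewrite -expr2 real_normK ?num_real.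
set n := `|a| in aa *; set l := ln _; set q := 1 + _ in pos *.
have -> : a ^+ 2 = n * n by [].
by field; rewrite yn0 gt_eqF.
Qed.

Lemma coulson1_bounds a y : 0 < y ->
  - (a ^+ 2 * y) <= coulson1 a y <= 2 * a ^+ 2 * y.
Proof.
move=> y0; have pos := one_plus_sqr_gt0 a y.
have ge1 : 1 <= 1 + a ^+ 2 * y ^+ 2 by rewrite lerDl mulr_ge0 // sqr_ge0.
have aa : `|a| * `|a| = a ^+ 2 by rewrite -expr2 real_normK ?num_real.
have at0 : 0 <= atan (`|a| * y).
  by rewrite -[leLHS](@atan0 R) le_atan // mulr_ge0 // ltW.
have aty : atan (`|a| * y) <= `|a| * y.
  have u0 : 0 <= `|a| * y by rewrite mulr_ge0 // ltW.
  have := @increment_le _ (fun z => z) (@atan R) (fun _ => 1)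
    (fun z => (1 + z ^+ 2)^-1) 0 (`|a| * y) u0.
  rewrite atan0 !subr0; apply=> z _.
  by rewrite invf_le1 ?lerDl ?sqr_ge0 // ltr_pwDl // sqr_ge0.
have ln0 : 0 <= ln (1 + a ^+ 2 * y ^+ 2) / y by rewrite divr_ge0 ?ln_ge0 // ltW.
have lny : ln (1 + a ^+ 2 * y ^+ 2) / y <= a ^+ 2 * y.
  rewrite ler_pdivrMr //; have -> : a ^+ 2 * y * y = a ^+ 2 * y ^+ 2 by ring.
  have := @le_ln1Dx R (a ^+ 2 * y ^+ 2).
  by apply; rewrite (lt_le_trans (ltrN10 _)) // mulr_ge0 // sqr_ge0.
have A0 : 0 <= 2 * `|a| * atan (`|a| * y) by rewrite !mulr_ge0.
have A1 : 2 * `|a| * atan (`|a| * y) <= 2 * a ^+ 2 * y.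
  have : `|a| * atan (`|a| * y) <= `|a| * (`|a| * y) by rewrite ler_wpM2l.
  by rewrite mulrA aa; lra.
by rewrite /coulson1; apply/andP; split; lra.
Qed.

Lemma coulson1_le a y : 0 < y -> coulson1 a y <= pi * `|a|.
Proof.
move=> y0.
have ln0 : 0 <= ln (1 + a ^+ 2 * y ^+ 2) / y.
  by rewrite divr_ge0 ?ln_ge0 ?(ltW y0) // lerDl mulr_ge0 // sqr_ge0.
have at1 : atan (`|a| * y) <= pi / 2 by rewrite ltW // atan_ltpi2.
have : 2 * `|a| * atan (`|a| * y) <= 2 * `|a| * (pi / 2) by rewrite ler_wpM2l // mulr_ge0.
by rewrite /coulson1; lra.
Qed.

Lemma coulson1_ge a e : 0 < e ->
  exists2 Y, 0 < Y & forall y, Y <= y -> pi * `|a| - e <= coulson1 a y.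
Proof.
move=> e0; have [->|an0] := eqVneq a 0.
  exists 1 => // y y1; rewrite /coulson1 expr0n /= mul0r addr0 ln1 mul0r normr0.
  by rewrite !(mulr0, mul0r) subr0 sub0r oppr_le0 ltW.
have a0 : 0 < `|a| by rewrite normr_gt0.
have [U [_ UP]] : exists U : R, U \is Num.real /\
    forall u, U < u -> pi / 2 - e / (4 * `|a|) < atan u.
  have e' : 0 < e / (4 * `|a|) by rewrite divr_gt0 // mulr_gt0.
  have /cvgrPdist_lt/(_ _ e') [U [Ur H]] := @cvgy_atan R.
  exists U; split=> // u /H /=; rewrite ltr_norml => /andP[_]; lra.
set b := 1 + `|a|; have b0 : 0 < b by rewrite addr_gt0.
(* The second summand brings the argument of the arctangent above [U]; the third makes the square
   root of [y] at least [8 * b / e], as the logarithmic term requires. *)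
exists (1 + `|U| / `|a| + (8 * b / e) ^+ 2).
  by rewrite addr_gt0 ?ltr_pwDl ?divr_ge0 // exprn_gt0 // divr_gt0 // mulr_gt0.
move=> y Yy.
have sq0 : 0 <= (8 * b / e) ^+ 2 by rewrite sqr_ge0.
have Ua0 : 0 <= `|U| / `|a| by rewrite divr_ge0.
have y0 : 0 < y by lra.
have at1 : pi / 2 - e / (4 * `|a|) < atan (`|a| * y).
  apply: UP; rewrite mulrC -ltr_pdivrMr //.
  have : U / `|a| <= `|U| / `|a| by rewrite ler_pM2r ?invr_gt0 // ler_norm.
  by lra.
have at2 : pi * `|a| - e / 2 <= 2 * `|a| * atan (`|a| * y).
  have : 2 * `|a| * (pi / 2 - e / (4 * `|a|)) <= 2 * `|a| * atan (`|a| * y).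
    by rewrite ler_pM2l ?mulr_gt0 // ltW.
  have -> : 2 * `|a| * (pi / 2 - e / (4 * `|a|)) = pi * `|a| - e / 2.
    by field; rewrite gt_eqF.
  by [].
(* Bounding the argument of the logarithm by [(1 + b * z) ^+ 4] bounds the logarithm by
   [4 * (b * z)], which is of smaller order than [y = z ^+ 2]. *)
pose z := Num.sqrt y.
have z0 : 0 < z by rewrite sqrtr_gt0.
have zz : y = z ^+ 2 by rewrite sqr_sqrtr // ltW.
have ezb : 8 * b / e <= z.
  rewrite -(@ler_pXn2r _ 2) ?nnegrE ?(ltW z0) //; last first.
    by rewrite divr_ge0 ?mulr_ge0 ?(ltW b0) ?(ltW e0).
  by rewrite -zz; lra.
have lnle : ln (1 + a ^+ 2 * y ^+ 2) / y <= e / 2.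
  rewrite ler_pdivrMr //.
  have le4 : 1 + a ^+ 2 * y ^+ 2 <= (1 + b * z) ^+ 4.
    have -> : a ^+ 2 = `|a| ^+ 2 by rewrite real_normK ?num_real.
    have n0 : 0 <= `|a| by [].
    rewrite -subr_ge0 /b zz; move: (`|a|) n0 => n n0.
    have -> : (1 + (1 + n) * z) ^+ 4 - (1 + n ^+ 2 * (z ^+ 2) ^+ 2) =
      4 * (1 + n) * z + 6 * ((1 + n) * z) ^+ 2 + 4 * ((1 + n) * z) ^+ 3 +
      (1 + 4 * n + 5 * n ^+ 2 + 4 * n ^+ 3 + n ^+ 4) * z ^+ 4 by ring.
    by rewrite !(addr_ge0, mulr_ge0, exprn_ge0) // ltW.
  have -> : e / 2 * y = 4 * (e / 8 * z * z) by rewrite zz; field.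
  apply: (@le_trans _ _ (4 * (b * z))).
    apply: le_trans (_ : ln ((1 + b * z) ^+ 4) <= _).
      by rewrite ler_ln ?posrE ?one_plus_sqr_gt0 // exprn_gt0 // addr_gt0 // mulr_gt0.
    have bz0 : 0 < b * z by rewrite mulr_gt0.
    have le1 : ln (1 + b * z) <= b * z by apply: le_ln1Dx; rewrite (lt_trans (ltrN10 _)).
    by rewrite lnXn ?addr_gt0 //; lra.
  rewrite ler_pM2l // ler_pM2r //.
  move: ezb; rewrite ler_pdivrMr //; lra.
by rewrite /coulson1; lra.
Qed.

End Coulson.

Section CoulsonComparison.
Local Open Scope ring_scope.
Variable R : realType.
Implicit Types (a y : R) (s : seq R).

Definition coulson s y := \sum_(a <- s) coulson1 a y.

Lemma is_derive_coulson s y : 0 < y ->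
  is_derive y 1 (coulson s)
    (ln (\prod_(a <- s) (1 + y ^+ 2 * a ^+ 2)) / y ^+ 2).
Proof.
move=> y0; elim: s => [|a s IH].
  rewrite big_nil ln1 mul0r (_ : coulson [::] = fun _ => 0).
    exact: is_derive1_cst.
  by apply/funext => z; rewrite /coulson big_nil.
rewrite big_cons (_ : coulson (a :: s) = fun z => coulson1 a z + coulson s z); last first.
  by apply/funext => z; rewrite /coulson big_cons.
apply: is_derive1_eq (is_derive1D (is_derive_coulson1 a y0) IH) _.
rewrite -mulrDl -lnM ?posrE.
- by rewrite [a ^+ 2 * _]mulrC.
- exact: one_plus_sqr_gt0.
- by apply: prodr_gt0 => b _; rewrite one_plus_sqr_gt0.
Qed.

Lemma coulson_bounds s : exists2 C, 0 < C &
  forall y, 0 < y -> - (C * y) <= coulson s y <= C * y.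
Proof.
elim: s => [|a s [C C0 IH]].
  by exists 1 => // y y0; rewrite /coulson big_nil mul1r oppr_le0 ltW.
exists (2 * a ^+ 2 + C); first by rewrite ltr_wpDl // mulr_ge0 // sqr_ge0.
move=> y y0; rewrite /coulson big_cons -/(coulson s y).
have /andP[h1 h2] := coulson1_bounds a y0; have /andP[h3 h4] := IH y y0.
have : 0 <= a ^+ 2 * y by rewrite mulr_ge0 ?sqr_ge0 ?ltW.
by move=> h5; apply/andP; split; lra.
Qed.

Lemma coulson_le s y : 0 < y -> coulson s y <= pi * \sum_(a <- s) `|a|.
Proof.
by move=> y0; rewrite big_distrr /=; apply: ler_sum => a _; apply: coulson1_le.
Qed.

Lemma coulson_ge s e : 0 < e ->
  exists2 Y, 0 < Y & forall y, Y <= y -> pi * (\sum_(a <- s) `|a|) - e <= coulson s y.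
Proof.
elim: s e => [|a s IH] e e0.
  by exists 1 => // y _; rewrite /coulson !big_nil mulr0 sub0r oppr_le0 ltW.
have e2 : 0 < e / 2 by rewrite divr_gt0.
have [Y1 Y10 H1] := coulson1_ge a e2; have [Y2 Y20 H2] := IH _ e2.
exists (Y1 + Y2); first exact: addr_gt0.
move=> y Yy; rewrite /coulson !big_cons -/(coulson s y).
have := H1 y; have := H2 y; rewrite mulrDr => /(_ ltac:(lra)) h2 /(_ ltac:(lra)) h1.
by lra.
Qed.

(** Taking [y] small and [y'] large costs at most [d / 4] at either end, so at least [d / 2] of the
    increase survives in [pi] times the difference of the sums. *)
Lemma sum_norm_lt s1 s2 d y1 y2 : 0 < d -> 0 < y1 ->
  (forall y y', 0 < y <= y1 -> y2 <= y' -> y <= y' ->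
     d <= coulson s1 y' - coulson s2 y' - (coulson s1 y - coulson s2 y)) ->
  \sum_(a <- s2) `|a| < \sum_(a <- s1) `|a|.
Proof.
move=> d0 y10 H.
have [C1 C10 B1] := coulson_bounds s1; have [C2 C20 B2] := coulson_bounds s2.
have [Y Y0 HY] := coulson_ge s2 (divr_gt0 d0 (ltr0Sn R 3)).
pose C := C1 + C2; have C0 : 0 < C by apply: addr_gt0.
pose y := Num.min y1 (d / (4 * C)).
have y0 : 0 < y by rewrite lt_min y10 divr_gt0 // mulr_gt0.
have yy1 : y <= y1 by rewrite ge_min lexx.
have Cy : C * y <= d / 4.
  have : y <= d / (4 * C) by rewrite ge_min lexx orbT.
  rewrite ler_pdivlMr ?mulr_gt0 //; lra.
pose y' := Y + `|y2| + y.
have yy' : y2 <= y' by rewrite /y'; have := ler_norm y2; lra.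
have le' : y <= y' by rewrite /y'; have := normr_ge0 y2; lra.
have Yy' : Y <= y' by rewrite /y'; have := normr_ge0 y2; lra.
have yin : 0 < y <= y1 by rewrite y0 yy1.
have := H y y' yin yy' le'.
have /andP[b1 b2] := B1 y y0; have /andP[b3 b4] := B2 y y0.
have := HY y' Yy'; have := @coulson_le s1 y' (lt_le_trans y0 le').
have : C * y = C1 * y + C2 * y by rewrite /C mulrDl.
rewrite -(@ltr_pM2l _ pi) ?pi_gt0 //.
by lra.
Qed.

End CoulsonComparison.

(** * From bounds on the integrand to an energy gap *)

Section EnergyGap.
Local Open Scope ring_scope.
Variable R : realType.
Implicit Types (y w k : R) (s : seq R).

Section Primitives.
Variables a0 a1 a2 : R.

(** The factor [y ^+ 5] matches the order 4 at which the integrand vanishes at 0; the three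
    coefficients are left free for a fit in each case of [t]. *)
Definition near_zero_primitive y :=
  y ^+ 5 * (a0 + a1 * y ^+ 2 + a2 * y ^+ 4) * (1 + 3 * y ^+ 2)^-1 ^+ 3.

Definition near_zero_numerator x :=
  (5 * a0 + 7 * a1 * x + 9 * a2 * x ^+ 2) * (1 + 3 * x) -
  18 * x * (a0 + a1 * x + a2 * x ^+ 2).

Lemma is_derive_near_zero_primitive y :
  is_derive y 1 near_zero_primitive
    (y ^+ 4 * near_zero_numerator (y ^+ 2) / (1 + 3 * y ^+ 2) ^+ 4).
Proof.
have did := is_derive1_id y.
have dX n := is_derive1Xn n did.
have q0 : 1 + 3 * y ^+ 2 != 0 by rewrite gt_eqF // ltr_pwDl // mulr_ge0 // sqr_ge0.
have dq := is_derive1D (is_derive1_cst 1 y) (is_derive1Z 3 (dX 2%N)).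
have dn := is_derive1D (is_derive1D (is_derive1_cst a0 y) (is_derive1Z a1 (dX 2%N)))
  (is_derive1Z a2 (dX 4%N)).
have := is_derive1M (is_derive1M (dX 5%N) dn)
  (is_derive1Xn 3%N (is_derive1V (f := fun z => 1 + 3 * z ^+ 2) q0 dq)).
move/is_derive1_eq; apply.
by rewrite /near_zero_numerator /=; field.
Qed.

Variables c0 c1 c2 c3 : R.

Definition far_polynomial w := c0 + c1 * w + c2 * w ^+ 2 + c3 * w ^+ 3.

(** For [w = k / y ^+ 2] this is [y] times the integral from [y] to infinity of [(z ^+ 2 - k) / z ^+
    4 * far_polynomial (k / z ^+ 2)], computed term by term. *)
Definition far_integral w := c0 * (1 - w / 3) + c1 * (w / 3 - w ^+ 2 / 5) +
  c2 * (w ^+ 2 / 5 - w ^+ 3 / 7) + c3 * (w ^+ 3 / 7 - w ^+ 4 / 9).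

Definition far_primitive k y := y^-1 * far_integral (k * y^-1 ^+ 2).

Lemma is_derive_far_primitive k y : 0 < y ->
  is_derive y 1 (far_primitive k)
    (- ((y ^+ 2 - k) / y ^+ 4 * far_polynomial (k / y ^+ 2))).
Proof.
move=> y0; have yn0 : y != 0 by rewrite gt_eqF.
have dv := is_derive1V (f := fun z => z) yn0 (is_derive1_id y).
have dw := is_derive1Z k (is_derive1Xn 2%N dv).
have dX n := is_derive1Xn n dw.
have d0 := is_derive1Z c0 (is_derive1B (is_derive1_cst 1 y)
  (is_derive1M dw (is_derive1_cst 3^-1 y))).
have d1 := is_derive1Z c1 (is_derive1B (is_derive1M dw (is_derive1_cst 3^-1 y))
  (is_derive1M (dX 2%N) (is_derive1_cst 5^-1 y))).
have d2 := is_derive1Z c2 (is_derive1B (is_derive1M (dX 2%N) (is_derive1_cst 5^-1 y))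
  (is_derive1M (dX 3%N) (is_derive1_cst 7^-1 y))).
have d3 := is_derive1Z c3 (is_derive1B (is_derive1M (dX 3%N) (is_derive1_cst 7^-1 y))
  (is_derive1M (dX 4%N) (is_derive1_cst 9^-1 y))).
have := is_derive1M dv (is_derive1D (is_derive1D (is_derive1D d0 d1) d2) d3).
move/is_derive1_eq; apply.
by rewrite /far_polynomial /=; field.
Qed.

End Primitives.

(* Over [0 < y <= 2] and over [y ^+ 2 >= k] the derivative of the difference of
   the Coulson functions is bounded below by a function with an elementary
   primitive; in between it is nonnegative. *)
Lemma sum_norm_lt_of_gap s1 s2 (h : R -> R) (k a0 a1 a2 c0 c1 c2 c3 K : R) :
  4 <= k -> 0 <= K -> 0 <= a0 <= 5 -> 0 <= a1 <= 5 -> a2 <= 0 ->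
  (forall y, 0 < y -> exists2 e, 2 * h y <= e &
     is_derive y 1 (fun y => coulson s1 y - coulson s2 y) e) ->
  (forall y, 0 < y <= 2 -> y ^+ 4 * near_zero_numerator a0 a1 a2 (y ^+ 2) /
     (1 + 3 * y ^+ 2) ^+ 4 <= h y) ->
  (forall y, 0 < y -> y ^+ 2 <= k -> 0 <= h y) ->
  (forall y, 0 < y -> k <= y ^+ 2 ->
     - (K * ((y ^+ 2 - k) / y ^+ 4 * far_polynomial c0 c1 c2 c3 (k / y ^+ 2))) <= h y) ->
  (forall w, 0 <= w <= 1 -> 0 <= far_integral c0 c1 c2 c3 w) ->
  K * far_integral c0 c1 c2 c3 1 < Num.sqrt k * near_zero_primitive a0 a1 a2 2 ->
  \sum_(a <- s2) `|a| < \sum_(a <- s1) `|a|.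
Proof.
move=> k4 K0 /andP[a00 a05] /andP[a10 a15] a20 der near mid far farI gap.
pose r := Num.sqrt k.
have r2 : 2 <= r.
  have -> : 2 = Num.sqrt (2 ^+ 2) :> R by rewrite sqrtr_sqr ger0_norm.
  by rewrite ler_sqrt; lra.
have k0 : 0 < k by lra.
have r0 : 0 < r by lra.
have rr : r ^+ 2 = k by rewrite sqr_sqrtr // ltW.
pose G := near_zero_primitive a0 a1 a2.
pose L y := K * far_primitive c0 c1 c2 c3 k y.
have Lr : L r = K * far_integral c0 c1 c2 c3 1 / r.
  rewrite /L /far_primitive -rr; have -> : r ^+ 2 * r^-1 ^+ 2 = 1.
    by field; rewrite gt_eqF.
  by ring.
pose g := G 2 - L r.
have g0 : 0 < g by rewrite /g Lr subr_gt0 ltr_pdivrMr // [ltRHS]mulrC.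
have L0 y : r <= y -> 0 <= L y.
  move=> ry; have y0 : 0 < y by lra.
  rewrite mulr_ge0 // /far_primitive mulr_ge0 ?invr_ge0 ?(ltW y0) //.
  apply: farI; rewrite exprVn mulr_ge0 ?invr_ge0 ?sqr_ge0 ?(ltW k0) //=.
  by rewrite ler_pdivrMr ?exprn_gt0 // mul1r -rr ler_pXn2r ?nnegrE ?(ltW r0) ?(ltW y0).
have G0 y : 0 < y -> y <= 1 -> G y <= 10 * y.
  move=> y0 y1.
  have q1 : 1 <= 1 + 3 * y ^+ 2 by rewrite lerDl mulr_ge0 // sqr_ge0.
  have i0 : 0 <= (1 + 3 * y ^+ 2)^-1 by rewrite invr_ge0; lra.
  have i1 : (1 + 3 * y ^+ 2)^-1 ^+ 3 <= 1.
    by rewrite exprn_ile1 // invf_le1 //; lra.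
  have y5 : y ^+ 5 <= y.
    by rewrite exprS ler_piMr ?exprn_ile1 // ltW.
  have y2 : y ^+ 2 <= 1 by rewrite exprn_ile1 // ltW.
  have y20 : 0 <= y ^+ 2 by rewrite sqr_ge0.
  have y40 : a2 * y ^+ 4 <= 0 by rewrite mulr_le0_ge0 // exprn_ge0 // ltW.
  have A : a0 + a1 * y ^+ 2 + a2 * y ^+ 4 <= 10 by nra.
  have y50 : 0 <= y ^+ 5 by rewrite exprn_ge0 // ltW.
  have i30 : 0 <= (1 + 3 * y ^+ 2)^-1 ^+ 3 by rewrite exprn_ge0.
  apply: le_trans (_ : y ^+ 5 * 10 * (1 + 3 * y ^+ 2)^-1 ^+ 3 <= _).
    by rewrite ler_wpM2r // ler_wpM2l.
  apply: le_trans (_ : y ^+ 5 * 10 * 1 <= _); last by lra.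
  by rewrite ler_wpM2l // mulr_ge0.
pose D y := coulson s1 y - coulson s2 y.
have incr (f df : R -> R) (b c : R) : 0 < b -> b <= c ->
    (forall z, b <= z <= c -> is_derive z 1 f (df z)) ->
    (forall z, b <= z <= c -> df z <= h z) -> 2 * (f c - f b) <= D c - D b.
  move=> b0 bc df' le.
  have z0 z : b <= z <= c -> 0 < z by move=> /andP[bz _]; apply: lt_le_trans bz.
  (* The hypothesis gives a derivative at each point; [increment_le] needs a function, so one is
     chosen. *)
  pose e z := if pselect (0 < z) is left zpos then s2val (cid2 (der z zpos)) else 0.
  have eP z : 0 < z -> 2 * h z <= e z /\ is_derive z 1 D (e z).
    move=> z0'; rewrite /e; case: pselect => // p.
    by case: (cid2 (der z p)) => /= e' h1 h2.
  rewrite mulrBr; apply: (@increment_le _ D (fun z => 2 * f z) e (fun z => 2 * df z)) => //.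
  - by move=> z zin; have [] := eP z (z0 z zin).
  - by move=> z zin; apply: is_derive1Z (df' z zin).
  - move=> z zin; have [le2 _] := eP z (z0 z zin).
    by apply: le_trans le2; rewrite ler_pM2l // le.
(* The bound on [y] gives [G y <= 10 * y <= g / 2], so the increase, at least twice [g - G y], is at
   least [g]. *)
apply: (@sum_norm_lt _ s1 s2 g (Num.min 1 (g / 20)) r) => //.
  by rewrite lt_min ltr01 divr_gt0.
move=> y y' /andP[y0]; rewrite le_min => /andP[y1 yg] ry' yy'.
have inc1 : 2 * (G 2 - G y) <= D 2 - D y.
  apply: (incr G (fun y => y ^+ 4 * near_zero_numerator a0 a1 a2 (y ^+ 2) / (1 + 3 * y ^+ 2) ^+ 4)) => //.
  - lra.
  - by move=> z _; apply: is_derive_near_zero_primitive.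
  - by move=> z /andP[yz z2]; apply: near; rewrite z2 (lt_le_trans y0).
have inc2 : 2 * (0 - 0) <= D r - D 2.
  apply: (incr (fun _ => 0) (fun _ => 0)) => //.
  move=> z /andP[z2 zr]; apply: mid; first by lra.
  by rewrite -rr ler_pXn2r // nnegrE; lra.
have inc3 : 2 * (L y' - L r) <= D y' - D r.
  apply: (incr L (fun y => K * - ((y ^+ 2 - k) / y ^+ 4 * far_polynomial c0 c1 c2 c3 (k / y ^+ 2)))) => //.
  - move=> z /andP[rz _]; apply: is_derive1Z; apply: is_derive_far_primitive.
    exact: lt_le_trans rz.
  - move=> z /andP[rz _]; rewrite mulrN; apply: far; first exact: lt_le_trans rz.
    by rewrite -rr ler_pXn2r // nnegrE; lra.
have := L0 y' ry'; have := G0 y y0 y1; rewrite -/(D y) -/(D y').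
have : g = G 2 - L r by [].
lra.
Qed.

End EnergyGap.

(** * T_b against two hubs at a distance *)

(* Adds the Bernstein-type hypotheses [B i (j + l) (n - l)] for [l <= n]. *)
Ltac add_products B i j n :=
  have := B i j n;
  lazymatch n with
  | O => idtac
  | S ?n' => add_products B i (S j) n'
  end.

(** On the unbounded range [k <= x] monomials take the place of Bernstein products. *)
Ltac add_powers B i j :=
  have := B i j O;
  lazymatch i with
  | O => idtac
  | S ?i' => add_powers B i' j
  end.

Section GapPolynomials.
Local Open Scope ring_scope.
Variable R : realType.
Implicit Types k x : R.

(* For [k = Delta - 2] and the path matching generating functions [u] and [v]
   of [P_(t - 3)] and [P_(t - 2)], this is that of [T_b] up to a power of
   [1 + x]. *)
Definition gap_denominator k x u v : R :=
  (1 + x + (k + 1) * x) *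
    (k * x * ((1 + x) * v + x * u) +
     (1 + x) * ((1 + 2 * x) * v + (x + x ^+ 2) * u)) +
  x * (1 + x) ^+ 2 * ((1 + x) * v + x * u).

Lemma mul3_exp_ge0 (s u v : R) : 0 <= s -> 0 <= u -> 0 <= v ->
  forall i j n, 0 <= s ^+ i * u ^+ j * v ^+ n.
Proof. by move=> s0 u0 v0 i j n; rewrite !mulr_ge0 ?exprn_ge0. Qed.

(* In the names of the following bounds 3, 4 and 5 stand for [t = 3], [t = 4]
   and [t >= 5]. For [t >= 5] the ratio of [P_(t - 3)] to [P_(t - 2)] lies between
   [(1 + 2 * x) / (1 + 3 * x + x ^+ 2)] and [(1 + x) / (1 + 2 * x)]. The
   coefficients come from a numerical fit; all polynomial inequalities follow
   from nonnegative coefficients in the products of powers supplied to [lra]. *)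
Lemma near_zero_bound_3 k x : 6 <= k -> 0 <= x <= 4 ->
  near_zero_numerator 4 (21 / 10) (- 17 / 100) x * gap_denominator k x 1 1 <=
  k * (k - x) * 1 * (1 + 3 * x) ^+ 4.
Proof.
move=> k6 /andP[x0 x4]; rewrite /near_zero_numerator /gap_denominator.
have [s Ek] : exists s, k = 6 + s by exists (k - 6); ring.
have s0 : 0 <= s by lra.
have v0 : 0 <= 4 - x by lra.
have B := mul3_exp_ge0 s0 x0 v0; rewrite Ek.
add_products B 0%N 0%N 12%N; add_products B 1%N 0%N 7%N.
add_products B 2%N 0%N 6%N; clear; lra.
Qed.

Lemma near_zero_bound_4 k x : 6 <= k -> 0 <= x <= 4 ->
  near_zero_numerator 3 (3 / 5) (- 1 / 20) x * gap_denominator k x 1 (1 + x) <=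
  k * (k - x) * 1 * (1 + 3 * x) ^+ 4.
Proof.
move=> k6 /andP[x0 x4]; rewrite /near_zero_numerator /gap_denominator.
have [s Ek] : exists s, k = 6 + s by exists (k - 6); ring.
have s0 : 0 <= s by lra.
have v0 : 0 <= 4 - x by lra.
have B := mul3_exp_ge0 s0 x0 v0; rewrite Ek.
add_products B 0%N 0%N 8%N; add_products B 1%N 0%N 7%N.
add_products B 2%N 0%N 7%N; clear; lra.
Qed.

Lemma near_zero_bound_5 k x : 6 <= k -> 0 <= x <= 4 ->
  near_zero_numerator (191 / 50) (133 / 100) (- 1 / 10) x *
    gap_denominator k x (1 + 2 * x) (1 + 3 * x + x ^+ 2) <=
  k * (k - x) * (1 + 2 * x) * (1 + 3 * x) ^+ 4.
Proof.
move=> k6 /andP[x0 x4]; rewrite /near_zero_numerator /gap_denominator.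
have [s Ek] : exists s, k = 6 + s by exists (k - 6); ring.
have s0 : 0 <= s by lra.
have v0 : 0 <= 4 - x by lra.
have B := mul3_exp_ge0 s0 x0 v0; rewrite Ek.
add_products B 1%N 0%N 8%N; add_products B 2%N 0%N 8%N.
(* The part free of [s] is treated on [[0, 1]] and [[1, 4]] separately, with the Bernstein products
   of each interval. *)
have [x1|x1] := leP x 1.
  have w0 : 0 <= 1 - x by lra.
  have {}B := mul3_exp_ge0 s0 x0 w0.
  add_products B 0%N 0%N 12%N; clear; lra.
have w0 : 0 <= x - 1 by lra.
have {}B := mul3_exp_ge0 s0 w0 v0.
add_products B 0%N 0%N 10%N; clear; lra.
Qed.

Lemma far_bound_3 k x : 6 <= k -> k <= x ->
  (k + 4) * x ^+ 6 * 1 <=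
  (x ^+ 2 - 7 / 5 * k * x + k ^+ 2) * gap_denominator k x 1 1.
Proof.
move=> k6 kx; rewrite /gap_denominator.
have [s Ek] : exists s, k = 6 + s by exists (k - 6); ring.
have [v Ex] : exists v, x = k + v by exists (x - k); ring.
have s0 : 0 <= s by lra.
have v0 : 0 <= v by lra.
have B := mul3_exp_ge0 s0 v0 v0; rewrite Ex Ek.
add_powers B 7%N 0%N; add_powers B 6%N 1%N; add_powers B 5%N 2%N;
add_powers B 4%N 3%N; add_powers B 3%N 4%N; add_powers B 2%N 5%N; clear; lra.
Qed.

Lemma far_bound_4 k x : 6 <= k -> k <= x ->
  (k + 5) * x ^+ 4 * 1 <= 2 / 5 * gap_denominator k x 1 (1 + x).
Proof.
move=> k6 kx; rewrite /gap_denominator.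
have [s Ek] : exists s, k = 6 + s by exists (k - 6); ring.
have [v Ex] : exists v, x = k + v by exists (x - k); ring.
have s0 : 0 <= s by lra.
have v0 : 0 <= v by lra.
have B := mul3_exp_ge0 s0 v0 v0; rewrite Ex Ek.
add_powers B 6%N 0%N; add_powers B 5%N 1%N; add_powers B 4%N 2%N;
add_powers B 3%N 3%N; add_powers B 2%N 4%N; add_powers B 1%N 5%N; clear; lra.
Qed.

Lemma far_bound_5 k x : 6 <= k -> k <= x ->
  (k + 5) * x ^+ 7 * (1 + x) <=
  (x ^+ 3 - 109 / 50 * k * x ^+ 2 + 27 / 10 * k ^+ 2 * x - 5 / 4 * k ^+ 3) *
    gap_denominator k x (1 + x) (1 + 2 * x).
Proof.
move=> k6 kx; rewrite /gap_denominator.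
have [s Ek] : exists s, k = 6 + s by exists (k - 6); ring.
have [v Ex] : exists v, x = k + v by exists (x - k); ring.
have s0 : 0 <= s by lra.
have v0 : 0 <= v by lra.
have B := mul3_exp_ge0 s0 v0 v0; rewrite Ex Ek.
add_powers B 9%N 0%N; add_powers B 8%N 1%N; add_powers B 7%N 2%N;
add_powers B 6%N 3%N; add_powers B 5%N 4%N; add_powers B 4%N 5%N;
add_powers B 3%N 6%N; add_powers B 2%N 7%N; clear; lra.
Qed.

End GapPolynomials.

Section HubComparison.
Local Open Scope ring_scope.
Variable R : realType.

Section Values.
Variable x : R.
Hypothesis x0 : 0 < x.

Lemma legs_mgf_nseq2 n : legs_mgf x (nseq n 2%N) = (1 + x) ^+ n.
Proof.
elim: n => [|n IH]; first by rewrite /legs_mgf big_nil.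
by rewrite [nseq _ _]/= legs_mgf_cons IH exprS /= mulr1.
Qed.

Lemma spider_mgf_nseq2 n :
  spider_mgf x (nseq n 2%N) = (1 + x) ^+ n * (1 + n%:R * x / (1 + x)).
Proof.
have c0 : 1 + x != 0 by rewrite gt_eqF // addr_gt0.
elim: n => [|n IH].
  by rewrite /spider_mgf /legs_mgf !big_nil !mul0r mulr0.
rewrite [nseq _ _]/= spider_mgf_cons // IH legs_mgf_nseq2 exprS /= -natr1.
by field.
Qed.

(** Here [k = Delta - 2] and [j = t - 3]. The factor [C], a power of [1 + x], cancels when the
    difference is divided by the value for [T_b]. *)
Lemma adjacent_distant_gap k j : exists2 C, 0 < C &
  adjacent_mgf x (nseq k.+1 2%N) (j.+3 :: nseq k 2%N) =
    C * gap_denominator k%:R x (path_mgf x j) (path_mgf x j.+1) /\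
  adjacent_mgf x (nseq k.+1 2%N) (j.+3 :: nseq k 2%N) -
  distant_mgf x j.+1 (nseq k.+1 2%N) (nseq k.+1 2%N) =
    C * (k%:R * x ^+ 3 * (k%:R - x) * path_mgf x j).
Proof.
have c0 : 0 < 1 + x by rewrite addr_gt0.
have cn0 : 1 + x != 0 by rewrite gt_eqF.
exists ((1 + x) ^+ k * (1 + x) ^+ k / (1 + x)).
  by rewrite divr_gt0 // mulr_gt0 // exprn_gt0.
rewrite {4}[nseq k.+1 _]/= distant_mgf_cons // /adjacent_mgf.
rewrite [spider_mgf x (j.+3 :: _)]spider_mgf_consS // legs_mgf_cons.
rewrite !spider_mgf_nseq2 !legs_mgf_nseq2 -[k.+1%:R]natr1 exprS.
rewrite !add2n !path_mgfSS /gap_denominator.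
move: (path_mgf x j) (path_mgf x j.+1) ((1 + x) ^+ k) => u v e.
rewrite /=; split; first by field.
by field.
Qed.

End Values.

Lemma gap_denominator_gt0 (k x u v : R) : 0 <= k -> 0 < x -> 0 <= u -> 0 < v ->
  0 < gap_denominator k x u v.
Proof.
move=> k0 x0 u0 v0; rewrite /gap_denominator.
have c0 : 0 < 1 + x by rewrite addr_gt0.
have xu : 0 <= x * u by rewrite mulr_ge0 // ltW.
apply: ltr_wpDl; last first.
  by rewrite !mulr_gt0 ?exprn_gt0 // ltr_pwDl // mulr_gt0.
have [x0' v0' c0'] : [/\ 0 <= x, 0 <= v & 0 <= 1 + x] by rewrite !ltW.
by rewrite !(addr_ge0, mulr_ge0, exprn_ge0).
Qed.

(** [gap_denominator] is linear in [u] and [v], so the difference of the sides is its coefficient at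
    [v] times [u * m - l * v]. Thus [u] over the denominator depends only on the ratio of [u] to [v]
    and grows with it. *)
Lemma gap_denominator_ratio (k x u v l m : R) : 0 <= k -> 0 < x -> l * v <= u * m ->
  l * gap_denominator k x u v <= u * gap_denominator k x l m.
Proof.
move=> k0 x0 le; rewrite -subr_ge0 /gap_denominator.
rewrite [X in 0 <= X](_ : _ =
  ((1 + x + (k + 1) * x) * (k * x * (1 + x) + (1 + x) * (1 + 2 * x)) +
   x * (1 + x) ^+ 2 * (1 + x)) * (u * m - l * v)); last by ring.
have c0 : 0 <= 1 + x by rewrite addr_ge0 // ltW.
have x0' := ltW x0.
by rewrite mulr_ge0 ?subr_ge0 // !(addr_ge0, mulr_ge0, exprn_ge0).
Qed.

(** For [x = y ^+ 2], the difference of the values for [T_b] and [T_a], divided by that for [T_b]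
    and by [x]. Since [ln b - ln a >= (b - a) / b], twice this bounds the derivative of the
    difference of the Coulson functions from below. *)
Definition gap_integrand (k : R) (u v : R -> R) y : R :=
  k * y ^+ 4 * (k - y ^+ 2) * u (y ^+ 2) /
    gap_denominator k (y ^+ 2) (u (y ^+ 2)) (v (y ^+ 2)).

Section Integrand.
Variables (k : R) (u v l m : R -> R).
Hypotheses (k6 : 6 <= k) (u0 : forall x, 0 < x -> 0 < u x)
  (v0 : forall x, 0 < x -> 0 < v x) (l0 : forall x, 0 < x -> 0 < l x)
  (m0 : forall x, 0 < x -> 0 < m x).

(** Here [k - x] is nonnegative, so passing to a pair [l], [m] of smaller ratio can only decrease
    the integrand. *)
Lemma gap_integrand_near a0 a1 a2 y :
  (forall x, 0 < x -> l x * v x <= u x * m x) ->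
  (forall x, 0 <= x <= 4 -> near_zero_numerator a0 a1 a2 x *
     gap_denominator k x (l x) (m x) <= k * (k - x) * l x * (1 + 3 * x) ^+ 4) ->
  0 < y <= 2 -> y ^+ 4 * near_zero_numerator a0 a1 a2 (y ^+ 2) /
     (1 + 3 * y ^+ 2) ^+ 4 <= gap_integrand k u v y.
Proof.
move=> le near /andP[y0 y2]; rewrite /gap_integrand.
have -> : y ^+ 4 = (y ^+ 2) ^+ 2 by rewrite -exprM.
have x0 : 0 < y ^+ 2 by rewrite exprn_gt0.
have x4 : 0 <= y ^+ 2 <= 4.
  have -> : 4 = 2 ^+ 2 :> R by ring.
  by rewrite ltW //= ler_pXn2r // nnegrE ltW.
move: (y ^+ 2) x0 x4 => x x0 x4.
have k0 : 0 <= k by apply: le_trans k6; rewrite ler0n.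
have g0 : 0 < gap_denominator k x (u x) (v x).
  by apply: (gap_denominator_gt0 k0 x0 (ltW (u0 x0)) (v0 x0)).
have g1 : 0 < gap_denominator k x (l x) (m x).
  by apply: (gap_denominator_gt0 k0 x0 (ltW (l0 x0)) (m0 x0)).
have q0 : 0 < (1 + 3 * x) ^+ 4 by rewrite exprn_gt0 // addr_gt0 // mulr_gt0.
have rat := gap_denominator_ratio k0 x0 (le x x0).
have nr := near x x4.
have kx0 : 0 <= k * (k - x) by
  case/andP: x4 => _ x4; rewrite mulr_ge0 // subr_ge0 (le_trans x4) // (le_trans _ k6) // ler_nat.
rewrite [leRHS](_ : _ = x ^+ 2 * (k * (k - x) * u x / gap_denominator k x (u x) (v x)));
  last by ring.
rewrite -mulrA ler_pM2l ?exprn_gt0 // ler_pdivlMr // mulrAC ler_pdivrMr //.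
rewrite -(ler_pM2r g1) mulrAC.
apply: le_trans (_ : k * (k - x) * l x * (1 + 3 * x) ^+ 4 *
  gap_denominator k x (u x) (v x) <= _); first by rewrite ler_pM2r.
rewrite [leLHS](_ : _ = (k * (k - x) * (1 + 3 * x) ^+ 4) *
  (l x * gap_denominator k x (u x) (v x))); last by ring.
rewrite [leRHS](_ : _ = (k * (k - x) * (1 + 3 * x) ^+ 4) *
  (u x * gap_denominator k x (l x) (m x))); last by ring.
by rewrite ler_wpM2l // mulr_ge0 // ltW.
Qed.

Lemma gap_integrand_ge0 y : 0 < y -> y ^+ 2 <= k -> 0 <= gap_integrand k u v y.
Proof.
move=> y0 yk; have x0 : 0 < y ^+ 2 by rewrite exprn_gt0.
have k0 : 0 <= k by apply: le_trans k6; rewrite ler0n.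
rewrite /gap_integrand divr_ge0 ?mulr_ge0 ?exprn_ge0 ?subr_ge0 ?(ltW y0) //.
  by rewrite ltW // u0.
by rewrite ltW // (gap_denominator_gt0 k0 x0 (ltW (u0 x0)) (v0 x0)).
Qed.

(** Beyond [k] the sign of [k - x] is reversed, so here [l], [m] must have the larger ratio. *)
Lemma gap_integrand_far c0 c1 c2 c3 d y :
  (forall x, 0 < x -> u x * m x <= l x * v x) -> 0 <= d ->
  (forall x, k <= x -> (k + d) * x ^+ 4 * l x <=
     far_polynomial c0 c1 c2 c3 (k / x) * gap_denominator k x (l x) (m x)) ->
  0 < y -> k <= y ^+ 2 ->
  - (k / (k + d) * ((y ^+ 2 - k) / y ^+ 4 * far_polynomial c0 c1 c2 c3 (k / y ^+ 2)))
    <= gap_integrand k u v y.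
Proof.
move=> le d0 far y0; rewrite /gap_integrand.
have -> : y ^+ 4 = (y ^+ 2) ^+ 2 by rewrite -exprM.
have : 0 < y ^+ 2 by rewrite exprn_gt0.
move: (y ^+ 2) => x x0 kx.
have k0 : 0 < k by apply: lt_le_trans k6; rewrite ltr0n.
have kd : 0 < k + d by rewrite ltr_wpDr.
have g0 : 0 < gap_denominator k x (u x) (v x).
  by apply: (gap_denominator_gt0 (ltW k0) x0 (ltW (u0 x0)) (v0 x0)).
have g1 : 0 < gap_denominator k x (l x) (m x).
  by apply: (gap_denominator_gt0 (ltW k0) x0 (ltW (l0 x0)) (m0 x0)).
have rat := gap_denominator_ratio (ltW k0) x0 (le x x0).
have fr := far x kx.
set F := far_polynomial _ _ _ _ _ in fr *.
have bnd : (k + d) * x ^+ 4 * u x <= F * gap_denominator k x (u x) (v x).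
  rewrite -(ler_pM2r g1).
  apply: le_trans (_ : (k + d) * x ^+ 4 * (l x * gap_denominator k x (u x) (v x)) <= _).
    by rewrite -[leLHS]mulrA ler_pM2l // mulr_gt0 // exprn_gt0.
  by rewrite mulrA [leRHS]mulrAC ler_pM2r.
have kx0 : 0 <= k * (x - k) / (x ^+ 2 * (k + d) * gap_denominator k x (u x) (v x)).
  by rewrite divr_ge0 ?mulr_ge0 ?subr_ge0 ?exprn_ge0 ?(ltW k0) ?(ltW kd) ?(ltW x0) ?(ltW g0).
rewrite -subr_ge0 [X in 0 <= X](_ : _ =
  k * (x - k) / (x ^+ 2 * (k + d) * gap_denominator k x (u x) (v x)) *
  (F * gap_denominator k x (u x) (v x) - (k + d) * x ^+ 4 * u x)).
  by rewrite mulr_ge0 // subr_ge0.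
by field; rewrite !gt_eqF.
Qed.

End Integrand.

End HubComparison.

Section DistantHubs.
Local Open Scope ring_scope.
Variable R : realType.

Lemma path_mgf_le_scale (x : R) i : 0 < x -> path_mgf x i.+1 <= (1 + x) * path_mgf x i.
Proof.
move=> x0; case: i => [|i]; first by rewrite /= mulr1 lerDl ltW.
by rewrite path_mgfSS mulrDl mul1r lerD2l ler_pM2l // path_mgf_leS.
Qed.

Lemma ln_ratio_ge (a b : R) : 0 < a -> 0 < b -> (b - a) / b <= ln b - ln a.
Proof.
move=> a0 b0; have ab0 : 0 < a / b by rewrite divr_gt0.
have : ln (a / b) <= a / b - 1.
  by rewrite -[X in ln X](subrKC 1) le_ln1Dx // ltrBrDr addNr.
rewrite ln_div ?posrE // mulrBl divff ?gt_eqF //; lra.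
Qed.

Lemma derivative_ge_gap (k j : nat) (s1 s2 : seq R) (M1 M2 : R -> R) :
  (forall y, M1 (y ^+ 2) ^+ 2 = \prod_(a <- s1) (1 + y ^+ 2 * a ^+ 2)) ->
  (forall y, M2 (y ^+ 2) ^+ 2 = \prod_(a <- s2) (1 + y ^+ 2 * a ^+ 2)) ->
  (forall x, 0 < x -> adjacent_mgf x (nseq k.+1 2%N) (j.+3 :: nseq k 2%N) <= M1 x) ->
  (forall x, 0 < x -> 0 < M2 x <=
     distant_mgf x j.+1 (nseq k.+1 2%N) (nseq k.+1 2%N)) ->
  forall y, 0 < y ->
    exists2 e, 2 * gap_integrand k%:R (fun x : R => path_mgf x j)
      (fun x : R => path_mgf x j.+1) y <= e &
    is_derive y 1 (fun y : R => coulson s1 y - coulson s2 y) e.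
Proof.
move=> E1 E2 ge1 le2 y y0.
eexists; last exact: is_derive1B (is_derive_coulson s1 y0) (is_derive_coulson s2 y0).
rewrite -E1 -E2 /gap_integrand.
have -> : y ^+ 4 = (y ^+ 2) ^+ 2 by rewrite -exprM.
have x0 : 0 < y ^+ 2 by rewrite exprn_gt0.
move: (y ^+ 2) x0 => x x0.
have [C C0 [Eb Eba]] := adjacent_distant_gap x0 k j.
have /andP[m20 m2] := le2 x x0; have m1 := ge1 x x0.
set a := adjacent_mgf _ _ _ in Eb Eba m1; set d := distant_mgf _ _ _ _ in Eba m2.
have g0 : 0 < gap_denominator k%:R x (path_mgf x j) (path_mgf x j.+1).
  by apply: gap_denominator_gt0; rewrite ?ler0n // ?ltW // path_mgf_gt0.
set g := gap_denominator _ _ _ _ in Eb g0 *.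
have a0 : 0 < a by rewrite Eb mulr_gt0.
have d0 : 0 < d := lt_le_trans m20 m2.
have m10 : 0 < M1 x := lt_le_trans a0 m1.
rewrite !lnXn // -mulrBl ler_pdivlMr // -mulrnBl -[leRHS]mulr_natl -[leLHS]mulrA
  ler_pM2l //.
apply: le_trans (_ : ln a - ln d <= _); last first.
  by rewrite lerB // ler_ln ?posrE.
apply: le_trans (ln_ratio_ge d0 a0).
rewrite Eba Eb le_eqVlt; apply/orP; left; apply/eqP.
by field; rewrite !gt_eqF.
Qed.

(** With [r] the square root of [k], the claim reads [0 < G * r ^+ 2 - J * r + d * G], and the last
    hypothesis makes the discriminant negative. *)
Lemma gap_threshold (k d J G : R) : 0 < k -> 0 < d -> 0 < G ->
  J ^+ 2 < 4 * d * G ^+ 2 -> k / (k + d) * J < Num.sqrt k * G.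
Proof.
move=> k0 d0 G0 disc; have r0 : 0 < Num.sqrt k by rewrite sqrtr_gt0.
have rr : k = Num.sqrt k ^+ 2 by rewrite sqr_sqrtr // ltW.
move: (Num.sqrt k) r0 rr => r r0 ->.
have q0 : 0 < r ^+ 2 + d by rewrite addr_gt0 // exprn_gt0.
rewrite mulrAC ltr_pdivrMr // -subr_gt0.
have -> : r * G * (r ^+ 2 + d) - r ^+ 2 * J =
    r / (4 * G) * ((2 * G * r - J) ^+ 2 + (4 * d * G ^+ 2 - J ^+ 2)).
  by field; rewrite gt_eqF.
by rewrite mulr_gt0 ?divr_gt0 ?mulr_gt0 // ltr_wpDl ?sqr_ge0 ?subr_gt0.
Qed.

Lemma near_zero_primitive2 (a0 a1 a2 : R) :
  near_zero_primitive a0 a1 a2 2 = 32 * (a0 + 4 * a1 + 16 * a2) / 2197.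
Proof. by rewrite /near_zero_primitive; field. Qed.

Lemma sum_norm_lt_distant (k j : nat) (s1 s2 : seq R) (M1 M2 : R -> R) :
  (5 < k)%N ->
  (forall y, M1 (y ^+ 2) ^+ 2 = \prod_(a <- s1) (1 + y ^+ 2 * a ^+ 2)) ->
  (forall y, M2 (y ^+ 2) ^+ 2 = \prod_(a <- s2) (1 + y ^+ 2 * a ^+ 2)) ->
  (forall x : R, 0 < x ->
     adjacent_mgf x (nseq k.+1 2%N) (j.+3 :: nseq k 2%N) <= M1 x) ->
  (forall x : R, 0 < x -> 0 < M2 x <=
     distant_mgf x j.+1 (nseq k.+1 2%N) (nseq k.+1 2%N)) ->
  \sum_(a <- s2) `|a| < \sum_(a <- s1) `|a|.
Proof.
move=> k5 E1 E2 ge1 le2; have der := derivative_ge_gap E1 E2 ge1 le2.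
have k6 : 6 <= k%:R :> R by rewrite ler_nat.
have k0 : 0 < k%:R :> R by apply: lt_le_trans k6; rewrite ltr0n.
have k4 : 4 <= k%:R :> R by apply: le_trans k6; rewrite ler_nat.
set u := fun x : R => path_mgf x j in der; set v := fun x : R => path_mgf x j.+1 in der.
have u0 x : 0 < x -> 0 < u x by move=> x0; apply: path_mgf_gt0.
have v0 x : 0 < x -> 0 < v x by move=> x0; apply: path_mgf_gt0.
have one0 (x : R) : 0 < x -> 0 < 1 :> R by [].
have lin1 (x : R) : 0 < x -> 0 < 1 + x by move=> x0; rewrite addr_gt0.
have lin2 (x : R) : 0 < x -> 0 < 1 + 2 * x by move=> x0; rewrite addr_gt0 ?mulr_gt0.
have quad (x : R) : 0 < x -> 0 < 1 + 3 * x + x ^+ 2.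
  by move=> x0; rewrite !addr_gt0 ?mulr_gt0 ?exprn_gt0.
have mid := gap_integrand_ge0 k6 u0 v0.
have pos (x : R) : k%:R <= x -> 0 < x by apply: lt_le_trans k0.
have K0 d : 0 <= k%:R / (k%:R + d%:R) :> R by rewrite divr_ge0 // addr_ge0.
clear ge1 le2.
(* The cases are [t = 3], [t = 4] and [t >= 5]. *)
move: @u @v u0 v0 der mid; case: j => [|[|i]] u v u0 v0 der mid.
- apply: (@sum_norm_lt_of_gap _ s1 s2 (gap_integrand k%:R u v) k%:R
    4 (21 / 10) (- 17 / 100) 1 (- 7 / 5) 1 0 (k%:R / (k%:R + 4))) => //; try lra.
  + move=> y; apply: (gap_integrand_near k6 u0 v0 one0 one0) => //.
    by move=> x; apply: near_zero_bound_3.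
  + move=> y; apply: (gap_integrand_far k6 u0 v0 one0 one0) => // x kx.
    have x0 := pos x kx; have b := far_bound_3 k6 kx.
    rewrite -(@ler_pM2l _ (x ^+ 2)) ?exprn_gt0 //.
    apply: le_trans (le_trans b _); rewrite le_eqVlt; apply/orP; left; apply/eqP.
      by ring.
    by rewrite /far_polynomial; field; rewrite gt_eqF.
  + move=> w /andP[w0 w1]; rewrite /far_integral; nra.
  + apply: gap_threshold => //; rewrite near_zero_primitive2 /far_integral; lra.
- apply: (@sum_norm_lt_of_gap _ s1 s2 (gap_integrand k%:R u v) k%:R
    3 (3 / 5) (- 1 / 20) (2 / 5) 0 0 0 (k%:R / (k%:R + 5))) => //; try lra.
  + move=> y; apply: (gap_integrand_near k6 u0 v0 one0 lin1).
      by move=> x _; rewrite /u /v /= mulr1 mul1r.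
    by move=> x; apply: near_zero_bound_4.
  + move=> y; apply: (gap_integrand_far k6 u0 v0 one0 lin1) => //.
      by move=> x _; rewrite /u /v /= mulr1 mul1r.
    move=> x kx; have b := far_bound_4 k6 kx.
    by rewrite /far_polynomial !mul0r !addr0.
  + move=> w /andP[w0 w1]; rewrite /far_integral; lra.
  + apply: gap_threshold => //; rewrite near_zero_primitive2 /far_integral; lra.
- have ratio x : 0 < x -> (1 + 2 * x) * v x <= u x * (1 + 3 * x + x ^+ 2) /\
      u x * (1 + 2 * x) <= (1 + x) * v x.
    move=> x0; rewrite /u /v !path_mgfSS.
    have := path_mgf_le_scale i x0; have := path_mgf_leS x0 i.
    move: (path_mgf x i) (path_mgf x i.+1) => a b ab ba.
    have x20 : 0 < x ^+ 2 by rewrite exprn_gt0.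
    (* The differences of the sides in the two claims are [x ^+ 2 * ((1 + x) * a - b)] and
       [x ^+ 2 * (b - a)]. *)
    rewrite -(ler_pM2l x20) in ab; rewrite -(ler_pM2l x20) in ba.
    by split; lra.
  apply: (@sum_norm_lt_of_gap _ s1 s2 (gap_integrand k%:R u v) k%:R
    (191 / 50) (133 / 100) (- 1 / 10) 1 (- 109 / 50) (27 / 10) (- 5 / 4)
    (k%:R / (k%:R + 5))) => //; try lra.
  + move=> y; apply: (gap_integrand_near k6 u0 v0 lin2 quad).
      by move=> x /ratio[].
    by move=> x; apply: near_zero_bound_5.
  + move=> y; apply: (gap_integrand_far k6 u0 v0 lin1 lin2) => //.
      by move=> x /ratio[].
    move=> x kx; have x0 := pos x kx; have b := far_bound_5 k6 kx.
    rewrite -(@ler_pM2l _ (x ^+ 3)) ?exprn_gt0 //.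
    apply: le_trans (le_trans b _); rewrite le_eqVlt; apply/orP; left; apply/eqP.
      by ring.
    by rewrite /far_polynomial; field; rewrite gt_eqF.
  + move=> w /andP[w0 w1]; rewrite /far_integral; nra.
  + apply: gap_threshold => //; rewrite near_zero_primitive2 /far_integral; lra.
Qed.

End DistantHubs.

(** * Comparison of energies *)

Section EnergyMonotone.
Local Open Scope ring_scope.
Variable R : realType.

Lemma sum_norm_lt_of_prod (s1 s2 : seq R) :
  (forall y : R, 0 < y -> \prod_(a <- s2) (1 + y ^+ 2 * a ^+ 2) <
     \prod_(a <- s1) (1 + y ^+ 2 * a ^+ 2)) ->
  \sum_(a <- s2) `|a| < \sum_(a <- s1) `|a|.
Proof.
move=> lt.
pose D (y : R) := coulson s1 y - coulson s2 y.
pose e (y : R) := ln (\prod_(a <- s1) (1 + y ^+ 2 * a ^+ 2)) / y ^+ 2 -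
  ln (\prod_(a <- s2) (1 + y ^+ 2 * a ^+ 2)) / y ^+ 2.
have dD (y : R) : 0 < y -> is_derive y 1 D (e y).
  by move=> y0; apply: is_derive1B; apply: is_derive_coulson.
have e0 (y : R) : 0 < y -> 0 < e y.
  move=> y0; rewrite /e -mulrBl divr_gt0 ?exprn_gt0 // subr_gt0.
  by rewrite ltr_ln ?posrE ?lt // prodr_gt0 // => a _; rewrite one_plus_sqr_gt0.
have incr (b c : R) : 0 < b -> b <= c -> D b <= D c.
  move=> b0 bc.
  rewrite -subr_ge0 -[0](subrr (0 : R)).
  apply: (@increment_le _ D (fun=> 0) e (fun=> 0) b c bc).
  - by move=> y /andP[yb _]; apply: dD; apply: lt_le_trans yb.
  - by move=> y /andP[yb _]; apply/ltW/e0; apply: lt_le_trans yb.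
(* [sum_norm_lt] asks for a uniform gap; the increase over [[1, 2]] provides it, and monotonicity
   preserves it. *)
have D12 : 0 < D 2 - D 1.
  rewrite subr_gt0.
  apply: (@increment_gt0 _ D e); first by lra.
  - by move=> y /andP[yb _]; apply: dD; lra.
  - by move=> y /andP[yb _]; apply: e0; lra.
apply: (sum_norm_lt D12 ltr01 (y2 := 2)) => y y' /andP[y0 y1] y2 _.
have := incr y 1 y0 y1; have := incr 2 y' (ltr0n _ 2) y2.
rewrite /D; lra.
Qed.

(** A further entry [e > 0] in [s1] makes the comparison strict and costs only [e], which is
    arbitrary. *)
Lemma sum_norm_le_of_prod (s1 s2 : seq R) :
  (forall y : R, 0 < y -> \prod_(a <- s2) (1 + y ^+ 2 * a ^+ 2) <=
     \prod_(a <- s1) (1 + y ^+ 2 * a ^+ 2)) ->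
  \sum_(a <- s2) `|a| <= \sum_(a <- s1) `|a|.
Proof.
move=> le; apply/ler_addgt0Pl => e e0.
have -> : e + \sum_(a <- s1) `|a| = \sum_(a <- e :: s1) `|a|.
  by rewrite big_cons gtr0_norm.
apply/ltW/sum_norm_lt_of_prod => y y0.
apply: le_lt_trans (le y y0) _; rewrite big_cons ltr_pMl.
  by rewrite ltrDl mulr_gt0 ?exprn_gt0.
by rewrite prodr_gt0 // => a _; rewrite one_plus_sqr_gt0.
Qed.

Lemma energy_lt (G H : sgraph) : is_acyclic G -> is_acyclic H ->
  (forall x : R, 0 < x -> mgf x [set: H] < mgf x [set: G]) ->
  energy R H < energy R G.
Proof.
move=> aG aH lt.
have [s -> Es] := energy_mgf R aG; have [r -> Er] := energy_mgf R aH.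
apply: sum_norm_lt_of_prod => y y0; rewrite -Es -Er.
have x0 : 0 < y ^+ 2 by rewrite exprn_gt0.
by rewrite ltr_pXn2r ?nnegrE ?lt // ltW ?mgf_gt0.
Qed.

Lemma energy_le (G H : sgraph) : is_acyclic G -> is_acyclic H ->
  (forall x : R, 0 < x -> mgf x [set: H] <= mgf x [set: G]) ->
  energy R H <= energy R G.
Proof.
move=> aG aH le.
have [s -> Es] := energy_mgf R aG; have [r -> Er] := energy_mgf R aH.
apply: sum_norm_le_of_prod => y y0; rewrite -Es -Er.
have x0 : 0 < y ^+ 2 by rewrite exprn_gt0.
by rewrite ler_pXn2r ?nnegrE ?le // ltW ?mgf_gt0.
Qed.

Lemma energy_lt_distant (G H : sgraph) (k j : nat) : (5 < k)%N ->
  is_acyclic G -> is_acyclic H ->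
  (forall x : R, 0 < x ->
     adjacent_mgf x (nseq k.+1 2%N) (j.+3 :: nseq k 2%N) <= mgf x [set: G]) ->
  (forall x : R, 0 < x -> mgf x [set: H] <=
     distant_mgf x j.+1 (nseq k.+1 2%N) (nseq k.+1 2%N)) ->
  energy R H < energy R G.
Proof.
move=> k5 aG aH ge le.
have [s -> Es] := energy_mgf R aG; have [r -> Er] := energy_mgf R aH.
apply: (@sum_norm_lt_distant R k j s r (fun x => mgf x [set: G])
  (fun x => mgf x [set: H]) k5 Es Er ge) => x x0.
by apply/andP; split; [exact: mgf_gt0 | exact: le].
Qed.

End EnergyMonotone.

(** * The extremal tree *)

Lemma T_b_legs_T_b (R : realFieldType) (x : R) m r a b : T_b_legs m r a b ->
  adjacent_mgf x a b = adjacent_mgf x (nseq m 2) (r.+2 :: nseq m.-1 2).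
Proof. by case/andP => pa pb; apply: adjacent_mgf_perm. Qed.

Lemma isomorphic_energy (R : realType) (G H : sgraph) :
  isomorphic G H -> is_acyclic G -> is_acyclic H -> energy R G = energy R H.
Proof.
case=> f bijf isof aG aH; apply/eqP; rewrite eq_le.
by rewrite !energy_le // => x _; rewrite (iso_mgfT bijf isof).
Qed.

Lemma energy_lt_T_b (R : realType) (k j : nat) (G : sgraph) : 5 < k ->
  two_max_tree (j.+3 + 4 * k.+2 - 4) k.+2 G ->
  isomorphic G (T_b k.+2 j.+3) \/ (energy R G < energy R (T_b k.+2 j.+3))%R.
Proof.
move=> k5 [[conG aG] cG maxG]; rewrite maxG => /eqP/cards2P[u [v [uv E]]].
have [Eu Ev] : degree u = k.+2 /\ degree v = k.+2.
  by split; apply/eqP; have := E; [move/setP/(_ u)|move/setP/(_ v)];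
    rewrite !inE eqxx ?orbT.
have D3 : 3 <= k.+2 by lia.
have [[_ aT] _ _ _] := two_max_tree_T_b D3 (isT : 2 <= j.+3).
have leT (x : R) : (0 < x)%R ->
    (adjacent_mgf x (nseq k.+1 2) (j.+3 :: nseq k 2) <=
     mgf x [set: T_b k.+2 j.+3])%R.
  by move=> x0; have := adjacent_mgf_le_T_b D3 (isT : 2 <= j.+3) x0; rewrite !subSS !subn0.
(* Four vertices for each of [k.+1] pairs of legs of size 2, then [t - 2 = j.+1] further vertices
   and the two hubs. *)
rewrite (_ : j.+3 + 4 * k.+2 - 4 = 4 * k.+1 + j.+1 + 2) in cG; last by lia.
have conu := connected_fromT u conG.
have [adjuv|nadj] := boolP (adj u v); last first.
  right; have [s [a [b [[sa sb] a1 b1 [s0 sab] le]]]] := distant_hubs aG R conu uv nadj.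
  rewrite Eu in sa; rewrite Ev in sb.
  apply: (energy_lt_distant k5 aT aG leT) => x x0.
  apply: le_trans (le x x0) (distant_mgf_le x0 sa sb a1 b1 s0 (ltn0Sn j) _).
  by apply/eqP; rewrite -(eqn_add2r 2) sab cG.
have [a [b [[sa sb] a1 b1 sab le]]] := adjacent_hubs aG R conu adjuv.
rewrite Eu in sa; rewrite Ev in sb.
have tot : legs_total k.+1 (4 * k.+1 + j.+1) a b.
  by split=> //; apply/eqP; rewrite -(eqn_add2r 2) sab cG.
have [legs|nlegs] := boolP (T_b_legs k.+1 j.+1 a b || T_b_legs k.+1 j.+1 b a); last first.
  right; apply: energy_lt => // x x0.
  apply: le_lt_trans (proj1 (le x x0)) (lt_le_trans _ (leT x x0)).
  by case: (adjacent_mgf_lt x0 tot) => // H; case/norP: nlegs; rewrite H.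
have Eab (x : R) : adjacent_mgf x a b = adjacent_mgf x (nseq k.+1 2) (j.+3 :: nseq k 2).
  by case/orP: legs => /(T_b_legs_T_b x); [| rewrite adjacent_mgfC].
(* One [x] with equality makes all branches paths, and the tree is [T_b]; if there is none,
   straightening is strict at every [x]. *)
have [[x [x0 Ex]]|strict] :=
  pselect (exists x : R, (0 < x)%R /\ mgf x [set: G] = adjacent_mgf x a b); last first.
  right; apply: energy_lt => // x x0.
  apply: lt_le_trans (leT x x0); rewrite -Eab lt_neqAle (proj1 (le x x0)) andbT.
  by apply/eqP => Ex; apply: strict; exists x.
left; have [A [B [La [Lb [AB spA spB]]]]] := (le x x0).2 Ex.
have cG' : #|G| = j.+3 + 4 * k.+2 - 4 by rewrite cG; lia.
case/orP: legs => legs.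
  by apply: (isomorphic_T_b D3 (isT : 2 <= j.+3) aG cG' AB adjuv spA spB); rewrite !subSS !subn0.
rewrite adj_sym in adjuv; rewrite setUC in AB.
by apply: (isomorphic_T_b D3 (isT : 2 <= j.+3) aG cG' AB adjuv spB spA); rewrite !subSS !subn0.
Qed.

Theorem theorem3p2 (R : realType) (Delta n : nat)
  (hDelta : 8 <= Delta) (ht : 3 <= n + 4 - 4 * Delta) :
  (forall G : sgraph,
     max_energy_tree R n Delta G -> most_2branches n Delta G) /\
  (forall G : sgraph,
     max_energy_tree R n Delta G <->
     isomorphic G (T_b Delta (n + 4 - 4 * Delta))).
Proof.
have [k k5 ED] : exists2 k, 5 < k & Delta = k.+2 by exists (Delta - 2); lia.
have [j Et] : exists j, n + 4 - 4 * Delta = j.+3.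
  by exists (n + 4 - 4 * Delta - 3); lia.
(* The subtraction in [n + 4 - 4 * Delta] is not truncated, since its value is at least 3. *)
have En : n = j.+3 + 4 * k.+2 - 4 by lia.
rewrite Et ED {}En {Delta hDelta ht ED Et n}.
have D3 : 3 <= k.+2 by lia.
have t2 : 2 <= j.+3 by [].
set n := j.+3 + _ - 4; set T := T_b _ _.
have tT : two_max_tree n k.+2 T := two_max_tree_T_b D3 t2.
have acyclic_of H : two_max_tree n k.+2 H -> is_acyclic H by case=> -[].
have maxT (G : sgraph) : max_energy_tree R n k.+2 G <-> isomorphic G T.
  split=> [[tG maxG]|isoG].
    have [//|] := energy_lt_T_b R k5 tG.
    by rewrite ltNge maxG.
  have [f bijf isof] := isoG.
  have tG : two_max_tree n k.+2 G := iso_two_max_tree bijf isof tT.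
  split=> // H tH.
  rewrite (isomorphic_energy R isoG (acyclic_of _ tG) (acyclic_of _ tT)).
  have [isoH|/ltW //] := energy_lt_T_b R k5 tH.
  by rewrite (isomorphic_energy R isoH (acyclic_of _ tH) (acyclic_of _ tT)).
split=> // G /[dup] -[tG _] /maxT[f bijf isof]; split=> //.
- exact: iso_two_branching bijf isof (two_branching_T_b D3 t2).
- move=> H tH bH; rewrite (iso_nb_2branches bijf isof).
  exact: leq_trans (nb_2branches_le D3 tH bH) (nb_2branches_T_b D3 t2).
Qed.
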